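(* Let $c>0$, $\Delta x,\Delta y>0$. The semi-discrete Active Flux method defined in the context is stationarity preserving for the two-dimensional linear acoustics system with Coriolis source terms. The discrete stationary state $q^X_{i,j}=(u^X_{i,j},v^X_{i,j},p^X_{i,j})$, $X\in\{A,E_H,E_V,N\}$, $i,j\in\mathbb{Z}$, of the method is characterized by the following relations (for all $i,j\in\mathbb{Z}$): $$c\,\frac{u^A_{i,j-1}+4u^A_{i,j}+u^A_{i,j+1}}{6}+\frac{p^A_{i,j+1}-p^A_{i,j-1}}{2\Delta y}=0,$$ $$c\,\frac{v^A_{i-1,j}+4v^A_{i,j}+v^A_{i+1,j}}{6}-\frac{p^A_{i+1,j}-p^A_{i-1,j}}{2\Delta x}=0,$$ $$c\,v^{E_H}_{i,j}-\frac{p^N_{i,j}-p^N_{i-1,j}}{\Delta x}=0,\qquad c\,u^{E_V}_{i,j}+\frac{p^N_{i,j}-p^N_{i,j-1}}{\Delta y}=0,$$ $$c\,\frac{u^N_{i,j+1}+u^N_{i,j}}{2}+\frac{p^N_{i,j+1}-p^N_{i,j}}{\Delta y}=0,\qquad c\,\frac{v^N_{i+1,j}+v^N_{i,j}}{2}-\frac{p^N_{i+1,j}-p^N_{i,j}}{\Delta x}=0,$$ $$c\,\frac{u^{E_H}_{i,j+1}+u^{E_H}_{i,j}}{2}+\frac{p^{E_H}_{i,j+1}-p^{E_H}_{i,j}}{\Delta y}=0,\qquad c\,\frac{v^{E_V}_{i+1,j}+v^{E_V}_{i,j}}{2}-\frac{p^{E_V}_{i+1,j}-p^{E_V}_{i,j}}{\Delta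 x}=0,$$ $$4(p^{E_V}_{i,j}+p^{E_V}_{i,j+1})-p^N_{i,j-1}-6p^N_{i,j}-p^N_{i,j+1}=0,$$ $$4(p^{E_H}_{i,j}+p^{E_H}_{i+1,j})-p^N_{i-1,j}-6p^N_{i,j}-p^N_{i+1,j}=0,$$ $$9(p^A_{i,j}+p^A_{i+1,j}+p^A_{i,j+1}+p^A_{i+1,j+1})-p^N_{i-1,j-1}-4p^N_{i-1,j}-p^N_{i-1,j+1}-4p^N_{i,j-1}-16p^N_{i,j}-4p^N_{i,j+1}-p^N_{i+1,j-1}-4p^N_{i+1,j}-p^N_{i+1,j+1}=0.$$
   Context: PDE: $\partial_t q+J_x\partial_x q+J_y\partial_y q=Sq$ for $q=(u,v,p)^T$, with $$J_x=\begin{pmatrix}0&0&1\\0&0&0\\1&0&0\end{pmatrix},\quad J_y=\begin{pmatrix}0&0&0\\0&0&1\\0&1&0\end{pmatrix},\quad S=\begin{pmatrix}0&c&0\\-c&0&0\\0&0&0\end{pmatrix}.$$ Its nontrivial stationary states are the geostrophic equilibria $\partial_x p=cv$, $\partial_y p=-cu$ (which imply $\partial_x u+\partial_y v=0$). Method. On a uniform Cartesian grid, the degrees of freedom attached to cell $(i,j)\in\mathbb{Z}^2$ are the cell average $q^A_{i,j}$, the horizontal-edge value $q^{E_H}_{i,j}$ (located at $(x_i,y_{j+1/2})$), the vertical-edge value $q^{E_V}_{i,j}$ (at $(x_{i+1/2},y_j)$) and the node value $q^N_{i,j}$ (at $(x_{i+1/2},y_{j+1/2})$). Cell averages evolve by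 $$\frac{d}{dt}q^A_{i,j}=-\frac{1}{\Delta x}(f^x_{i+1/2,j}-f^x_{i-1/2,j})-\frac{1}{\Delta y}(f^y_{i,j+1/2}-f^y_{i,j-1/2})+Sq^A_{i,j},$$ $f^x_{i+1/2,j}=\tfrac16J_x(q^N_{i,j}+4q^{E_V}_{i,j}+q^N_{i,j-1})$, $f^y_{i,j+1/2}=\tfrac16J_y(q^N_{i-1,j}+4q^{E_H}_{i,j}+q^N_{i,j})$. Point values ($P\in\{E_H,E_V,N\}$) evolve by $$\frac{d}{dt}q^P_{i,j}=-J_x^+D_x^+q^P_{i,j}-J_x^-D_x^-q^P_{i,j}-J_y^+D_y^+q^P_{i,j}-J_y^-D_y^-q^P_{i,j}+Sq^P_{i,j},$$ where $J^\pm$ are the positive/negative parts obtained by diagonalization, i.e. $J_x^\pm=\frac12(J_x\pm\mathrm{diag}(1,0,1))$, $J_y^\pm=\frac12(J_y\pm\mathrm{diag}(0,1,1))$, and Nodes: $D_x^+q^N_{i,j}=\frac{1}{\Delta x}(3q^N_{i,j}+q^N_{i-1,j}-4q^{E_H}_{i,j})$, $D_x^-q^N_{i,j}=\frac1{\Delta x}(-3q^N_{i,j}-q^N_{i+1,j}+4q^{E_H}_{i+1,j})$, $D_y^+q^N_{i,j}=\frac1{\Delta y}(3q^N_{i,j}+q^N_{i,j-1}-4q^{E_V}_{i,j})$, $D_y^-q^N_{i,j}=\frac1{\Delta y}(-3q^N_{i,j}-q^N_{i,j+1}+4q^{E_V}_{i,j+1})$. Vertical edges: $D_x^+q^{E_V}_{i,j}=\frac1{\Delta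 x}\big(4q^{E_V}_{i,j}+2q^{E_V}_{i-1,j}+q^{E_H}_{i,j}+q^{E_H}_{i,j-1}+\frac14(q^N_{i,j}+q^N_{i-1,j}+q^N_{i,j-1}+q^N_{i-1,j-1})-9q^A_{i,j}\big)$, $D_x^-q^{E_V}_{i,j}=\frac1{\Delta x}\big(-4q^{E_V}_{i,j}-2q^{E_V}_{i+1,j}-q^{E_H}_{i+1,j}-q^{E_H}_{i+1,j-1}-\frac14(q^N_{i,j}+q^N_{i+1,j}+q^N_{i,j-1}+q^N_{i+1,j-1})+9q^A_{i+1,j}\big)$, $D_y^\pm q^{E_V}_{i,j}=\frac1{\Delta y}(q^N_{i,j}-q^N_{i,j-1})$. Horizontal edges: $D_y^+q^{E_H}_{i,j}=\frac1{\Delta y}\big(4q^{E_H}_{i,j}+2q^{E_H}_{i,j-1}+q^{E_V}_{i,j}+q^{E_V}_{i-1,j}+\frac14(q^N_{i,j}+q^N_{i,j-1}+q^N_{i-1,j}+q^N_{i-1,j-1})-9q^A_{i,j}\big)$, $D_y^-q^{E_H}_{i,j}=\frac1{\Delta y}\big(-4q^{E_H}_{i,j}-2q^{E_H}_{i,j+1}-q^{E_V}_{i,j+1}-q^{E_V}_{i-1,j+1}-\frac14(q^N_{i,j}+q^N_{i,j+1}+q^N_{i-1,j}+q^N_{i-1,j+1})+9q^A_{i,j+1}\big)$, $D_x^\pm q^{E_H}_{i,j}=\frac1{\Delta x}(q^N_{i,j}-q^N_{i-1,j})$. Fourier transform: for $\boldsymbol k=(k_x,k_y)\in\mathbb{R}^2$,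 $t_x=\exp(\mathrm{i}k_x\Delta x)$, $t_y=\exp(\mathrm{i}k_y\Delta y)$, grid data are expressed as superpositions of modes $\hat q^X(t,\boldsymbol{k})\,t_x^it_y^j$; inserting such a mode into the method gives $\frac{d}{dt}\hat{\boldsymbol q}+\mathcal{E}(t_x,t_y)\hat{\boldsymbol q}=0$, $\hat{\boldsymbol q}=(\hat q^A,\hat q^{E_H},\hat q^{E_V},\hat q^N)$, which defines the evolution matrix $\mathcal{E}\in\mathbb{C}^{12\times12}$. A discrete stationary state is grid data kept stationary by the method (its Fourier transform lies in the kernel of $\mathcal{E}$). A method is called stationarity preserving if it discretizes all the analytical stationary states of the PDE; here this means that the method admits some discretization of the geostrophic equilibrium which it keeps stationary, and in Fourier space that the kernel of $\mathcal{E}$ is nontrivial for any choice of $t_x,t_y$ (i.e. of $\boldsymbol{k}$).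
   Formalization: The grid data are assumed bounded (exponentially growing stationary data violate the relations); relations ⇒ stationary is claimed only for data without modes t_x=-1 or t_y=-1, since e.g. u^N_{i,j}=(-1)^j, all else 0, satisfies the relations but is not stationary. *)

(* Defs.v *)
From HB Require Import structures.
From mathcomp Require Import all_boot all_order all_algebra.
From mathcomp Require Import ring complex.
From mathcomp Require Import all_classical all_reals all_analysis.
Import Order.TTheory GRing.Theory Num.Theory numFieldNormedType.Exports.

Set Implicit Arguments.
Unset Strict Implicit.
Unset Printing Implicit Defensive.

Local Open Scope ring_scope.
Local Open Scope complex_scope.

(* The degrees of freedom attached to a cell (i, j) of the grid:
   cell average (located at (x_i, y_j)), horizontal edge (x_i, y_{j+1/2}),
   vertical edge (x_{i+1/2}, y_j), node (x_{i+1/2}, y_{j+1/2}). *)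
Definition dA : 'I_4 := @Ordinal 4 0 isT.
Definition dEH : 'I_4 := @Ordinal 4 1 isT.
Definition dEV : 'I_4 := @Ordinal 4 2 isT.
Definition dN : 'I_4 := @Ordinal 4 3 isT.

Definition grid (K : Type) := 'I_4 -> int -> int -> 'cV[K]_3.

Definition mx3 (K : numFieldType) (s : seq (seq K)) : 'M[K]_3 :=
  \matrix_(a < 3, b < 3) nth 0 (nth [::] s a) b.

Definition Jx (K : numFieldType) : 'M[K]_3 :=
  mx3 [:: [:: 0; 0; 1]; [:: 0; 0; 0]; [:: 1; 0; 0]].
Definition Jy (K : numFieldType) : 'M[K]_3 :=
  mx3 [:: [:: 0; 0; 0]; [:: 0; 0; 1]; [:: 0; 1; 0]].
Definition Smx (K : numFieldType) (c : K) : 'M[K]_3 :=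
  mx3 [:: [:: 0; c; 0]; [:: - c; 0; 0]; [:: 0; 0; 0]].

Definition absJx (K : numFieldType) : 'M[K]_3 :=
  mx3 [:: [:: 1; 0; 0]; [:: 0; 0; 0]; [:: 0; 0; 1]].
Definition absJy (K : numFieldType) : 'M[K]_3 :=
  mx3 [:: [:: 0; 0; 0]; [:: 0; 1; 0]; [:: 0; 0; 1]].
Definition Jxp (K : numFieldType) : 'M[K]_3 := 2^-1 *: (Jx K + absJx K).
Definition Jxm (K : numFieldType) : 'M[K]_3 := 2^-1 *: (Jx K - absJx K).
Definition Jyp (K : numFieldType) : 'M[K]_3 := 2^-1 *: (Jy K + absJy K).
Definition Jym (K : numFieldType) : 'M[K]_3 := 2^-1 *: (Jy K - absJy K).

(* fx i j and fy i j are the fluxes through the edges (i+1/2, j) and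
   (i, j+1/2). *)
Definition fx (K : numFieldType) (q : grid K) (i j : int) : 'cV[K]_3 :=
  6^-1 *: (Jx K *m (q dN i j + 4 *: q dEV i j + q dN i (j - 1))).
Definition fy (K : numFieldType) (q : grid K) (i j : int) : 'cV[K]_3 :=
  6^-1 *: (Jy K *m (q dN (i - 1) j + 4 *: q dEH i j + q dN i j)).

Definition rhsA (K : numFieldType) (c dx dy : K) (q : grid K) (i j : int)
    : 'cV[K]_3 :=
  - (dx^-1 *: (fx q i j - fx q (i - 1) j))
  - dy^-1 *: (fy q i j - fy q i (j - 1)) + Smx c *m q dA i j.

Definition DxpN (K : numFieldType) (dx : K) (q : grid K) (i j : int) :=
  dx^-1 *: (3 *: q dN i j + q dN (i - 1) j - 4 *: q dEH i j).
Definition DxmN (K : numFieldType) (dx : K) (q : grid K) (i j : int) :=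
  dx^-1 *: (- (3 *: q dN i j) - q dN (i + 1) j + 4 *: q dEH (i + 1) j).
Definition DypN (K : numFieldType) (dy : K) (q : grid K) (i j : int) :=
  dy^-1 *: (3 *: q dN i j + q dN i (j - 1) - 4 *: q dEV i j).
Definition DymN (K : numFieldType) (dy : K) (q : grid K) (i j : int) :=
  dy^-1 *: (- (3 *: q dN i j) - q dN i (j + 1) + 4 *: q dEV i (j + 1)).

Definition DxpEV (K : numFieldType) (dx : K) (q : grid K) (i j : int) :=
  dx^-1 *: (4 *: q dEV i j + 2 *: q dEV (i - 1) j
    + q dEH i j + q dEH i (j - 1)
    + 4^-1 *: (q dN i j + q dN (i - 1) j + q dN i (j - 1)
               + q dN (i - 1) (j - 1))
    - 9 *: q dA i j).
Definition DxmEV (K : numFieldType) (dx : K) (q : grid K) (i j : int) :=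
  dx^-1 *: (- (4 *: q dEV i j) - 2 *: q dEV (i + 1) j
    - q dEH (i + 1) j - q dEH (i + 1) (j - 1)
    - 4^-1 *: (q dN i j + q dN (i + 1) j + q dN i (j - 1)
               + q dN (i + 1) (j - 1))
    + 9 *: q dA (i + 1) j).
Definition DyEV (K : numFieldType) (dy : K) (q : grid K) (i j : int) :=
  dy^-1 *: (q dN i j - q dN i (j - 1)).

Definition DypEH (K : numFieldType) (dy : K) (q : grid K) (i j : int) :=
  dy^-1 *: (4 *: q dEH i j + 2 *: q dEH i (j - 1)
    + q dEV i j + q dEV (i - 1) j
    + 4^-1 *: (q dN i j + q dN i (j - 1) + q dN (i - 1) j
               + q dN (i - 1) (j - 1))
    - 9 *: q dA i j).
Definition DymEH (K : numFieldType) (dy : K) (q : grid K) (i j : int) :=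
  dy^-1 *: (- (4 *: q dEH i j) - 2 *: q dEH i (j + 1)
    - q dEV i (j + 1) - q dEV (i - 1) (j + 1)
    - 4^-1 *: (q dN i j + q dN i (j + 1) + q dN (i - 1) j
               + q dN (i - 1) (j + 1))
    + 9 *: q dA i (j + 1)).
Definition DxEH (K : numFieldType) (dx : K) (q : grid K) (i j : int) :=
  dx^-1 *: (q dN i j - q dN (i - 1) j).

Definition rhsP (K : numFieldType) (c : K) (qP dxp dxm dyp dym : 'cV[K]_3)
    : 'cV[K]_3 :=
  - (Jxp K *m dxp) - Jxm K *m dxm - Jyp K *m dyp - Jym K *m dym
  + Smx c *m qP.

(* The semi-discrete method is d/dt q = af_rhs c dx dy q. *)
Definition af_rhs (K : numFieldType) (c dx dy : K) (q : grid K) : grid K :=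
  fun X i j =>
    if X == dA then rhsA c dx dy q i j
    else if X == dEH then
      rhsP c (q dEH i j) (DxEH dx q i j) (DxEH dx q i j)
                         (DypEH dy q i j) (DymEH dy q i j)
    else if X == dEV then
      rhsP c (q dEV i j) (DxpEV dx q i j) (DxmEV dx q i j)
                         (DyEV dy q i j) (DyEV dy q i j)
    else
      rhsP c (q dN i j) (DxpN dx q i j) (DxmN dx q i j)
                        (DypN dy q i j) (DymN dy q i j).

Definition stationary (K : numFieldType) (c dx dy : K) (q : grid K) : Prop :=
  forall X i j, af_rhs c dx dy q X i j = 0.

(* 'cV_12 as four blocks of three components, in the order (A, EH, EV, N). *)
Definition pack (K : numFieldType) (f : 'I_4 -> 'cV[K]_3) : 'cV[K]_(4 * 3) :=
  (mxvec (\matrix_(X < 4, a < 3) f X a 0))^T.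
Definition unpack (K : numFieldType) (w : 'cV[K]_(4 * 3)) (X : 'I_4)
    : 'cV[K]_3 :=
  (row X (vec_mx w^T))^T.

Definition mode (K : numFieldType) (tx ty : K) (qhat : 'cV[K]_(4 * 3))
    : grid K :=
  fun X i j => (tx ^ i * ty ^ j) *: unpack qhat X.

(* Column s is minus the right-hand side, at cell (0, 0), for the mode whose
   amplitude is the s-th unit vector; evolution_matrixP below shows that this
   is the matrix E of d/dt qhat + E qhat = 0. *)
Definition evolution_matrix (K : numFieldType) (c dx dy tx ty : K)
    : 'M[K]_(4 * 3) :=
  \matrix_(r, s)
    (- pack (fun X => af_rhs c dx dy (mode tx ty (delta_mx s 0)) X 0 0)) r 0.

Lemma af_rhs_linear (K : numFieldType) (c dx dy k : K) (q q' : grid K) X i j :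
  af_rhs c dx dy (fun X i j => k *: q X i j + q' X i j) X i j =
  k *: af_rhs c dx dy q X i j + af_rhs c dx dy q' X i j.
Proof.
pose lin (f : grid K -> 'cV[K]_3) := forall q q' : grid K,
  f (fun X i j => k *: q X i j + q' X i j) = k *: f q + f q'.
have linE Y m n : lin (fun q => q Y m n) by [].
have linD f g : lin f -> lin g -> lin (fun q => f q + g q).
  by move=> lf lg ? ?; rewrite lf lg scalerDr addrACA.
have linN f : lin f -> lin (fun q => - f q).
  by move=> lf ? ?; rewrite lf scalerN opprD.
have linZ a f : lin f -> lin (fun q => a *: f q).
  by move=> lf ? ?; rewrite lf scalerDr !scalerA mulrC.
have linM (A : 'M[K]_3) f : lin f -> lin (fun q => A *m f q).
  by move=> lf ? ?; rewrite lf mulmxDr -scalemxAr.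
suff : lin (fun q => af_rhs c dx dy q X i j) by exact.
rewrite /af_rhs /rhsA /rhsP /fx /fy /DxEH /DypEH /DymEH /DxpEV /DxmEV /DyEV.
rewrite /DxpN /DxmN /DypN /DymN.
case: (X == dA); last case: (X == dEH); last case: (X == dEV).
all: repeat first [exact (linE _ _ _) | refine (linD _ _ _ _)
  | refine (linN _ _) | refine (linZ _ _ _) | refine (linM _ _ _)].
Qed.

Lemma af_rhs_shift (K : numFieldType) (c dx dy : K) (q : grid K) (m n : int)
    X i j :
  af_rhs c dx dy (fun X i j => q X (i + m) (j + n)) X i j =
  af_rhs c dx dy q X (i + m) (j + n).
Proof.
rewrite /af_rhs /rhsA /rhsP /fx /fy /DxEH /DypEH /DymEH /DxpEV /DxmEV /DyEV.
rewrite /DxpN /DxmN /DypN /DymN.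
by rewrite ![i + m + _]addrAC ![j + n + _]addrAC.
Qed.

Lemma unpack_linear (K : numFieldType) (k : K) (w w' : 'cV[K]_(4 * 3)) X :
  unpack (k *: w + w') X = k *: unpack w X + unpack w' X.
Proof. by rewrite /unpack !linearP. Qed.

Lemma packK (K : numFieldType) (f : 'I_4 -> 'cV[K]_3) X :
  unpack (pack f) X = f X.
Proof. by rewrite /unpack /pack trmxK mxvecK; apply/colP => a; rewrite !mxE. Qed.

Lemma mode_linear (K : numFieldType) (tx ty k : K) (w w' : 'cV[K]_(4 * 3)) :
  mode tx ty (k *: w + w') =
  fun X i j => k *: mode tx ty w X i j + mode tx ty w' X i j.
Proof.
apply/funext => X; apply/funext => i; apply/funext => j.
by rewrite /mode unpack_linear scalerDr !scalerA [k * _]mulrC.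
Qed.

Lemma mode_rhs_shift (K : numFieldType) (c dx dy tx ty : K)
    (w : 'cV[K]_(4 * 3)) X i j : tx != 0 -> ty != 0 ->
  af_rhs c dx dy (mode tx ty w) X i j =
  (tx ^ i * ty ^ j) *: af_rhs c dx dy (mode tx ty w) X 0 0.
Proof.
move=> tx0 ty0; rewrite -[i in LHS]add0r -[j in LHS]add0r -af_rhs_shift.
have -> : (fun X i' j' => mode tx ty w X (i' + i) (j' + j)) =
    (fun X i' j' => (tx ^ i * ty ^ j) *: mode tx ty w X i' j' + (0 : 'cV[K]_3)).
  apply/funext => Y; apply/funext => i'; apply/funext => j'.
  by rewrite /mode addr0 scalerA !expfzDr //; congr (_ *: _); ring.
rewrite af_rhs_linear; have -> : af_rhs c dx dy (fun _ _ _ => 0) X 0 0 = 0.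
  rewrite -[RHS](addNr (af_rhs c dx dy (fun _ _ _ => 0) X 0 0)) -scaleN1r.
  rewrite -af_rhs_linear; congr (af_rhs c dx dy _ X 0 0).
  by apply/funext => Y; apply/funext => i'; apply/funext => j'; rewrite scaler0 addr0.
by rewrite addr0.
Qed.

Lemma evolution_matrixP (K : numFieldType) (c dx dy tx ty : K)
    (qhat : 'cV[K]_(4 * 3)) X i j : tx != 0 -> ty != 0 ->
  af_rhs c dx dy (mode tx ty qhat) X i j =
  mode tx ty (- (evolution_matrix c dx dy tx ty *m qhat)) X i j.
Proof.
move=> tx0 ty0; rewrite mode_rhs_shift // /mode; congr (_ *: _).
pose L (w : 'cV[K]_(4 * 3)) := pack (af_rhs c dx dy (mode tx ty w) ^~ 0 ^~ 0).
suff -> : evolution_matrix c dx dy tx ty *m qhat = - L qhat.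
  by rewrite opprK packK.
have LP k w w' : L (k *: w + w') = k *: L w + L w'.
  rewrite /L /pack mode_linear -!linearP/=; congr (mxvec _)^T.
  by apply/matrixP => Y a; rewrite !mxE af_rhs_linear !mxE.
have L0 : L 0 = 0 by have := LP (-1) 0 0; rewrite scaleN1r addNr scaleN1r addNr.
have LD w w' : L (w + w') = L w + L w' by rewrite -[w]scale1r LP !scale1r.
have LZ k w : L (k *: w) = k *: L w by rewrite -[k *: w]addr0 LP L0 addr0.
have Lsum (F : 'I_(4 * 3) -> 'cV[K]_(4 * 3)) :
    L (\sum_s F s) = \sum_s L (F s).
  by apply: (big_morph L LD L0).
have {2}-> : qhat = \sum_s qhat s 0 *: delta_mx s 0.
  by rewrite [LHS]matrix_sum_delta; apply: eq_bigr => s _; rewrite big_ord1.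
rewrite Lsum; apply/colP => r; rewrite !mxE summxE -sumrN; apply: eq_bigr => s _.
have -> : evolution_matrix c dx dy tx ty r s = - L (delta_mx s 0) r 0.
  by rewrite mxE [LHS]mxE.
by rewrite LZ [X in _ = - X]mxE mulNr mulrC.
Qed.

Definition expi (R : realType) (t : R) : R[i] := cos t +i* sin t.

Definition grid_x (R : realType) (dx : R) (X : 'I_4) (i : int) : R :=
  i%:~R * dx + (if (X == dEV) || (X == dN) then dx / 2 else 0).
Definition grid_y (R : realType) (dy : R) (X : 'I_4) (j : int) : R :=
  j%:~R * dy + (if (X == dEH) || (X == dN) then dy / 2 else 0).

Definition col3 (K : numFieldType) (u v p : K) : 'cV[K]_3 :=
  \col_(a < 3) nth 0 [:: u; v; p] a.

Definition geostrophic_equilibrium (R : realType) (c : R) (u v p : R -> R -> R)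
    : Prop :=
  [/\ continuous (fun z : R * R => u z.1 z.2),
      continuous (fun z : R * R => v z.1 z.2),
      (forall x y : R, is_derive x 1 (fun x' => p x' y) (c * v x y)) &
      (forall x y : R, is_derive y 1 (fun y' => p x y') (- (c * u x y)))].

(* Every geostrophic equilibrium is the limit, uniformly on bounded regions, of
   grid data that the method keeps exactly stationary.  Cell averages are
   compared with the value at the cell centre: as the equilibrium is
   continuous, this gives the same limit as comparing with its averages. *)
Definition discretizes_equilibria (R : realType) (c : R) : Prop :=
  forall u v p : R -> R -> R, geostrophic_equilibrium c u v p ->
  forall r eps : R, 0 < eps ->
  exists2 delta : R, 0 < delta &
  forall dx dy : R, 0 < dx < delta -> 0 < dy < delta ->
  exists2 q : grid R, stationary c dx dy q &
  forall (X : 'I_4) (i j : int),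
    let x := grid_x dx X i in let y := grid_y dy X j in
    `|x| <= r -> `|y| <= r ->
    forall a : 'I_3, `|q X i j a 0 - col3 (u x y) (v x y) (p x y) a 0| <= eps.

Definition kernel_nontrivial (R : realType) (c dx dy : R) : Prop :=
  forall kx ky : R,
  exists2 qhat : 'cV[R[i]]_(4 * 3), qhat != 0 &
    evolution_matrix c%:C dx%:C dy%:C (expi (kx * dx)) (expi (ky * dy))
      *m qhat = 0.

Definition stationarity_preserving (R : realType) (c : R) : Prop :=
  discretizes_equilibria c /\
  forall dx dy : R, 0 < dx -> 0 < dy -> kernel_nontrivial c dx dy.

Definition cu (K : numFieldType) (q : grid K) (X : 'I_4) (i j : int) : K :=
  q X i j (@Ordinal 3 0 isT) 0.
Definition cv (K : numFieldType) (q : grid K) (X : 'I_4) (i j : int) : K :=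
  q X i j (@Ordinal 3 1 isT) 0.
Definition cp (K : numFieldType) (q : grid K) (X : 'I_4) (i j : int) : K :=
  q X i j (@Ordinal 3 2 isT) 0.

Record discrete_equilibrium (K : numFieldType) (c dx dy : K) (q : grid K)
    : Prop := DiscreteEquilibrium {
  eq_uA : forall i j : int,
    c * ((cu q dA i (j - 1) + 4 * cu q dA i j + cu q dA i (j + 1)) / 6)
    + (cp q dA i (j + 1) - cp q dA i (j - 1)) / (2 * dy) = 0;
  eq_vA : forall i j : int,
    c * ((cv q dA (i - 1) j + 4 * cv q dA i j + cv q dA (i + 1) j) / 6)
    - (cp q dA (i + 1) j - cp q dA (i - 1) j) / (2 * dx) = 0;
  eq_vEH : forall i j : int,
    c * cv q dEH i j - (cp q dN i j - cp q dN (i - 1) j) / dx = 0;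
  eq_uEV : forall i j : int,
    c * cu q dEV i j + (cp q dN i j - cp q dN i (j - 1)) / dy = 0;
  eq_uN : forall i j : int,
    c * ((cu q dN i (j + 1) + cu q dN i j) / 2)
    + (cp q dN i (j + 1) - cp q dN i j) / dy = 0;
  eq_vN : forall i j : int,
    c * ((cv q dN (i + 1) j + cv q dN i j) / 2)
    - (cp q dN (i + 1) j - cp q dN i j) / dx = 0;
  eq_uEH : forall i j : int,
    c * ((cu q dEH i (j + 1) + cu q dEH i j) / 2)
    + (cp q dEH i (j + 1) - cp q dEH i j) / dy = 0;
  eq_vEV : forall i j : int,
    c * ((cv q dEV (i + 1) j + cv q dEV i j) / 2)
    - (cp q dEV (i + 1) j - cp q dEV i j) / dx = 0;
  eq_pEV : forall i j : int,
    4 * (cp q dEV i j + cp q dEV i (j + 1))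
    - cp q dN i (j - 1) - 6 * cp q dN i j - cp q dN i (j + 1) = 0;
  eq_pEH : forall i j : int,
    4 * (cp q dEH i j + cp q dEH (i + 1) j)
    - cp q dN (i - 1) j - 6 * cp q dN i j - cp q dN (i + 1) j = 0;
  eq_pA : forall i j : int,
    9 * (cp q dA i j + cp q dA (i + 1) j + cp q dA i (j + 1)
         + cp q dA (i + 1) (j + 1))
    - cp q dN (i - 1) (j - 1) - 4 * cp q dN (i - 1) j - cp q dN (i - 1) (j + 1)
    - 4 * cp q dN i (j - 1) - 16 * cp q dN i j - 4 * cp q dN i (j + 1)
    - cp q dN (i + 1) (j - 1) - 4 * cp q dN (i + 1) j - cp q dN (i + 1) (j + 1)
    = 0 }.

(* Superpositions of the modes t_x^i t_y^j with |t_x| = |t_y| = 1 are bounded.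
   Without any growth restriction the method also has exponentially growing
   stationary grid data, carried by modes off the unit circle, which violate
   the relations of discrete_equilibrium. *)
Definition bounded_grid (R : realType) (q : grid R[i]) : Prop :=
  exists M : R, forall (X : 'I_4) (i j : int) (a : 'I_3),
    `|q X i j a 0| <= M%:C.

(* No contribution of the grid-scale modes t_x = -1 or t_y = -1, expressed by
   vanishing means of (-1)^m q along grid lines.  It holds for every finite
   superposition of modes with t_x, t_y <> -1, and for all data vanishing at
   infinity.  It is needed because some relations of discrete_equilibrium are
   multiples of 1 + t_x or 1 + t_y: the data u^N_{i,j} = (-1)^j, all other
   values 0, satisfy all of them but are not stationary. *)
Definition no_gridscale_mode (R : realType) (q : grid R[i]) : Prop :=
  forall (X : 'I_4) (i j : int) (a : 'I_3) (eps : R), 0 < eps ->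
  exists n0 : nat, forall n : nat, (n0 <= n)%N ->
    `|\sum_(m < n) (-1) ^+ m * q X (i + m%:Z) j a 0| <= (n%:R * eps)%:C /\
    `|\sum_(m < n) (-1) ^+ m * q X i (j + m%:Z) a 0| <= (n%:R * eps)%:C.

(* Main.v *)
(* On the Fourier mode with half-cell phases C + i s and D + i t, replacing the
   cell averages by the cell centre values of Simpson's rule gives the nodes,
   the edges and the cells the same tensor product structure.  The upwind
   equations are then plane rotations, which eliminate everything but three
   unknowns at the node and one defect.  Subtracting the known stationary mode
   leaves two deviations x, y with (s t)(C D) x y <= 0, and a combination of
   the remaining equations that depends on the sign of (s t)(C D) gives
   x = y = 0.  Hence the evolution matrix with one extra row for the mean
   pressure is injective on the whole torus, and uniformly so by compactness.

   A bounded stationary grid function with p^A = 0 is periodized on a box;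
   Parseval's identity and the uniform injectivity bound its energy in the box
   by the energy near the boundary.  So the energy grows exponentially with the
   size of the box unless it vanishes.  If q is bounded and stationary, this
   applies to T q - E(36 p^A), where T has the symbol
   (1 / t_x + 4 + t_x) (1 / t_y + 4 + t_y) and E(phi) is an explicit family of
   stationary data with p^A = T phi / 36.  So T q = E(36 p^A) satisfies the
   discrete relations, and so does q since T is diagonally dominant.
   Conversely, the relations give (1 + t_x) (1 + t_y) q = E(4 p^N), and without
   grid-scale modes the factor can be cancelled in the stationarity equations.
   E also produces the discretizations of the geostrophic equilibria: with
   phi = p at the cell centres, all its components are convex combinations of
   values of p or of difference quotients of p. *)
Require Import Defs.
From mathcomp Require Import all_boot all_order all_algebra.
From mathcomp Require Import ring lra zify complex.
From mathcomp Require Import all_classical all_reals all_analysis.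
Import Order.TTheory GRing.Theory Num.Theory numFieldNormedType.Exports.

Set Implicit Arguments.
Unset Strict Implicit.
Unset Printing Implicit Defensive.
Local Open Scope ring_scope.
Local Open Scope complex_scope.

Notation ia := (@Ordinal 3 0 isT).
Notation ib := (@Ordinal 3 1 isT).
Notation ic := (@Ordinal 3 2 isT).

(** * The equations in components and the explicit stationary data *)

Lemma ord3_ind (P : 'I_3 -> Prop) : P ia -> P ib -> P ic -> forall u, P u.
Proof.
by move=> p0 p1 p2 [[|[|[|u]]] h] //;
  [rewrite (_ : Ordinal h = ia)|rewrite (_ : Ordinal h = ib)|rewrite (_ : Ordinal h =
    ic)] => //;
  exact/val_inj.
Qed.

Lemma col3_eta (K : numFieldType) (w : 'cV[K]_3) : w = col3 (w ia 0) (w ib 0) (w ic 0).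
Proof. by apply/colP => -[[|[|[|a]]] h] //; rewrite mxE /=; congr (w _ _);
  exact/val_inj. Qed.

Lemma mx3_mul (K : numFieldType) (s : seq (seq K)) (w : 'cV[K]_3) :
  let m a b := nth 0 (nth [::] s a) b in
  let r a := m a 0%N * w ia 0 + m a 1%N * w ib 0 + m a 2%N * w ic 0 in
  mx3 s *m w = col3 (r 0%N) (r 1%N) (r 2%N).
Proof.
move=> m r; rewrite {1}(col3_eta w); apply/colP => a.
rewrite !mxE !big_ord_recl big_ord0 !mxE /= /bump /= addr0 addrA.
by case: a => -[|[|[|a]]] h.
Qed.

Lemma col3D (K : numFieldType) (x y z x' y' z' : K) :
  col3 x y z + col3 x' y' z' = col3 (x + x') (y + y') (z + z').
Proof. by apply/colP => -[[|[|[|a]]] h]; rewrite !mxE. Qed.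

Lemma col3N (K : numFieldType) (x y z : K) : - col3 x y z = col3 (- x) (- y) (- z).
Proof. by apply/colP => -[[|[|[|a]]] h]; rewrite !mxE. Qed.

Lemma col3Z (K : numFieldType) (k x y z : K) : k *: col3 x y z = col3 (k * x) (k * y)
  (k * z).
Proof. by apply/colP => -[[|[|[|a]]] h]; rewrite !mxE. Qed.

Lemma col3_inj (K : numFieldType) (x y z x' y' z' : K) :
  x = x' -> y = y' -> z = z' -> col3 x y z = col3 x' y' z'.
Proof. by move=> -> -> ->. Qed.

Lemma col3_eq0 (K : numFieldType) (x y z : K) : col3 x y z = 0 <-> [/\ x = 0, y = 0 &
  z = 0].
Proof.
split=> [h|[-> -> ->]]; last by apply/colP => -[[|[|[|a]]] h]; rewrite !mxE.
by split; [have := congr1 (fun w : 'cV_3 => w ia 0) h | have := congr1 (fun w : 'cV_3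
  => w ib 0) h
  | have := congr1 (fun w : 'cV_3 => w ic 0) h]; rewrite !mxE.
Qed.

Lemma rhsA_col3 (K : numFieldType) (c dx dy : K) (q : grid K) (i j : int) :
  af_rhs c dx dy q dA i j =
  let F a k l := q dN k l a 0 + 4 * q dEV k l a 0 + q dN k (l - 1) a 0 in
  let G a k l := q dN (k - 1) l a 0 + 4 * q dEH k l a 0 + q dN k l a 0 in
  col3 (c * cv q dA i j - (F ic i j - F ic (i - 1) j) / (6 * dx))
       (- (c * cu q dA i j) - (G ic i j - G ic i (j - 1)) / (6 * dy))
       (- ((F ia i j - F ia (i - 1) j) / (6 * dx))
        - (G ib i j - G ib i (j - 1)) / (6 * dy)).
Proof.
rewrite /af_rhs eqxx /rhsA /fx /fy /Jx /Jy /Smx /cu /cv /=.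
rewrite ?(mx3_mul,col3D,col3N,col3Z) /=.
by rewrite !mxE /= !invfM; apply: col3_inj; ring.
Qed.

(** Upwind splitting: $J^+D^++J^-D^-=\frac12J(D^++D^-)+\frac12|J|(D^+-D^-)$, so each direction
    contributes a central term and a dissipative term. *)
Lemma rhsP_col3 (K : numFieldType) (c : K) (w gp gm hp hm : 'cV[K]_3) :
  rhsP c w gp gm hp hm =
  col3 (c * w ib 0 - (gp ic 0 + gm ic 0 + gp ia 0 - gm ia 0) / 2)
       (- (c * w ia 0) - (hp ic 0 + hm ic 0 + hp ib 0 - hm ib 0) / 2)
       (- ((gp ia 0 + gm ia 0 + gp ic 0 - gm ic 0) / 2)
        - (hp ib 0 + hm ib 0 + hp ic 0 - hm ic 0) / 2).
Proof.
rewrite /rhsP /Jxp /Jxm /Jyp /Jym /Jx /Jy /absJx /absJy /Smx.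
rewrite -?scalemxAl ?mulmxBl ?mulmxDl ?(mx3_mul,col3D,col3N,col3Z) /=.
by apply: col3_inj; ring.
Qed.

(** Along the edge both one-sided differences coincide, so the dissipative term in $x$ cancels and
    [h] is their sum; hence its factor 2. *)
Lemma rhsEH_col3 (K : numFieldType) (c dx dy : K) (q : grid K) (i j : int) :
  af_rhs c dx dy q dEH i j =
  let h a := 2 * (q dN i j a 0 - q dN (i - 1) j a 0) / dx in
  let s a k := 4 * q dEH i j a 0 + 2 * q dEH i (j + k) a 0
    + (q dN i j a 0 + q dN i (j + k) a 0 + q dN (i - 1) j a 0
       + q dN (i - 1) (j + k) a 0) / 4 in
  let gp a := (s a (- 1) + q dEV i j a 0 + q dEV (i - 1) j a 0
               - 9 * q dA i j a 0) / dy in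
  let gm a := (- s a 1 - q dEV i (j + 1) a 0 - q dEV (i - 1) (j + 1) a 0
               + 9 * q dA i (j + 1) a 0) / dy in
  col3 (c * cv q dEH i j - h ic / 2)
       (- (c * cu q dEH i j) - (gp ic + gm ic + gp ib - gm ib) / 2)
       (- (h ia / 2) - (gp ib + gm ib + gp ic - gm ic) / 2).
Proof.
rewrite /af_rhs /= rhsP_col3 /cu /cv; apply: col3_inj; rewrite !mxE; ring.
Qed.

Lemma rhsEV_col3 (K : numFieldType) (c dx dy : K) (q : grid K) (i j : int) :
  af_rhs c dx dy q dEV i j =
  let h a := 2 * (q dN i j a 0 - q dN i (j - 1) a 0) / dy in
  let s a k := 4 * q dEV i j a 0 + 2 * q dEV (i + k) j a 0
    + (q dN i j a 0 + q dN (i + k) j a 0 + q dN i (j - 1) a 0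
       + q dN (i + k) (j - 1) a 0) / 4 in
  let gp a := (s a (- 1) + q dEH i j a 0 + q dEH i (j - 1) a 0
               - 9 * q dA i j a 0) / dx in
  let gm a := (- s a 1 - q dEH (i + 1) j a 0 - q dEH (i + 1) (j - 1) a 0
               + 9 * q dA (i + 1) j a 0) / dx in
  col3 (c * cv q dEV i j - (gp ic + gm ic + gp ia - gm ia) / 2)
       (- (c * cu q dEV i j) - h ic / 2)
       (- (gp ia + gm ia + gp ic - gm ic) / 2 - h ib / 2).
Proof.
rewrite /af_rhs /= rhsP_col3 /cu /cv; apply: col3_inj; rewrite !mxE; ring.
Qed.

Lemma rhsN_col3 (K : numFieldType) (c dx dy : K) (q : grid K) (i j : int) :
  af_rhs c dx dy q dN i j =
  let gp a := (3 * q dN i j a 0 + q dN (i - 1) j a 0 - 4 * q dEH i j a 0) / dx in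
  let gm a := (- (3 * q dN i j a 0) - q dN (i + 1) j a 0
               + 4 * q dEH (i + 1) j a 0) / dx in
  let hp a := (3 * q dN i j a 0 + q dN i (j - 1) a 0 - 4 * q dEV i j a 0) / dy in
  let hm a := (- (3 * q dN i j a 0) - q dN i (j + 1) a 0
               + 4 * q dEV i (j + 1) a 0) / dy in
  col3 (c * cv q dN i j - (gp ic + gm ic + gp ia - gm ia) / 2)
       (- (c * cu q dN i j) - (hp ic + hm ic + hp ib - hm ib) / 2)
       (- (gp ia + gm ia + gp ic - gm ic) / 2 - (hp ib + hm ib + hp ic - hm ic) / 2).
Proof.
rewrite /af_rhs /= rhsP_col3 /cu /cv; apply: col3_inj; rewrite !mxE; ring.
Qed.

Lemma dofP (X : 'I_4) : [\/ X = dA, X = dEH, X = dEV | X = dN].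
Proof.
by case: X => -[|[|[|[|X]]]] h //; [apply: Or41|apply: Or42|apply: Or43|apply: Or44];
  exact/val_inj.
Qed.

Lemma col3_0 (K : numFieldType) (x y z : K) : col3 x y z ia 0 = x.
Proof. by rewrite mxE. Qed.
Lemma col3_1 (K : numFieldType) (x y z : K) : col3 x y z ib 0 = y.
Proof. by rewrite mxE. Qed.
Lemma col3_2 (K : numFieldType) (x y z : K) : col3 x y z ic 0 = z.
Proof. by rewrite mxE. Qed.

(* The stationary grid data generated by a potential phi at the cell centres:
   every component is a local difference expression, obtained by dividing the
   relations of discrete_equilibrium by (1 + t_x) (1 + t_y). *)
Definition equil (K : numFieldType) (c dx dy : K) (phi : int -> int -> K) : grid K :=
  fun X i j =>
  let sx (f : int -> int -> K) i j := f i j + f (i + 1) j in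
  let sy (f : int -> int -> K) i j := f i j + f i (j + 1) in
  let dfx (f : int -> int -> K) i j := f (i + 1) j - f i j in
  let dfy (f : int -> int -> K) i j := f i (j + 1) - f i j in
  let ddx (f : int -> int -> K) i j := f (i + 1) j - f (i - 1) j in
  let ddy (f : int -> int -> K) i j := f i (j + 1) - f i (j - 1) in
  let mx r (f : int -> int -> K) i j := f (i - 1) j + r * f i j + f (i + 1) j in
  let my r (f : int -> int -> K) i j := f i (j - 1) + r * f i j + f i (j + 1) in
  if X == dA then
    col3 (- ddy (mx 4 phi) i j / (12 * c * dy)) (ddx (my 4 phi) i j / (12 * c * dx))
         (mx 4 (my 4 phi) i j / 36)
  else if X == dEH then
    col3 (- dfy (mx 6 phi) i j / (8 * c * dy)) (ddx (sy phi) i j / (4 * c * dx))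
         (mx 6 (sy phi) i j / 16)
  else if X == dEV then
    col3 (- ddy (sx phi) i j / (4 * c * dy)) (dfx (my 6 phi) i j / (8 * c * dx))
         (my 6 (sx phi) i j / 16)
  else
    col3 (- dfy (sx phi) i j / (2 * c * dy)) (dfx (sy phi) i j / (2 * c * dx))
         (sx (sy phi) i j / 4).

(** Rewriting with this tuple brings composed index shifts to one syntactic form, so that [field]
    recognises equal grid values as the same atom. *)
Lemma shiftz (x : int) :
  (((x + 1 + 1)%R = (x + 2)%R) *
   ((x + 1 - 1)%R = (x)%R) *
   ((x - 1 + 1)%R = (x)%R) *
   ((x - 1 - 1)%R = (x - 2)%R) *
   ((x + 2 - 1)%R = (x + 1)%R) *
   ((x - 2 + 1)%R = (x - 1)%R))%type.
Proof. by do !split; ring. Qed.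

Lemma equil_stationary (K : numFieldType) (c dx dy : K) (phi : int -> int -> K) :
  c != 0 -> dx != 0 -> dy != 0 -> stationary c dx dy (equil c dx dy phi).
Proof.
move=> c0 dx0 dy0 X i j.
case: (dofP X) => ->.
- by rewrite rhsA_col3 /cu /cv /equil /= !(col3_0, col3_1, col3_2) !shiftz;
    apply/col3_eq0; split; field; rewrite ?c0 ?dx0 ?dy0.
- by rewrite rhsEH_col3 /cu /cv /equil /= !(col3_0, col3_1, col3_2) !shiftz;
    apply/col3_eq0; split; field; rewrite ?c0 ?dx0 ?dy0.
- by rewrite rhsEV_col3 /cu /cv /equil /= !(col3_0, col3_1, col3_2) !shiftz;
    apply/col3_eq0; split; field; rewrite ?c0 ?dx0 ?dy0.
- by rewrite rhsN_col3 /cu /cv /equil /= !(col3_0, col3_1, col3_2) !shiftz;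
    apply/col3_eq0; split; field; rewrite ?c0 ?dx0 ?dy0.
Qed.

Lemma equil_discrete (K : numFieldType) (c dx dy : K) (phi : int -> int -> K) :
  c != 0 -> dx != 0 -> dy != 0 -> discrete_equilibrium c dx dy (equil c dx dy phi).
Proof.
move=> c0 dx0 dy0; split=> i j.
all: rewrite /cu /cv /cp /equil /= !(col3_0, col3_1, col3_2) !shiftz.
all: by field; rewrite ?c0 ?dx0 ?dy0.
Qed.

(** * Stationary Fourier modes with vanishing mean pressure *)

Ltac pos := repeat first [assumption | by rewrite ltr0n | apply: mulr_gt0
  | apply: addr_gt0 | apply: exprn_gt0].

(** Certificate form of using a relation $a=b$: the multiplier [r] is supplied by hand, and the
    remaining identity is left to [ring] or [field]. *)
Lemma eq_of_multiple (R : comPzRingType) (x y r a b : R) :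
  a = b -> x - y = r * (a - b) -> x = y.
Proof. by move=> ->; rewrite subrr mulr0 => /subr0_eq. Qed.

(* The upwind equations for velocity and pressure form a rotation by the angle
   with cosine C and sine s acting on the values (P, U) at the cell centre. *)
Lemma upwind_rotation (R : realFieldType) (s C P U p u a b : R) :
  s ^+ 2 + C ^+ 2 = 1 ->
  s * (2 * P - C * p) + (1 + C ^+ 2) * u - 2 * C * U = a ->
  - (s * (2 * U - C * u)) + (1 + C ^+ 2) * p - 2 * C * P = b ->
  P = (2 * C * p - s * u + s * a - C * b) / 2 /\
  U = (s * p + 2 * C * u - C * a - s * b) / 2.
Proof.
move=> h <- <-; split.
  by apply: (eq_of_multiple (r := (C * p - 2 * P) / 2) h); field.
by apply: (eq_of_multiple (r := (C * u - 2 * U) / 2) h); field.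
Qed.

(** Multiplying the equation by $x$ gives $Px^2=Qxy\le 0$. *)
Lemma pos_kernel (R : realFieldType) (P Q x y : R) :
  0 < P -> 0 < Q -> x * y <= 0 -> P * x = Q * y -> x = 0 /\ y = 0.
Proof.
move=> P0 Q0 xy h.
have x0 : x = 0.
  apply/eqP; rewrite -sqrf_eq0 eq_le sqr_ge0 andbT -(pmulr_rle0 _ P0).
  by rewrite expr2 mulrA h -mulrA (mulrC y) pmulr_rle0.
split=> //; move: h; rewrite x0 mulr0 => /esym/eqP.
by rewrite mulf_eq0 gt_eqF //= => /eqP.
Qed.

(** Cramer's rule. *)
Lemma pair_kernel (R : realFieldType) (a b c d x y : R) :
  a * d - b * c != 0 -> a * x + b * y = 0 -> c * x + d * y = 0 -> x = 0 /\ y = 0.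
Proof.
move=> dt h1 h2; split; apply/eqP; rewrite -(mulrI_eq0 _ (mulfI dt)).
  have -> : (a * d - b * c) * x = d * (a * x + b * y) - b * (c * x + d * y) by ring.
  by rewrite h1 h2 !mulr0 subrr.
have -> : (a * d - b * c) * y = a * (c * x + d * y) - c * (a * x + b * y) by ring.
by rewrite h1 h2 !mulr0 subrr.
Qed.

(* x and y are the deviations of p and eps from the known kernel vector; since
   a b = (s t) (C D), the first equation forces a b x y <= 0. *)
Lemma deviation_eq0 (R : realFieldType) (k l a b S T x y : R) :
  0 < k -> 0 < l -> (a != 0) || (b != 0) -> S * T = a * b ->
  S * (k * l + 2) * x + 2 * (k * l) * T * y = 0 ->
  (3 * l * a + (3 - k * l) * b) * x + (l * (l - k) * a - k * (l ^+ 2 + 3) * b) * y = 0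
    ->
  ((k * l - 3) * a + 3 * k * b) * x + (k * (l - k) * b - l * (k ^+ 2 + 3) * a) * y = 0
    ->
  x = 0 /\ y = 0.
Proof.
move=> k0 l0 ab0 ST h0 h2 h1.
have kl0 : 0 < k * l by exact: mulr_gt0.
have abxy : a * b * (x * y) <= 0.
  have : (k * l + 2) * (a * b * (x * y)) = - (2 * (k * l) * (T * y) ^+ 2).
    by rewrite -ST; apply: (eq_of_multiple (r := T * y) h0); ring.
  move=> e; rewrite -(pmulr_rle0 _ (_ : 0 < k * l + 2)) ?e; last by lra.
  by rewrite oppr_le0 mulr_ge0 ?sqr_ge0 //; lra.
have [ab|ab|/eqP ab] := ltgtP (a * b) 0.
(* For $ab<0$ the combination $a(k\cdot$[h2]$-$[h1]$)$ has positive coefficients at both $x$ and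
   $y$, while $x(-y)\le 0$. *)
- have xy : x * - y <= 0 by rewrite mulrN oppr_le0 -(nmulr_rle0 _ ab).
  have a20 : 0 < a ^+ 2 by rewrite exprn_even_gt0 //=; apply: contraTN ab => /eqP ->;
    rewrite mul0r ltxx.
  have [||||-> /eqP] := @pos_kernel _ ((2 * (k * l) + 3) * a ^+ 2 - k * l * k * (a * b))
     (l * (k * l + 3) * a ^+ 2 - k * (k * l * l + 2 * k + l) * (a * b)) x (- y) => //.
  + have p1 : 0 < (2 * (k * l) + 3) * a ^+ 2 by pos.
    have p2 : 0 < k * l * k * - (a * b) by pos; rewrite oppr_gt0.
    lra.
  + have p1 : 0 < l * (k * l + 3) * a ^+ 2 by pos.
    have p2 : 0 < k * (k * l * l + 2 * k + l) * - (a * b). by pos; rewrite oppr_gt0.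
    lra.
  + apply/eqP; rewrite -subr_eq0; apply/eqP.
    transitivity (a * (k * ((3 * l * a + (3 - k * l) * b) * x + (l * (l - k) * a - k *
      (l ^+ 2 + 3) * b) * y)
      - (((k * l - 3) * a + 3 * k * b) * x + (k * (l - k) * b - l * (k ^+ 2 + 3) * a)
        * y))); first by ring.
    by rewrite h1 h2; ring.
  + by rewrite oppr_eq0 => /eqP ->.
(* For $ab>0$ the combination $a(3\cdot$[h2]$+l\cdot$[h1]$)$ has a positive coefficient at $x$ and a
   negative one at $y$, while $xy\le 0$. *)
- have xy : x * y <= 0 by rewrite -(pmulr_rle0 _ ab).
  have a20 : 0 < a ^+ 2 by rewrite exprn_even_gt0 //=; apply: contraTN ab => /eqP ->;
    rewrite mul0r ltxx.
  have l2 : 0 < l ^+ 2 by rewrite exprn_gt0.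
  apply: (@pos_kernel _ ((6 * l + k * l * l) * a ^+ 2 + 9 * (a * b))
     (k * l * (3 + k * l) * a ^+ 2 + k * (2 * l ^+ 2 + 9 + k * l) * (a * b)) x y) => //.
  + by pos.
  + by pos.
  + apply/eqP; rewrite -subr_eq0; apply/eqP.
    transitivity (a * (3 * ((3 * l * a + (3 - k * l) * b) * x + (l * (l - k) * a - k *
      (l ^+ 2 + 3) * b) * y)
      + l * (((k * l - 3) * a + 3 * k * b) * x + (k * (l - k) * b - l * (k ^+ 2 + 3) *
        a) * y))); first by ring.
    by rewrite h1 h2; ring.
have l2 : 0 < l ^+ 2 by rewrite exprn_gt0.
have k2 : 0 < k ^+ 2 by rewrite exprn_gt0.
have kkl : 0 < k * l * l ^+ 2 by rewrite mulr_gt0.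
have klk : 0 < k * l * k ^+ 2 by rewrite mulr_gt0.
have kl2 : 0 < (k * l) ^+ 2 by rewrite exprn_gt0.
(* For $ab=0$ exactly one of $a$, $b$ vanishes, and the determinant of [h2] and [h1] is a positive
   multiple of $b^2$ or a negative multiple of $a^2$. *)
move: ab; rewrite mulf_eq0; case: (eqVneq a 0) ab0 => [a0 /= b0 _|a0 _ /= /eqP b0].
  apply: (pair_kernel _ h2 h1); rewrite a0.
  have -> : (3 * l * 0 + (3 - k * l) * b) * (k * (l - k) * b - l * (k ^+ 2 + 3) * 0) -
   (l * (l - k) * 0 - k * (l ^+ 2 + 3) * b) * ((k * l - 3) * 0 + 3 * k * b) =
   b ^+ 2 * (3 * (k * l) + 2 * (k * l) ^+ 2 + 6 * k ^+ 2 + k * l * k ^+ 2) by ring.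
  by rewrite mulf_neq0 ?sqrf_eq0 // gt_eqF //; lra.
apply: (pair_kernel _ h2 h1); rewrite b0.
have -> : (3 * l * a + (3 - k * l) * 0) * (k * (l - k) * 0 - l * (k ^+ 2 + 3) * a) -
   (l * (l - k) * a - k * (l ^+ 2 + 3) * 0) * ((k * l - 3) * a + 3 * k * 0) =
   - (a ^+ 2 * (3 * (k * l) + 2 * (k * l) ^+ 2 + 6 * l ^+ 2 + k * l * l ^+ 2)) by ring.
by rewrite oppr_eq0 mulf_neq0 ?sqrf_eq0 // gt_eqF //; lra.
Qed.

(* Stationary Fourier modes in symmetric form: the values of a mode are taken
   relative to their positions, with velocities divided by the imaginary unit;
   C + i s and D + i t are the phases of half a cell, k = c dx / 2,
   l = c dy / 2, and Z is the cell centre value given by Simpson's rule. *)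
Lemma symmetric_mode_eq0 (R : realFieldType)
    (k l s C t D uN vN pN uE vE pE uV vV pV uZ vZ pZ : R) :
  0 < k -> 0 < l -> s ^+ 2 + C ^+ 2 = 1 -> t ^+ 2 + D ^+ 2 = 1 ->
  s * (2 * pE - C * pN) + (1 + C ^+ 2) * uN - 2 * C * uE - k * vN = 0 ->
  t * (2 * pV - D * pN) + (1 + D ^+ 2) * vN - 2 * D * vV + l * uN = 0 ->
  (- (s * (2 * uE - C * uN)) + (1 + C ^+ 2) * pN - 2 * C * pE) / k
    + (- (t * (2 * vV - D * vN)) + (1 + D ^+ 2) * pN - 2 * D * pV) / l = 0 ->
  s * (2 * pZ - C * pV) + (1 + C ^+ 2) * uV - 2 * C * uZ - k * vV = 0 ->
  t * pN + l * uV = 0 ->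
  (- (s * (2 * uZ - C * uV)) + (1 + C ^+ 2) * pV - 2 * C * pZ) / k - t * vN / l = 0 ->
  s * pN - k * vE = 0 ->
  t * (2 * pZ - D * pE) + (1 + D ^+ 2) * vE - 2 * D * vZ + l * uE = 0 ->
  (- (t * (2 * vZ - D * vE)) + (1 + D ^+ 2) * pE - 2 * D * pZ) / l - s * uN / k = 0 ->
  3 * s * (D * pN + 2 * pV) - k * (4 * vZ + 2 * C * vV + 2 * D * vE + C * D * vN) = 0 ->
  3 * t * (C * pN + 2 * pE) + l * (4 * uZ + 2 * C * uV + 2 * D * uE + C * D * uN) = 0 ->
  s * (D * uN + 2 * uV) / k + t * (C * vN + 2 * vE) / l = 0 ->
  4 * pZ + 2 * C * pV + 2 * D * pE + C * D * pN = 0 ->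
  [/\ [/\ uN = 0, vN = 0 & pN = 0], [/\ uE = 0, vE = 0 & pE = 0],
    [/\ uV = 0, vV = 0 & pV = 0] & [/\ uZ = 0, vZ = 0 & pZ = 0]].
Proof.
move=> k0 l0 sC tD N1 N2 N3 V1 V2 V3 H1 H2 H3 A1 A2 A3 PA.
have kN : k != 0 by rewrite gt_eqF.
have lN : l != 0 by rewrite gt_eqF.
(* The defect: the pressure equation at the node says that its $x$ part [e] and its $y$ part cancel.
   With [e] as an extra unknown, the $x$ equations and the $y$ equations are each a closed
   rotation. *)
pose e := (- (s * (2 * uE - C * uN)) + (1 + C ^+ 2) * pN - 2 * C * pE) / k.
have eV : (- (t * (2 * vV - D * vN)) + (1 + D ^+ 2) * pN - 2 * D * pV) / l = - e.
  by apply/eqP; rewrite -addr_eq0 addrC; apply/eqP.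
have fromdiv (x y m : R) : m != 0 -> x / m = y -> x = m * y.
  by move=> m0 <-; rewrite mulrC divfK.
have [pEE uEE] := upwind_rotation sC (subr0_eq N1) (fromdiv _ _ _ kN (erefl e)).
have N2' : t * (2 * pV - D * pN) + (1 + D ^+ 2) * vN - 2 * D * vV = - (l * uN).
  by apply/eqP; rewrite -addr_eq0; apply/eqP.
have [pVE vVE] := upwind_rotation tD N2' (fromdiv _ _ _ lN eV).
have uVE : uV = - (t * pN) / l.
  by apply: (mulfI lN); rewrite mulrC [RHS]mulrC divfK //; apply/eqP;
    rewrite -addr_eq0 mulrC addrC V2.
have vEE : vE = s * pN / k by apply: (mulfI kN);
  rewrite [RHS]mulrC divfK // (subr0_eq H1).
have [pZE uZE] := upwind_rotation sC (subr0_eq V1) (fromdiv _ _ _ kN (subr0_eq V3)).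
have H2' : t * (2 * pZ - D * pE) + (1 + D ^+ 2) * vE - 2 * D * vZ = - (l * uE).
  by apply/eqP; rewrite -addr_eq0; apply/eqP.
have [pZE' vZE] := upwind_rotation tD H2' (fromdiv _ _ _ lN (subr0_eq H3)).
have kl0 : k + l != 0 by rewrite gt_eqF // addr_gt0.
(* The edge velocities [uV] and [vE] are geostrophic in [pN], so their contributions to the discrete
   divergence cancel and a relation between the node velocities remains. *)
have {}A3 : s * D * l * uN + C * t * k * vN = 0.
  transitivity (k * l * (s * (D * uN + 2 * uV) / k + t * (C * vN + 2 * vE) / l));
    last by rewrite A3 mulr0.
  by rewrite uVE vEE; field; rewrite ?kN ?lN.
(* The centre pressure is obtained twice, from the vertical edge and from the horizontal edge; this
   is the compatibility condition, simplified with [A3]. *)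
have PZ : s * t * (k + l) * (k * l + 2) * pN + k * l * (k * l + 4) * (s * D * uN - C *
  t * vN)
    + 2 * (k * l) * C * D * (k + l) * e = 0.
  have := subrr pZ; rewrite {1}pZE pZE' uVE vEE vVE pVE uEE pEE => PZ.
  transitivity (4 * k * l * 0 + 2 * (k - l) * (s * D * l * uN + C * t * k * vN));
    last by rewrite A3; ring.
  rewrite -PZ; field; by rewrite ?kN ?lN.
have {}A2 : (3 * l * (s * D) + (3 - k * l) * (C * t)) * pN
   + (- (s * t * (l ^+ 2 + 3)) + C * D * l * (3 - k * l)) * uN
   + (s * t * (k - l) - 3 * C * D * k * l) * vN
   + (s * D * l * (l - k) - C * t * k * (l ^+ 2 + 3)) * e = 0.
  rewrite -A2 uZE vVE pVE uEE pEE uVE; field; by rewrite ?kN ?lN.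
have {}A1 : ((k * l - 3) * (s * D) + 3 * k * (C * t)) * pN
   + (s * t * (l - k) + 3 * C * D * k * l) * uN
   + (s * t * (k ^+ 2 + 3) + C * D * k * (3 - k * l)) * vN
   + (C * t * k * (l - k) - s * D * l * (k ^+ 2 + 3)) * e = 0.
  rewrite -[RHS]oppr0 -A1 vZE vVE pVE uEE pEE vEE; field; by rewrite ?kN ?lN.
have {}PA : (9 * C * D + s * t * (2 / l + k)) * pN + (- (3 * C * t * l) + s * k * D *
  l - s * D) * uN
   + (- (3 * C * t) + 3 * s * k * D - 2 * C * k * t / l) * vN
   + (3 * C * D * l + s * k * t * l - C * D * k) * e = 0.
  rewrite -PA pZE vVE pVE pEE uVE; field; by rewrite ?kN ?lN.
suff : [/\ uN = 0, vN = 0, pN = 0 & e = 0].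
  move=> [uN0 vN0 pN0 e0].
  have {}uVE : uV = 0 by rewrite uVE pN0; ring.
  have {}vEE : vE = 0 by rewrite vEE pN0; ring.
  have {}pEE : pE = 0 by rewrite pEE pN0 uN0 vN0 e0; ring.
  have {}uEE : uE = 0 by rewrite uEE pN0 uN0 vN0 e0; ring.
  have {}pVE : pV = 0 by rewrite pVE pN0 uN0 vN0 e0; ring.
  have {}vVE : vV = 0 by rewrite vVE pN0 uN0 vN0 e0; ring.
  have {}uZE : uZ = 0 by rewrite uZE pVE uVE vVE vN0; ring.
  have {}vZE : vZ = 0 by rewrite vZE pEE vEE uEE uN0; ring.
  have {}pZE : pZ = 0 by rewrite pZE pVE uVE vVE vN0; ring.
  by [].
move: PZ A1 A2 PA A3; clearbody e.
clear -k0 l0 sC tD kN lN kl0 => PZ A1 A2 PA A3.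
have kl1 : 0 < k * l by exact: mulr_gt0.
(* When both coefficients of [A3] vanish, $s^2+C^2=t^2+D^2=1$ leaves the constant mode $s=t=0$ and
   the checkerboard mode $C=D=0$. There the equations decouple and are solved directly. *)
have [|ab0] := boolP ((s * D == 0) && (C * t == 0)).
  rewrite !mulf_eq0 => /andP[/orP[]/eqP s0 /orP[]/eqP C0].
  - by move: sC; rewrite s0 C0; lra.
  - have {}sC : C ^+ 2 = 1 by move: sC; rewrite s0; lra.
    have {}tD : D ^+ 2 = 1 by move: tD; rewrite C0; lra.
    have C0' : C != 0 by rewrite -sqrf_eq0 sC oner_neq0.
    have D0' : D != 0 by rewrite -sqrf_eq0 tD oner_neq0.
    have e0 : e = 0.
      apply: (@mulfI _ (2 * (k * l) * C * D * (k + l)));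
        last by rewrite mulr0 -PZ s0 C0; ring.
      by rewrite !mulf_neq0 // pnatr_eq0.
    have [uN0 vN0] : uN = 0 /\ vN = 0.
      apply: (@pair_kernel _ (C * D * l * (3 - k * l)) (- 3 * C * D * k * l)
        (3 * C * D * k * l) (C * D * k * (3 - k * l))).
      + have -> : C * D * l * (3 - k * l) * (C * D * k * (3 - k * l)) - -3 * C * D * k
        * l * (3 * C * D * k * l)
          = C ^+ 2 * D ^+ 2 * (k * l * ((3 - k * l) ^+ 2 + 9 * (k * l))) by ring.
        by rewrite sC tD !mul1r gt_eqF // mulr_gt0 // ltr_wpDl ?sqr_ge0 // mulr_gt0
        ?ltr0n.
      + by rewrite -[RHS]A2 s0 C0 e0; ring.
      + by rewrite -[RHS]A1 s0 C0 e0; ring.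
    split=> //; apply: (@mulfI _ (9 * C * D));
      last by rewrite mulr0 -PA s0 C0 uN0 vN0 e0; ring.
    by rewrite !mulf_neq0 // pnatr_eq0.
  - have {}sC : s ^+ 2 = 1 by move: sC; rewrite C0; lra.
    have {}tD : t ^+ 2 = 1 by move: tD; rewrite s0; lra.
    have s0' : s != 0 by rewrite -sqrf_eq0 sC oner_neq0.
    have t0' : t != 0 by rewrite -sqrf_eq0 tD oner_neq0.
    have pN0 : pN = 0.
      apply: (@mulfI _ (s * t * (k + l) * (k * l + 2)));
        last by rewrite mulr0 -PZ s0 C0; ring.
      by rewrite !mulf_neq0 // gt_eqF //; pos.
    have [uN0 vN0] : uN = 0 /\ vN = 0.
      apply: (@pair_kernel _ (- (s * t * (l ^+ 2 + 3))) (s * t * (k - l)) (s * t * (l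
        - k)) (s * t * (k ^+ 2 + 3))).
      + have -> : - (s * t * (l ^+ 2 + 3)) * (s * t * (k ^+ 2 + 3)) - s * t * (k - l)
        * (s * t * (l - k))
          = - (s ^+ 2 * t ^+ 2 * ((k * l) ^+ 2 + 2 * k ^+ 2 + 2 * l ^+ 2 + 2 * (k * l)
        + 9)) by ring.
        by rewrite sC tD !mul1r oppr_eq0 gt_eqF //; pos.
      + by rewrite -[RHS]A2 s0 C0 pN0; ring.
      + by rewrite -[RHS]A1 s0 C0 pN0; ring.
    split=> //; apply: (@mulfI _ (s * k * t * l));
      last by rewrite mulr0 -PA s0 C0 uN0 vN0 pN0; ring.
    by rewrite !mulf_neq0.
  - by move: tD; rewrite s0 C0; lra.
have ab2 : (s * D) ^+ 2 + (C * t) ^+ 2 != 0.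
  by rewrite paddr_eq0 ?sqr_ge0 // !sqrf_eq0.
(* [A3] confines the node velocities to the line spanned by those of the known stationary mode,
   $(-Ct/l,\,sD/k)$; [z] is the amplitude along it, found by projection. *)
pose z := (k * (s * D) * vN - l * (C * t) * uN) / ((s * D) ^+ 2 + (C * t) ^+ 2).
have zE : z * ((s * D) ^+ 2 + (C * t) ^+ 2) = k * (s * D) * vN - l * (C * t) * uN.
  by rewrite /z divfK.
have uNE : uN = - (C * t * z) / l.
  apply: (mulfI (mulf_neq0 lN ab2)).
  transitivity (- (C * t * (z * ((s * D) ^+ 2 + (C * t) ^+ 2)))); last by field;
    rewrite lN.
  by rewrite zE; apply: (eq_of_multiple (r := s * D) A3); ring.
have vNE : vN = s * D * z / k.
  apply: (mulfI (mulf_neq0 kN ab2)).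
  transitivity (s * D * (z * ((s * D) ^+ 2 + (C * t) ^+ 2))); last by field; rewrite kN.
  by rewrite zE; apply: (eq_of_multiple (r := C * t) A3); ring.
clearbody z.
(* The stationary mode of amplitude [z] has $p^N=CDz$ and defect $stz/(kl)$; it drops out of [PZ],
   [A1] and [A2], which then involve the deviations alone. *)
pose x := pN - C * D * z; pose y := e - s * t * z / (k * l).
have pNE : pN = x + C * D * z by rewrite /x subrK.
have eE : e = y + s * t * z / (k * l) by rewrite /y subrK.
have [x0 y0] : x = 0 /\ y = 0.
  clearbody x y.
  apply: (@deviation_eq0 _ k l (s * D) (C * t) (s * t) (C * D)) => //.
  - by rewrite -negb_and.
  - by ring.
  - apply: (mulfI kl0); rewrite mulr0 -PZ uNE vNE pNE eE.
    by field; rewrite ?kN ?lN.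
  - by rewrite -[RHS]A2 uNE vNE pNE eE; field; rewrite ?kN ?lN.
  - by rewrite -[RHS]A1 uNE vNE pNE eE; field; rewrite ?kN ?lN.
(* For the pure stationary mode the mean pressure is a multiple of $(s^2+3C^2)(t^2+3D^2)z$. This is
   the symbol $4+t+t^{-1}$ in each direction up to a constant, which never vanishes. *)
have z0 : z = 0.
  apply: (@mulfI _ ((s ^+ 2 + 3 * C ^+ 2) * (t ^+ 2 + 3 * D ^+ 2))).
    have sq (a b : R) : a ^+ 2 + b ^+ 2 = 1 -> a ^+ 2 + 3 * b ^+ 2 != 0.
      by move=> h; rewrite gt_eqF //; have := sqr_ge0 b; lra.
    by rewrite mulf_neq0 ?sq.
  rewrite mulr0 -PA uNE vNE pNE eE x0 y0.
  by field; rewrite ?kN ?lN.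
by rewrite uNE vNE pNE eE x0 y0 z0; split; ring.
Qed.

(** * Complex phases and the reduction of Fourier modes to symmetric form *)

Lemma expiD (R : realType) (x y : R) : expi (x + y) = expi x * expi y.
Proof. by rewrite /expi sinD cosD; apply/eqP;
  rewrite eq_complex /= eqxx addrC eqxx. Qed.

Lemma expi0 (R : realType) : expi (0 : R) = 1.
Proof. by rewrite /expi sin0 cos0. Qed.

Lemma expi_neq0 (R : realType) (x : R) : expi x != 0.
Proof.
apply/eqP => h; have := oner_neq0 R[i].
by rewrite -(expi0 R) -(subrr x) expiD h mul0r eqxx.
Qed.

Lemma expiN (R : realType) (x : R) : expi (- x) = (expi x)^-1.
Proof. by apply: (mulfI (expi_neq0 x)); rewrite -expiD subrr expi0 mulfV // expi_neq0.
  Qed.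

Lemma expi_Re_Im (R : realType) (x : R) : expi x = (cos x)%:C + 'i * (sin x)%:C.
Proof. by rewrite [LHS]complexE. Qed.

Lemma expi_conj (R : realType) (x : R) : (expi x)^-1 = (cos x)%:C - 'i * (sin x)%:C.
Proof. by rewrite -expiN expi_Re_Im cosN sinN rmorphN mulrN. Qed.

Lemma cos_expi (R : realType) (x : R) : (cos x)%:C = (expi x + (expi x)^-1) / 2.
Proof. by rewrite expi_conj expi_Re_Im; field. Qed.

Lemma sin_expi (R : realType) (x : R) : (sin x)%:C = (expi x - (expi x)^-1) / (2 * 'i).
Proof. by rewrite expi_conj expi_Re_Im; field; rewrite neq0Ci. Qed.

(** The sine with ['i] in the numerator instead of the denominator. Since [field] treats ['i] as an
    atom, the velocity and pressure equations below each use the form in which ['i] cancels without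
    $i^2=-1$. *)
Lemma sin_expi_mulI (R : realType) (x : R) : (sin x)%:C = - ('i * (expi x - (expi
  x)^-1) / 2).
Proof.
rewrite expi_conj expi_Re_Im.
by apply: (eq_of_multiple (r := (sin x)%:C) (sqrCi R[i])); field.
Qed.

Lemma modeE (K : numFieldType) (tx ty : K) (w : 'cV[K]_(4 * 3)) X i j a :
  mode tx ty w X i j a 0 = tx ^ i * ty ^ j * unpack w X a 0.
Proof. by rewrite mxE. Qed.

Lemma exprz_unit (K : numFieldType) (t : K) :
  ((t ^ (0 : int) = 1)%R * (t ^ (0 + 1 : int) = t)%R * (t ^ (0 - 1 : int) = t^-1)%R
   * (t ^ (- 1 : int) = t^-1)%R * (t ^ (1 : int) = t)%R)%type.
Proof. by rewrite sub0r add0r expr0z expr1z exprN1. Qed.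

Lemma unpack_eq0 (K : numFieldType) (w : 'cV[K]_(4 * 3)) :
  (forall X a, unpack w X a 0 = 0) -> w = 0.
Proof.
move=> h; apply: (can_inj (@trmxK _ _ _)); apply: (can_inj (@vec_mxK _ _ _)).
by apply/matrixP => X a; have := h X a; rewrite trmx0 linear0 !mxE.
Qed.

(** All coefficients are real, so real and imaginary parts satisfy the real system separately. Each
    coefficient is a single embedded real, which lets an additive projection pass through it. *)
Lemma complex_symmetric_mode_eq0 (R : realType) (k l s C t D : R)
    (uN vN pN uE vE pE uV vV pV uZ vZ pZ : R[i]) :
  0 < k -> 0 < l -> s ^+ 2 + C ^+ 2 = 1 -> t ^+ 2 + D ^+ 2 = 1 ->
  (2 * s)%:C * pE + (- (s * C))%:C * pN + (1 + C ^+ 2)%:C * uN + (- (2 * C))%:C * uE +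
    (- k)%:C * vN = 0 ->
  (2 * t)%:C * pV + (- (t * D))%:C * pN + (1 + D ^+ 2)%:C * vN + (- (2 * D))%:C * vV +
    (l)%:C * uN = 0 ->
  (- (2 * s) / k)%:C * uE + (s * C / k)%:C * uN + ((1 + C ^+ 2) / k + (1 + D ^+ 2) /
    l)%:C * pN + (- (2 * C) / k)%:C * pE + (- (2 * t) / l)%:C * vV + (t * D / l)%:C *
      vN + (- (2 * D) / l)%:C * pV = 0 ->
  (2 * s)%:C * pZ + (- (s * C))%:C * pV + (1 + C ^+ 2)%:C * uV + (- (2 * C))%:C * uZ +
    (- k)%:C * vV = 0 ->
  (t)%:C * pN + (l)%:C * uV = 0 ->
  (- (2 * s) / k)%:C * uZ + (s * C / k)%:C * uV + ((1 + C ^+ 2) / k)%:C * pV + (- (2 *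
    C) / k)%:C * pZ + (- t / l)%:C * vN = 0 ->
  (s)%:C * pN + (- k)%:C * vE = 0 ->
  (2 * t)%:C * pZ + (- (t * D))%:C * pE + (1 + D ^+ 2)%:C * vE + (- (2 * D))%:C * vZ +
    (l)%:C * uE = 0 ->
  (- (2 * t) / l)%:C * vZ + (t * D / l)%:C * vE + ((1 + D ^+ 2) / l)%:C * pE + (- (2 *
    D) / l)%:C * pZ + (- s / k)%:C * uN = 0 ->
  (3 * s * D)%:C * pN + (6 * s)%:C * pV + (- (4 * k))%:C * vZ + (- (2 * k * C))%:C *
    vV + (- (2 * k * D))%:C * vE + (- (k * C * D))%:C * vN = 0 ->
  (3 * t * C)%:C * pN + (6 * t)%:C * pE + (4 * l)%:C * uZ + (2 * l * C)%:C * uV + (2 *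
    l * D)%:C * uE + (l * C * D)%:C * uN = 0 ->
  (s * D / k)%:C * uN + (2 * s / k)%:C * uV + (t * C / l)%:C * vN + (2 * t / l)%:C *
    vE = 0 ->
  (4)%:C * pZ + (2 * C)%:C * pV + (2 * D)%:C * pE + (C * D)%:C * pN = 0 ->
  [/\ [/\ uN = 0, vN = 0 & pN = 0], [/\ uE = 0, vE = 0 & pE = 0],
    [/\ uV = 0, vV = 0 & pV = 0] & [/\ uZ = 0, vZ = 0 & pZ = 0]].
Proof.
move=> k0 l0 sC tD N1 N2 N3 V1 V2 V3 H1 H2 H3 A1 A2 A3 PA.
have part (f : {additive R[i] -> R}) : (forall x z, f (x%:C * z) = x * f z) ->
    [/\ [/\ f uN = 0, f vN = 0 & f pN = 0], [/\ f uE = 0, f vE = 0 & f pE = 0],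
    [/\ f uV = 0, f vV = 0 & f pV = 0] & [/\ f uZ = 0, f vZ = 0 & f pZ = 0]].
  move=> fZ; have fE x y : x = y -> f x = f y by move=> ->.
  move/fE: N1; rewrite !(raddfD f) !fZ raddf0 => N1.
  move/fE: N2; rewrite !(raddfD f) !fZ raddf0 => N2.
  move/fE: N3; rewrite !(raddfD f) !fZ raddf0 => N3.
  move/fE: V1; rewrite !(raddfD f) !fZ raddf0 => V1.
  move/fE: V2; rewrite !(raddfD f) !fZ raddf0 => V2.
  move/fE: V3; rewrite !(raddfD f) !fZ raddf0 => V3.
  move/fE: H1; rewrite !(raddfD f) !fZ raddf0 => H1.
  move/fE: H2; rewrite !(raddfD f) !fZ raddf0 => H2.
  move/fE: H3; rewrite !(raddfD f) !fZ raddf0 => H3.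
  move/fE: A1; rewrite !(raddfD f) !fZ raddf0 => A1.
  move/fE: A2; rewrite !(raddfD f) !fZ raddf0 => A2.
  move/fE: A3; rewrite !(raddfD f) !fZ raddf0 => A3.
  move/fE: PA; rewrite !(raddfD f) !fZ raddf0 => PA.
  apply: (symmetric_mode_eq0 k0 l0 sC tD).
  - by rewrite -[RHS]N1; ring.
  - by rewrite -[RHS]N2; ring.
  - by rewrite -[RHS]N3; ring.
  - by rewrite -[RHS]V1; ring.
  - by rewrite -[RHS]V2; ring.
  - by rewrite -[RHS]V3; ring.
  - by rewrite -[RHS]H1; ring.
  - by rewrite -[RHS]H2; ring.
  - by rewrite -[RHS]H3; ring.
  - by rewrite -[RHS]A1; ring.
  - by rewrite -[RHS]A2; ring.
  - by rewrite -[RHS]A3; ring.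
  - by rewrite -[RHS]PA; ring.
have re := part (@complex.Re R) _; have im := part (@complex.Im R) _.
have {re}[|[u1 v1 p1] [u2 v2 p2] [u3 v3 p3] [u4 v4 p4]] := re.
  by move=> x [y z] /=; rewrite mul0r subr0.
have {im}[|[u1' v1' p1'] [u2' v2' p2'] [u3' v3' p3'] [u4' v4' p4']] := im.
  by move=> x [y z] /=; rewrite mul0r addr0.
by split; split; apply/eqP; rewrite eq_complex /= ?(u1, v1, p1, u2, v2, p2, u3, v3,
  p3, u4, v4, p4) ?(u1', v1', p1', u2', v2', p2', u3', v3', p3', u4', v4', p4') eqxx.
Qed.

(** The kernel of $\mathcal E$ contains no nonzero vector of zero mean pressure. The angles are
    written as [a + a] and [b + b] so that the half-cell phases are [expi a] and [expi b]. *)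
Lemma evolution_matrix_injective (R : realType) (c dx dy a b : R) (w : 'cV[R[i]]_(4 *
  3)) :
  0 < c -> 0 < dx -> 0 < dy ->
  evolution_matrix c%:C dx%:C dy%:C (expi (a + a)) (expi (b + b)) *m w = 0 ->
  unpack w dA ic 0 = 0 -> w = 0.
Proof.
move=> c0 dx0 dy0 Ew pA.
have st X : af_rhs c%:C dx%:C dy%:C (mode (expi (a + a)) (expi (b + b)) w) X 0 0 = 0.
  by rewrite evolution_matrixP ?expi_neq0 // Ew oppr0 /mode /unpack !linear0.
have qE X i j u : mode (expi (a + a)) (expi (b + b)) w X i j u 0 =
    expi (a + a) ^ i * expi (b + b) ^ j * unpack w X u 0 by exact: modeE.
apply: unpack_eq0; move: pA.
move: (mode _ _ w) (unpack w) qE st => q W qE st WA.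
have := st dA; rewrite rhsA_col3 /cu /cv => /col3_eq0[];
  rewrite /= !qE !exprz_unit => A1 A2 A3.
have := st dEH; rewrite rhsEH_col3 /cu /cv => /col3_eq0[];
  rewrite /= !qE !exprz_unit => H1 H2 H3.
have := st dEV; rewrite rhsEV_col3 /cu /cv => /col3_eq0[];
  rewrite /= !qE !exprz_unit => V1 V2 V3.
have := st dN; rewrite rhsN_col3 /cu /cv => /col3_eq0[];
  rewrite /= !qE !exprz_unit => N1 N2 N3.
move: A1 A2 A3 H1 H2 H3 V1 V2 V3 N1 N2 N3;
  rewrite !expiD => A1 A2 A3 H1 H2 H3 V1 V2 V3 N1 N2 N3.
have ex0 := expi_neq0 a; have ey0 := expi_neq0 b.
have i0 : 'i != 0 :> R[i] := neq0Ci _.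
have [s1 s2 C1] := And3 (sin_expi a) (sin_expi_mulI a) (cos_expi a).
have [t1 t2 D1] := And3 (sin_expi b) (sin_expi_mulI b) (cos_expi b).
have sC := cos2Dsin2 a; have tD := cos2Dsin2 b.
rewrite addrC in sC; rewrite addrC in tD.
move: ex0 ey0 s1 s2 C1 t1 t2 D1 sC tD A1 A2 A3 H1 H2 H3 V1 V2 V3 N1 N2 N3.
move: (expi a) (expi b) (sin a) (cos a) (sin b) (cos b) => ex ey s C t D ex0 ey0 s1 s2
  C1 t1 t2 D1 sC tD.
have cC0 : c%:C != 0 :> R[i] by rewrite fmorph_eq0 gt_eqF.
have dxC0 : dx%:C != 0 :> R[i] by rewrite fmorph_eq0 gt_eqF.
have dyC0 : dy%:C != 0 :> R[i] by rewrite fmorph_eq0 gt_eqF.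
have scale (z y : R[i]) : y != 0 -> z = y * (z / y) by move=> y0; rewrite mulrC divfK.
(* Amplitudes are taken relative to the position of the degree of freedom, by removing its half-cell
   phases, and velocities are divided by ['i]. *)
pose uN := W dN ia 0 / ('i * (ex * ey)).
have uNE : W dN ia 0 = 'i * (ex * ey) * uN by apply: scale; rewrite ?mulf_neq0.
pose vN := W dN ib 0 / ('i * (ex * ey)).
have vNE : W dN ib 0 = 'i * (ex * ey) * vN by apply: scale; rewrite ?mulf_neq0.
pose pN := W dN ic 0 / (ex * ey).
have pNE : W dN ic 0 = ex * ey * pN by apply: scale; rewrite ?mulf_neq0.
pose uE := W dEH ia 0 / ('i * (ey)).
have uEE : W dEH ia 0 = 'i * (ey) * uE by apply: scale; rewrite ?mulf_neq0.
pose vE := W dEH ib 0 / ('i * (ey)).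
have vEE : W dEH ib 0 = 'i * (ey) * vE by apply: scale; rewrite ?mulf_neq0.
pose pE := W dEH ic 0 / (ey).
have pEE : W dEH ic 0 = ey * pE by apply: scale; rewrite ?mulf_neq0.
pose uV := W dEV ia 0 / ('i * (ex)).
have uVE : W dEV ia 0 = 'i * (ex) * uV by apply: scale; rewrite ?mulf_neq0.
pose vV := W dEV ib 0 / ('i * (ex)).
have vVE : W dEV ib 0 = 'i * (ex) * vV by apply: scale; rewrite ?mulf_neq0.
pose pV := W dEV ic 0 / (ex).
have pVE : W dEV ic 0 = ex * pV by apply: scale; rewrite ?mulf_neq0.
(* Simpson's rule with weights $16,4,1$ over $36$, solved for the centre value: on a mode the
   average is $(4Z+2CV+2DE+CDN)/9$. *)
pose uZ := (9 * (W dA ia 0 / 'i) - 2 * C%:C * uV - 2 * D%:C * uE - C%:C * D%:C * uN) /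
  4.
have uZE : W dA ia 0 = 'i * (4 * uZ + 2 * C%:C * uV + 2 * D%:C * uE + C%:C * D%:C *
  uN) / 9.
  by rewrite /uZ; field; rewrite ?i0.
pose vZ := (9 * (W dA ib 0 / 'i) - 2 * C%:C * vV - 2 * D%:C * vE - C%:C * D%:C * vN) /
  4.
have vZE : W dA ib 0 = 'i * (4 * vZ + 2 * C%:C * vV + 2 * D%:C * vE + C%:C * D%:C *
  vN) / 9.
  by rewrite /vZ; field; rewrite ?i0.
pose pZ := (9 * (W dA ic 0) - 2 * C%:C * pV - 2 * D%:C * pE - C%:C * D%:C * pN) / 4.
have pZE : W dA ic 0 = (4 * pZ + 2 * C%:C * pV + 2 * D%:C * pE + C%:C * D%:C * pN) / 9.
  by rewrite /pZ; field; rewrite ?i0.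
clearbody uN vN pN uE vE pE uV vV pV uZ vZ pZ.
rewrite pZE in WA; rewrite ?uNE ?vNE ?pNE ?uEE ?vEE ?pEE ?uVE ?vVE ?pVE ?uZE ?vZE ?pZE.
move=> A1 A2 A3 H1 H2 H3 V1 V2 V3 N1 N2 N3.
pose k := c * dx / 2; pose l := c * dy / 2.
suff [[uN0 vN0 pN0] [uE0 vE0 pE0] [uV0 vV0 pV0] [uZ0 vZ0 pZ0]] :
  [/\ [/\ uN = 0, vN = 0 & pN = 0], [/\ uE = 0, vE = 0 & pE = 0],
    [/\ uV = 0, vV = 0 & pV = 0] & [/\ uZ = 0, vZ = 0 & pZ = 0]].
{ move=> X; have [->|->|->|->] := dofP X; apply: ord3_ind.
  all: rewrite ?uZE ?vZE ?pZE ?uEE ?vEE ?pEE ?uVE ?vVE ?pVE ?uNE ?vNE ?pNE.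
  all: by rewrite ?(uN0, vN0, pN0, uE0, vE0, pE0, uV0, vV0, pV0, uZ0, vZ0, pZ0); ring. }
apply: (@complex_symmetric_mode_eq0 _ k l s C t D) => //;
  rewrite ?divr_gt0 ?mulr_gt0 // /k /l.
- apply: (eq_of_multiple (r := - (dx%:C / (2 * 'i * ex * ey))) N1).
  by rewrite ?(rmorphD, rmorphM, rmorphN, rmorphXn, rmorph_nat, rmorph1, fmorphV) /=
    ?s1 ?t1 ?C1 ?D1; field; rewrite ?cC0 ?dxC0 ?dyC0 ?ex0 ?ey0 ?i0.
- apply: (eq_of_multiple (r := - (dy%:C / (2 * 'i * ex * ey))) N2).
  by rewrite ?(rmorphD, rmorphM, rmorphN, rmorphXn, rmorph_nat, rmorph1, fmorphV) /=
    ?s1 ?t1 ?C1 ?D1; field; rewrite ?cC0 ?dxC0 ?dyC0 ?ex0 ?ey0 ?i0.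
- apply: (eq_of_multiple (r := - (c%:C * ex * ey)^-1) N3).
  by rewrite ?(rmorphD, rmorphM, rmorphN, rmorphXn, rmorph_nat, rmorph1, fmorphV) /=
    ?s2 ?t2 ?C1 ?D1; field; rewrite ?cC0 ?dxC0 ?dyC0 ?ex0 ?ey0 ?i0.
- apply: (eq_of_multiple (r := - (dx%:C / (2 * 'i * ex))) V1).
  by rewrite ?(rmorphD, rmorphM, rmorphN, rmorphXn, rmorph_nat, rmorph1, fmorphV) /=
    ?s1 ?t1 ?C1 ?D1; field; rewrite ?cC0 ?dxC0 ?dyC0 ?ex0 ?ey0 ?i0.
- apply: (eq_of_multiple (r := - (dy%:C / (2 * 'i * ex))) V2).
  by rewrite ?(rmorphD, rmorphM, rmorphN, rmorphXn, rmorph_nat, rmorph1, fmorphV) /=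
    ?s1 ?t1 ?C1 ?D1; field; rewrite ?cC0 ?dxC0 ?dyC0 ?ex0 ?ey0 ?i0.
- apply: (eq_of_multiple (r := - (c%:C * ex)^-1) V3).
  by rewrite ?(rmorphD, rmorphM, rmorphN, rmorphXn, rmorph_nat, rmorph1, fmorphV) /=
    ?s2 ?t2 ?C1 ?D1; field; rewrite ?cC0 ?dxC0 ?dyC0 ?ex0 ?ey0 ?i0.
- apply: (eq_of_multiple (r := - (dx%:C / (2 * 'i * ey))) H1).
  by rewrite ?(rmorphD, rmorphM, rmorphN, rmorphXn, rmorph_nat, rmorph1, fmorphV) /=
    ?s1 ?t1 ?C1 ?D1; field; rewrite ?cC0 ?dxC0 ?dyC0 ?ex0 ?ey0 ?i0.
- apply: (eq_of_multiple (r := - (dy%:C / (2 * 'i * ey))) H2).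
  by rewrite ?(rmorphD, rmorphM, rmorphN, rmorphXn, rmorph_nat, rmorph1, fmorphV) /=
    ?s1 ?t1 ?C1 ?D1; field; rewrite ?cC0 ?dxC0 ?dyC0 ?ex0 ?ey0 ?i0.
- apply: (eq_of_multiple (r := - (c%:C * ey)^-1) H3).
  by rewrite ?(rmorphD, rmorphM, rmorphN, rmorphXn, rmorph_nat, rmorph1, fmorphV) /=
    ?s2 ?t2 ?C1 ?D1; field; rewrite ?cC0 ?dxC0 ?dyC0 ?ex0 ?ey0 ?i0.
- apply: (eq_of_multiple (r := - (9 * dx%:C / (2 * 'i))) A1).
  by rewrite ?(rmorphD, rmorphM, rmorphN, rmorphXn, rmorph_nat, rmorph1, fmorphV) /=
    ?s1 ?t1 ?C1 ?D1; field; rewrite ?cC0 ?dxC0 ?dyC0 ?ex0 ?ey0 ?i0.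
- apply: (eq_of_multiple (r := - (9 * dy%:C / (2 * 'i))) A2).
  by rewrite ?(rmorphD, rmorphM, rmorphN, rmorphXn, rmorph_nat, rmorph1, fmorphV) /=
    ?s1 ?t1 ?C1 ?D1; field; rewrite ?cC0 ?dxC0 ?dyC0 ?ex0 ?ey0 ?i0.
- apply: (eq_of_multiple (r := 3 / c%:C) A3).
  by rewrite ?(rmorphD, rmorphM, rmorphN, rmorphXn, rmorph_nat, rmorph1, fmorphV) /=
    ?s2 ?t2 ?C1 ?D1; field; rewrite ?cC0 ?dxC0 ?dyC0 ?ex0 ?ey0 ?i0.
- by apply: (eq_of_multiple (r := 9) WA);
  rewrite ?(rmorphD, rmorphM, rmorphN, rmorphXn, rmorph_nat, rmorph1, fmorphV) /=;
    field.
Qed.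

(** * Locality and coercivity of the evolution matrix *)

Definition nsq (R : realType) (z : R[i]) : R := complex.Re z ^+ 2 + complex.Im z ^+ 2.
Definition vsq (R : realType) n (w : 'cV[R[i]]_n) : R := \sum_r nsq (w r 0).

Lemma nsq_ge0 (R : realType) (z : R[i]) : 0 <= nsq z.
Proof. by rewrite addr_ge0 ?sqr_ge0. Qed.

Lemma nsqM (R : realType) (x y : R[i]) : nsq (x * y) = nsq x * nsq y.
Proof. by case: x y => [a b] [c d]; rewrite /nsq /=; ring. Qed.

Lemma nsqN (R : realType) (x : R[i]) : nsq (- x) = nsq x.
Proof. by case: x => [a b]; rewrite /nsq /= !sqrrN. Qed.

Lemma nsqD (R : realType) (x y : R[i]) : nsq (x + y) <= 2 * nsq x + 2 * nsq y.
Proof.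
case: x y => [a b] [c d]; rewrite /nsq /=.
by have := sqr_ge0 (a - c); have := sqr_ge0 (b - d); lra.
Qed.

Lemma nsq0 (R : realType) : nsq (0 : R[i]) = 0.
Proof. by rewrite /nsq /= expr0n addr0. Qed.

Lemma nsq_eq0 (R : realType) (z : R[i]) : nsq z = 0 -> z = 0.
Proof.
case: z => [a b] /eqP; rewrite /nsq /= paddr_eq0 ?sqr_ge0 // !sqrf_eq0.
by move=> /andP[/eqP -> /eqP ->].
Qed.

Lemma nsqE (R : realType) (z : R[i]) : (nsq z)%:C = z * z^*.
Proof.
case: z => a b; apply/eqP; rewrite eq_complex /=; apply/andP; split; apply/eqP;
  rewrite /nsq /=; ring.
Qed.

Lemma vsq_ge0 (R : realType) n (w : 'cV[R[i]]_n) : 0 <= vsq w.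
Proof. by rewrite sumr_ge0 // => r _; exact: nsq_ge0. Qed.

Lemma vsq0 (R : realType) n : vsq (0 : 'cV[R[i]]_n) = 0.
Proof. by rewrite /vsq big1 // => r _; rewrite mxE nsq0. Qed.

Lemma vsqD (R : realType) n (v w : 'cV[R[i]]_n) : vsq (v + w) <= 2 * vsq v + 2 * vsq w.
Proof. by rewrite /vsq !mulr_sumr -big_split ler_sum // => r _; rewrite mxE nsqD. Qed.

Lemma vsqN (R : realType) n (w : 'cV[R[i]]_n) : vsq (- w) = vsq w.
Proof. by apply: eq_bigr => r _; rewrite mxE nsqN. Qed.

Lemma vsqZ (R : realType) n k (w : 'cV[R[i]]_n) : vsq (k *: w) = nsq k * vsq w.
Proof. by rewrite /vsq mulr_sumr; apply: eq_bigr => r _; rewrite mxE nsqM. Qed.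

Lemma vsq_eq0 (R : realType) n (w : 'cV[R[i]]_n) : vsq w = 0 -> w = 0.
Proof.
move=> /eqP; rewrite psumr_eq0 => [/allP h|r _]; last exact: nsq_ge0.
apply/colP => r; rewrite mxE; apply/nsq_eq0/eqP.
exact: (implyP (h r (mem_index_enum r)) isT).
Qed.

Lemma nsq_sum (R : realType) n (F : 'I_n -> R[i]) :
  nsq (\sum_i F i) <= 2 ^+ n * \sum_i nsq (F i).
Proof.
elim: n F => [|n IH] F; first by rewrite !big_ord0 nsq0 mulr0.
rewrite !big_ord_recl (le_trans (nsqD _ _)) // [leRHS]mulrDr exprS; apply: lerD.
  by rewrite ler_wpM2r ?nsq_ge0 // ler_peMr // exprn_ege1 // ler1n.
by rewrite -mulrA ler_wpM2l.
Qed.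

Lemma vsqM (R : realType) m n (A : 'M[R[i]]_(m, n)) :
  exists2 K : R, 0 <= K & forall w : 'cV_n, vsq (A *m w) <= K * vsq w.
Proof.
exists (\sum_r \sum_s 2 ^+ n * nsq (A r s)) => [|w].
  by rewrite sumr_ge0 // => r _; rewrite sumr_ge0 // => s _;
    rewrite mulr_ge0 ?nsq_ge0 ?exprn_ge0.
rewrite mulr_suml ler_sum // => r _; rewrite mxE (le_trans (nsq_sum _)) //.
rewrite mulr_sumr mulr_suml ler_sum // => s _; rewrite nsqM mulrA ler_wpM2l //.
  by rewrite mulr_ge0 ?nsq_ge0 ?exprn_ge0.
by rewrite /vsq (bigD1 s) //= lerDl sumr_ge0 // => ? _; exact: nsq_ge0.
Qed.

Definition gsq (R : realType) (q : grid R[i]) (i j : int) : R := \sum_X vsq (q X i j).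
Definition gsq_nbr (R : realType) (q : grid R[i]) (i j : int) : R :=
  \sum_(k < 3) \sum_(l < 3) gsq q (i + k%:Z - 1) (j + l%:Z - 1).

Lemma gsq_ge0 (R : realType) (q : grid R[i]) i j : 0 <= gsq q i j.
Proof. by rewrite sumr_ge0 // => X _; exact: vsq_ge0. Qed.

(** By translation invariance only cell $(0,0)$ matters, and there the right-hand side is built by
    linear operations from values in the $3\times3$ block of neighbours. The constant is crude but
    independent of the data and the cell. *)
Lemma af_rhs_local (R : realType) (c dx dy : R[i]) :
  exists2 K : R, 0 <= K &
  forall q i j, gsq (af_rhs c dx dy q) i j <= K * gsq_nbr q i j.
Proof.
pose loc (F : grid R[i] -> 'cV[R[i]]_3) := exists2 K : R, 0 <= K &
  forall q, vsq (F q) <= K * gsq_nbr q 0 0.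
suff H X : loc (fun q => af_rhs c dx dy q X 0 0).
  have [K KP] := choice (fun X => let: ex_intro2 K K0 KP := H X in
    ex_intro (fun K => 0 <= K /\ forall q, vsq (af_rhs c dx dy q X 0 0) <= K * gsq_nbr
      q 0 0) K (conj K0 KP)).
  exists (\sum_X K X) => [|q i j]; first by rewrite sumr_ge0 // => X _; have [] := KP X.
  rewrite mulr_suml ler_sum // => X _; have [_ /(_ (fun X i' j' => q X (i' + i) (j' +
    j)))] := KP X.
  rewrite af_rhs_shift !add0r; congr (_ <= _ * _).
  by do 2!apply: eq_bigr => ? _; rewrite /gsq !add0r ![_ - 1 + _]addrC !addrA.
have locE Y (m n : int) : (`|m| <= 1)%N -> (`|n| <= 1)%N -> loc (fun q => q Y m n).
  have nbrE (x : int) : (`|x| <= 1)%N -> exists k : 'I_3, x = k%:Z - 1.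
    by case: x => -[|[|x]] // _; [exists 1|exists 2|exists 0].
  move=> /nbrE[{}m ->] /nbrE[{}n ->].
  exists 1 => // q; rewrite mul1r /gsq_nbr (bigD1 m) //= (bigD1 n) //= !add0r -addrA.
  rewrite {1}/gsq (bigD1 Y) //= -addrA lerDl !addr_ge0 //.
  - by rewrite sumr_ge0 // => ? _; exact: vsq_ge0.
  - by rewrite sumr_ge0 // => ? _; exact: gsq_ge0.
  - by rewrite sumr_ge0 // => ? _; rewrite sumr_ge0 // => ? _; exact: gsq_ge0.
have locD f g : loc f -> loc g -> loc (fun q => f q + g q).
  move=> [a a0 fa] [b b0 gb]; exists (2 * a + 2 * b) => [|q].
    by rewrite addr_ge0 ?mulr_ge0.
  by rewrite (le_trans (vsqD _ _)) // [leRHS]mulrDl -!mulrA lerD // ler_wpM2l.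
have locN f : loc f -> loc (fun q => - f q).
  by move=> [a a0 fa]; exists a => // q; rewrite vsqN.
have locZ k f : loc f -> loc (fun q => k *: f q).
  move=> [a a0 fa]; exists (nsq k * a) => [|q]; first by rewrite mulr_ge0 ?nsq_ge0.
  by rewrite vsqZ -mulrA ler_wpM2l ?nsq_ge0.
have locM (A : 'M[R[i]]_3) f : loc f -> loc (fun q => A *m f q).
  move=> [a a0 fa]; have [b b0 Ab] := vsqM A; exists (b * a) => [|q];
    first by rewrite mulr_ge0.
  by rewrite (le_trans (Ab _)) // -mulrA ler_wpM2l.
rewrite /af_rhs /rhsA /rhsP /fx /fy /DxEH /DypEH /DymEH /DxpEV /DxmEV /DyEV.
rewrite /DxpN /DxmN /DypN /DymN.
case: (X == dA); [|case: (X == dEH); [|case: (X == dEV)]]; repeat match goal with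
  | |- loc (fun q => @?F q + @?G q) => refine (locD F G _ _)
  | |- loc (fun q => - @?F q) => refine (locN F _)
  | |- loc (fun q => ?k *: @?F q) => refine (locZ k F _)
  | |- loc (fun q => ?A *m @?F q) => refine (locM A F _)
  | |- loc (fun q => q ?Y ?m ?n) => exact (locE Y m n isT isT)
  end.
Qed.

(** * Continuity in the phases and uniform injectivity by compactness *)

Local Open Scope classical_set_scope.

Lemma expiMz (R : realType) (x : R) (k : int) : expi x ^ k = expi (k%:~R * x).
Proof.
have expn n : expi x ^+ n = expi (n%:R * x).
  elim: n => [|n IH]; first by rewrite mul0r expi0.
  by rewrite exprS IH -expiD [in RHS]mulrS mulrDl mul1r.
case: k => n; first by rewrite -[LHS]/(expi x ^+ n) expn.
by rewrite NegzE -[LHS]/((expi x ^+ n.+1)^-1) expn -expiN mulrNz mulNr.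
Qed.

Lemma nsq_expi_modeB (R : realType) (x y x' y' : R) (i j : int) :
  let a := i%:~R * x + j%:~R * y in let b := i%:~R * x' + j%:~R * y' in
  nsq (expi x ^ i * expi y ^ j - expi x' ^ i * expi y' ^ j) =
  (cos a - cos b) ^+ 2 + (sin a - sin b) ^+ 2.
Proof. by move=> a b; rewrite !expiMz -!expiD. Qed.

Lemma near_expi (R : realType) (i j : int) (z0 : R * R) (e : R) : 0 < e ->
  \forall z \near z0, nsq (expi z.1 ^ i * expi z.2 ^ j - expi z0.1 ^ i * expi z0.2 ^
    j) < e.
Proof.
move=> e0; pose f (z : R * R) : R := i%:~R * z.1 + j%:~R * z.2.
have cf : f z @[z --> z0] --> f z0.
  by apply: cvgD; apply: cvgM; [exact: cvg_cst|exact: cvg_fst|exact: cvg_cst|exact: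
    cvg_snd].
have ccos : cos (f z) @[z --> z0] --> cos (f z0) by exact: cvg_comp cf
  (@continuous_cos R _).
have csin : sin (f z) @[z --> z0] --> sin (f z0) by exact: cvg_comp cf
  (@continuous_sin R _).
have cc : (cos (f z) - cos (f z0)) ^+ 2 + (sin (f z) - sin (f z0)) ^+ 2 @[z --> z0]
  --> (0 : R).
  have -> : (0 : R) = (cos (f z0) - cos (f z0)) ^+ 2 + (sin (f z0) - sin (f z0)) ^+ 2.
    by rewrite !subrr expr0n addr0.
  by apply: cvgD; rewrite expr2; apply: cvgM; apply: cvgB => //; exact: cvg_cst.
have h : \forall z \near z0, (cos (f z) - cos (f z0)) ^+ 2 + (sin (f z) - sin (f z0))
  ^+ 2 < e by exact: (cvgr_lt _ cc _ e0).
apply: (@filterS _ _ (nbhs_filter z0) _ _ _ h) => z hz.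
rewrite nsq_expi_modeB; exact: hz.
Qed.

Lemma vsq_unpack (R : realType) (w : 'cV[R[i]]_(4 * 3)) :
  vsq w = \sum_X vsq (unpack w X).
Proof.
rewrite /vsq pair_big /= (reindex _ (curry_mxvec_bij 4 3)) /=.
apply: eq_bigr => -[X a] _; congr nsq.
by rewrite /unpack !mxE.
Qed.

Lemma af_rhs_mode0 (K : numFieldType) (c dx dy tx ty : K) (w : 'cV[K]_(4 * 3)) X :
  tx != 0 -> ty != 0 ->
  af_rhs c dx dy (mode tx ty w) X 0 0 = - unpack (evolution_matrix c dx dy tx ty *m w)
    X.
Proof.
move=> tx0 ty0; rewrite (evolution_matrixP _ _ _ _ _ _ _ tx0 ty0).
by rewrite /mode !expr0z mulr1 scale1r /unpack !linearN.
Qed.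

(** Continuity of $\mathcal E$ in the phases, deduced from locality: the difference of the two
    matrices acts as minus the right-hand side at cell $(0,0)$ of the difference of two modes. The
    $9$ counts the neighbours. *)
Lemma evolution_matrix_near (R : realType) (c dx dy : R[i]) : exists2 L : R, 0 <= L &
  forall tx ty tx' ty', tx != 0 -> ty != 0 -> tx' != 0 -> ty' != 0 -> forall w e,
  (forall k l : 'I_3, let i := 0 + k%:Z - 1 in let j := 0 + l%:Z - 1 in
    nsq (tx ^ i * ty ^ j - tx' ^ i * ty' ^ j) <= e) ->
  vsq ((evolution_matrix c dx dy tx ty - evolution_matrix c dx dy tx' ty') *m w)
    <= 9 * L * e * vsq w.
Proof.
have [L L0 LP] := af_rhs_local c dx dy; exists L => // tx ty tx' ty' tx0 ty0 tx'0 ty'0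
  w e he.
pose f X i j := -1 *: mode tx' ty' w X i j + mode tx ty w X i j.
have -> : vsq ((evolution_matrix c dx dy tx ty - evolution_matrix c dx dy tx' ty') *m w)
    = gsq (af_rhs c dx dy f) 0 0.
  rewrite vsq_unpack; apply: eq_bigr => X _;
    rewrite -vsqN af_rhs_linear !af_rhs_mode0 //.
  by rewrite mulmxBl [X in unpack X _]addrC -[- (_ *m _)]scaleN1r unpack_linear opprD
    scalerN.
rewrite (le_trans (LP _ _ _)) // [9 * L]mulrC -!mulrA ler_wpM2l //.
have nbr k l : gsq f (0 + (k : 'I_3)%:Z - 1) (0 + (l : 'I_3)%:Z - 1) <= e * vsq w.
  have -> : gsq f (0 + k%:Z - 1) (0 + l%:Z - 1) = 
      nsq (tx ^ (0 + k%:Z - 1) * ty ^ (0 + l%:Z - 1) - tx' ^ (0 + k%:Z - 1) * ty' ^ (0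
        + l%:Z - 1)) * vsq w.
    rewrite vsq_unpack mulr_sumr; apply: eq_bigr => X _.
    by rewrite /f scaleN1r addrC -scalerBl vsqZ.
  by rewrite ler_wpM2r ?vsq_ge0 // he.
have -> : 9 * (e * vsq w) = \sum_(k < 3) \sum_(l < 3) e * vsq w.
  by move: (e * vsq w) => x; rewrite !big_ord_recl !big_ord0; ring.
by apply: ler_sum => k _; apply: ler_sum => l _; exact: nbr.
Qed.

(** Appending to $\mathcal E$ the row that reads the mean pressure gives an injective matrix; [K]
    bounds its left inverse. *)
Lemma evolution_matrix_coercive_at (R : realType) (c dx dy : R) (z0 : R * R) :
  0 < c -> 0 < dx -> 0 < dy -> exists2 K : R, 0 <= K & forall w,
    vsq w <= K * (vsq (evolution_matrix c%:C dx%:C dy%:C (expi z0.1) (expi z0.2) *m w)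
                  + nsq (unpack w dA ic 0)).
Proof.
move=> c0 dx0 dy0; set E := evolution_matrix _ _ _ _ _.
pose r : 'rV[R[i]]_(4 * 3) := delta_mx 0 (mxvec_index dA ic).
have rE w : (r *m w) 0 0 = unpack w dA ic 0.
  by rewrite -rowE !mxE.
have full : row_full (col_mx E r).
  rewrite -cokermx_eq0; apply/eqP/matrixP => a b.
  suff /colP/(_ a) : col b (cokermx (col_mx E r)) = 0 by rewrite !mxE.
  set v := col b _.
  have : col_mx E r *m v = 0 by rewrite /v colE mulmxA mulmx_coker mul0mx.
  rewrite mul_col_mx -[0]col_mx0 => /eq_col_mx[Ev rv].
  have pv : unpack v dA ic 0 = 0 by rewrite -rE rv mxE.
  apply: (evolution_matrix_injective c0 dx0 dy0 _ pv (a := z0.1 / 2) (b := z0.2 / 2)).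
  by move: Ev; rewrite /E {1}[z0.1]splitr {1}[z0.2]splitr.
have [K K0 KP] := vsqM (pinvmx (col_mx E r)).
exists K => // w; rewrite -{1}[w]mul1mx -(mulVpmx full) -mulmxA (le_trans (KP _)) //.
rewrite ler_wpM2l // mul_col_mx -rE.
rewrite /vsq big_split_ord /= big_ord1 col_mxEd lerD2r ler_sum // => i _.
by rewrite col_mxEu.
Qed.

(** The radius $(4(K+1)(9L+1))^{-1}$ makes the perturbation small enough to be absorbed: it costs at
    most half of [vsq w]. *)
Lemma coercive_perturb (R : realType) n (A B : 'M[R[i]]_n) (w : 'cV_n) (K L p m : R) :
  0 <= K -> 0 <= L -> 0 <= p -> vsq w <= K * (vsq (A *m w) + p) ->
  vsq ((B - A) *m w) <= 9 * L * (4 * (K + 1) * (9 * L + 1))^-1 * vsq w ->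
  m <= (4 * (K + 1))^-1 -> m * vsq w <= vsq (B *m w) + p.
Proof.
move=> K0 L0 p0 KW diff mK; set e := (4 * (K + 1) * (9 * L + 1))^-1 in diff.
have e0 : 0 < e by rewrite invr_gt0 !mulr_gt0 ?ltr_wpDl ?mulr_ge0.
have E0 : vsq (A *m w) <= 2 * vsq (B *m w) + 2 * (9 * L * e * vsq w).
  have -> : A *m w = B *m w + - ((B - A) *m w) by rewrite mulmxBl opprB addrC subrK.
  by rewrite (le_trans (vsqD _ _)) // vsqN lerD2l ler_pM2l.
have KE : 4 * (K + 1) * (9 * L) * e <= 1.
  rewrite -[leRHS](mulVf (_ : 4 * (K + 1) * (9 * L + 1) != 0)).
    rewrite mulrC ler_wpM2l ?(ltW e0) // ler_wpM2l ?lerDl ?mulr_ge0 //.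
    by rewrite addr_ge0.
  by rewrite gt_eqF // !mulr_gt0 ?ltr_wpDl ?mulr_ge0.
move: KW E0; have := vsq_ge0 (A *m w); have := vsq_ge0 (B *m w); have := vsq_ge0 w.
move: (vsq (A *m w)) (vsq (B *m w)) (vsq w) => T S v v0 S0 T0 KW E0.
have {}KW : v <= (K + 1) * (2 * S + 2 * (9 * L * e * v) + p).
  rewrite (le_trans KW) // (@le_trans _ _ (K * (2 * S + 2 * (9 * L * e * v) + p))) //.
    by rewrite ler_wpM2l // lerD2r.
  by rewrite ler_wpM2r ?lerDl // !addr_ge0 ?mulr_ge0 // ltW.
have h : 4 * (K + 1) * (9 * L) * e * v <= v by rewrite -[leRHS]mul1r ler_wpM2r.
have h2 : v <= 4 * (K + 1) * (S + p) by have := mulr_ge0 K0 p0; lra.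
apply: (@le_trans _ _ ((4 * (K + 1))^-1 * v)); first by rewrite ler_wpM2r.
by rewrite ler_pdivrMl // mulr_gt0 ?ltr_wpDl.
Qed.

(** The pointwise bound at each pair of angles survives on a neighbourhood; compactness of the
    square of angles gives one constant for all of them. *)
Lemma evolution_matrix_coercive (R : realType) (c dx dy : R) (M : R) :
  0 < c -> 0 < dx -> 0 < dy -> exists2 m : R, 0 < m & forall x y w,
    0 <= x <= M -> 0 <= y <= M ->
    m * vsq w <= vsq (evolution_matrix c%:C dx%:C dy%:C (expi x) (expi y) *m w)
                  + nsq (unpack w dA ic 0).
Proof.
move=> c0 dx0 dy0; pose E (z : R * R) := evolution_matrix c%:C dx%:C dy%:C (expi z.1)
  (expi z.2).
pose P (m : R) (z : R * R) := forall w, m * vsq w <= vsq (E z *m w) + nsq (unpack w dA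
  ic 0).
have cK : compact (`[0, M] `*` `[0, M] : set (R * R)).
  by have cM : compact (`[0, M] : set R) := @segment_compact R 0 M;
    exact: (compact_setX cM cM).
have : \forall m \near 0^'+, (`[0, M] `*` `[0, M] : set (R * R)) `<=` P m.
  move/compact_near_coveringP: cK; apply => z0 _.
  have [K K0 KP] := evolution_matrix_coercive_at z0 c0 dx0 dy0.
  have [L L0 LP] := evolution_matrix_near c%:C dx%:C dy%:C.
  pose e := (4 * (K + 1) * (9 * L + 1))^-1.
  have e0 : 0 < e by rewrite invr_gt0 !mulr_gt0 ?ltr_wpDl ?mulr_ge0.
  pose d (k l : 'I_3) (z : R * R) : R := let i := 0 + k%:Z - 1 in let j := 0 + l%:Z -
    1 in
    nsq (expi z.1 ^ i * expi z.2 ^ j - expi z0.1 ^ i * expi z0.2 ^ j).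
  have near_d : \forall z \near z0, forall k l, d k l z < e.
    apply: (@filter_forall _ _ _ _ (nbhs_filter z0)) => k;
      apply: (@filter_forall _ _ _ _ (nbhs_filter z0)) => l; exact: near_expi.
  have near_m : \forall m \near 0^'+, (m : R) < (4 * (K + 1))^-1.
    by apply: nbhs_right_lt; rewrite invr_gt0 mulr_gt0 ?ltr_wpDl.
  exists ([set z | forall k l, d k l z < e], [set m | m < (4 * (K + 1))^-1]) => //.
  move=> [z m] [/= dz mK] w.
  apply: (@coercive_perturb _ _ (E z0) (E z) w K L _ m K0 L0 (nsq_ge0 _) (KP w) _ (ltW
    mK)).
  exact: (LP _ _ _ _ (expi_neq0 z.1) (expi_neq0 z.2) (expi_neq0 z0.1) (expi_neq0 z0.2)
    w e
    (fun k l => ltW (dz k l))).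
move=> near0; have [m [m0 mP]] : exists m : R, 0 < m /\ `[0, M] `*` `[0, M] `<=` P m.
  apply: (@filter_ex _ (0 : R)^'+); near=> m; split; first by near: m;
    exact: nbhs_right_gt.
  by near: m.
exists m => // x y w hx hy; apply: (mP (x, y)).
by split; rewrite /= in_itv.
Unshelve. all: by end_near.
Qed.

Local Close Scope classical_set_scope.

(** * Discrete Fourier transform on a periodic box *)

Definition dft_angle (R : realType) (N k : nat) : R := 2 * pi * k%:R / N%:R.
Definition dft_root (R : realType) (N k : nat) : R[i] := expi (dft_angle R N k).

Lemma expiMn (R : realType) (x : R) (n : nat) : expi x ^+ n = expi (n%:R * x).
Proof. exact: (expiMz x n). Qed.

Lemma expi_2pi (R : realType) (n : nat) : expi (2 * pi * n%:R : R) = 1.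
Proof.
rewrite mulrC -expiMn mulr_natl mulr2n (_ : expi (pi + pi) = 1) ?expr1n //.
rewrite /expi cosD sinD cospi sinpi.
by apply/eqP; rewrite eq_complex /=; apply/andP; split; apply/eqP; ring.
Qed.

Lemma expi_neq1 (R : realType) (x : R) : 0 < x < 2 * pi -> expi x != 1.
Proof.
move=> /andP[x0 x1]; apply/eqP => /(congr1 (@complex.Re R)) /=.
rewrite [x in cos x]splitr cosD => h.
have s0 : 0 < sin (x / 2) by apply: sin_gt0_pi; apply/andP; split; lra.
have := cos2Dsin2 (x / 2); have : 0 < sin (x / 2) ^+ 2 by rewrite exprn_gt0.
by move: h; rewrite -!expr2; lra.
Qed.

Lemma dft_root_exp (R : realType) (N k n : nat) :
  dft_root R N k ^+ n = dft_root R N n ^+ k.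
Proof. by rewrite !expiMn /dft_angle; congr expi; ring. Qed.

(** For distinct indices the ratio is an $N$-th root of unity other than $1$, so its geometric sum
    vanishes. *)
Lemma dft_root_orth (R : realType) (N : nat) (k l : 'I_N) :
  \sum_(i < N) (dft_root R N k / dft_root R N l) ^+ i = N%:R * (k == l)%:R.
Proof.
have N0 : N%:R != 0 :> R by case: N k {l} => [[]//|N] _; rewrite pnatr_eq0.
have [->|kl] := eqVneq k l.
  under eq_bigr do rewrite divff ?expi_neq0 // expr1n.
  by rewrite sumr_const card_ord mulr1.
rewrite mulr0; set z := _ / _.
have zN : z ^+ N = 1.
  rewrite expr_div_n !expiMn /dft_angle !(mulrC N%:R) !divfK // !expi_2pi.
  by rewrite divr1.
suff z1 : z - 1 != 0 by apply: (mulfI z1); rewrite -subrX1 zN subrr mulr0.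
rewrite subr_eq0; have N0' : 0 < N%:R :> R by rewrite lt_def N0 ler0n.
have small (a b : 'I_N) : (b < a)%N -> dft_root R N a / dft_root R N b != 1.
  move=> ba; rewrite /dft_root -expiN -expiD; apply: expi_neq1.
  have -> : dft_angle R N a + - dft_angle R N b = 2 * pi * ((a - b)%:R / N%:R).
    by rewrite /dft_angle natrB 1?ltnW //; ring.
  have p0 := pi_gt0 R; have p2 : 0 < 2 * pi :> R by rewrite mulr_gt0.
  apply/andP; split; first by rewrite mulr_gt0 // divr_gt0 // ltr0n subn_gt0.
  rewrite -[X in _ < X]mulr1 ltr_pM2l // ltr_pdivrMr // mul1r ltr_nat.
  exact: leq_ltn_trans (leq_subr _ _) (ltn_ord a).
move: kl; rewrite neq_ltn => /orP[lt|lt]; last exact: small.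
have := small l k lt; apply: contraNneq => z1.
by rewrite -[X in X == _]invrK invf_div -/z z1 invr1.
Qed.

Lemma conj_dft_root (R : realType) (N k : nat) : ((dft_root R N k)^*)%R = (dft_root R
  N k)^-1.
Proof. by rewrite -expiN; apply/eqP; rewrite eq_complex /= cosN sinN !eqxx. Qed.

Lemma dft_parseval (R : realType) (N : nat) (g : 'I_N -> R[i]) :
  \sum_(i < N) nsq (\sum_(k < N) dft_root R N k ^+ i * g k) = N%:R * \sum_k nsq (g k).
Proof.
have conj_sum (F : 'I_N -> R[i]) : ((\sum_k F k)^*)%R = \sum_k (F k)^* := rmorph_sum _
  _ _ _.
have conjM (x y : R[i]) (n : nat) : ((x ^+ n * y)^*)%R = x^* ^+ n * y^*.
  by rewrite rmorphM rmorphXn.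
apply: (@complexI R); rewrite rmorphM rmorph_nat !rmorph_sum /=.
transitivity (\sum_(i < N) \sum_(k < N) \sum_(l < N) (g k * (g l)^*) * (dft_root R N k
  / dft_root R N l) ^+ i).
  apply: eq_bigr => i _; rewrite nsqE conj_sum mulr_suml; apply: eq_bigr => k _.
  rewrite mulr_sumr; apply: eq_bigr => l _.
  rewrite conjM conj_dft_root.
  by rewrite exprMn; ring.
rewrite exchange_big mulr_sumr; apply: eq_bigr => k _.
rewrite exchange_big (bigD1 k) //= [X in _ + X]big1 => [|l lk].
  by rewrite -mulr_sumr dft_root_orth eqxx mulr1 addr0 mulrC nsqE.
by rewrite -mulr_sumr dft_root_orth eq_sym (negPf lk) !mulr0.
Qed.

Lemma dft_inversion (R : realType) (N : nat) (f : 'I_N -> R[i]) (i : 'I_N) :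
  \sum_(k < N) dft_root R N k ^+ i * (N%:R^-1 * \sum_(j < N) (dft_root R N k ^+ j)^-1
    * f j) = f i.
Proof.
have N0 : N%:R != 0 :> R[i] by case: N f i => [? []//|N] _ _; rewrite pnatr_eq0.
transitivity (\sum_(k < N) \sum_(j < N) N%:R^-1 * f j * (dft_root R N i / dft_root R N
  j) ^+ k).
  apply: eq_bigr => k _; rewrite !mulr_sumr; apply: eq_bigr => j _.
  by rewrite expr_div_n !(dft_root_exp R N k); ring.
rewrite exchange_big (bigD1 i) //= [X in _ + X]big1 => [|j ji].
  by rewrite -mulr_sumr dft_root_orth eqxx mulr1 addr0 mulrAC mulVf // mul1r.
by rewrite -mulr_sumr dft_root_orth eq_sym (negPf ji) !mulr0.
Qed.

Definition dft_synthesis (R : realType) (N : nat) (h : 'I_N -> 'I_N -> 'cV[R[i]]_(4 *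
  3)) : grid R[i] :=
  fun X i j => \sum_(k < N) \sum_(l < N) mode (dft_root R N k) (dft_root R N l) (h k
    l) X i j.

Lemma dft_synthesisE (R : realType) (N : nat) h X i j a :
  @dft_synthesis R N h X i j a 0 =
  \sum_(k < N) dft_root R N k ^ i * \sum_(l < N) dft_root R N l ^ j * unpack (h k l) X
    a 0.
Proof.
rewrite summxE; apply: eq_bigr => k _; rewrite summxE mulr_sumr; apply: eq_bigr => l _.
by rewrite mxE mulrA.
Qed.

Lemma dft_parseval2 (R : realType) (N : nat) (g : 'I_N -> 'I_N -> R[i]) :
  \sum_(i < N) \sum_(j < N)
    nsq (\sum_(k < N) dft_root R N k ^+ i * \sum_(l < N) dft_root R N l ^+ j * g k l) =
  N%:R ^+ 2 * \sum_(k < N) \sum_(l < N) nsq (g k l).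
Proof.
rewrite exchange_big /=; under eq_bigr do rewrite dft_parseval.
rewrite -mulr_sumr exchange_big /= expr2 -mulrA; congr (_ * _).
by rewrite mulr_sumr; apply: eq_bigr => k _; exact: dft_parseval.
Qed.

Lemma gsq_dft_synthesis (R : realType) (N : nat) h :
  \sum_(i < N) \sum_(j < N) gsq (@dft_synthesis R N h) i j =
  N%:R ^+ 2 * \sum_(k < N) \sum_(l < N) vsq (h k l).
Proof.
have exch (G : 'I_N -> 'I_N -> 'I_4 -> 'I_3 -> R) :
    \sum_i \sum_j \sum_X \sum_a G i j X a = \sum_X \sum_a \sum_i \sum_j G i j X a.
  under eq_bigr do rewrite exchange_big /=.
  rewrite exchange_big /=; apply: eq_bigr => X _.
  by under eq_bigr do rewrite exchange_big /=; rewrite exchange_big.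
rewrite /gsq /vsq exch.
under [in RHS]eq_bigr do under eq_bigr do rewrite -/(vsq _) vsq_unpack /vsq.
rewrite exch mulr_sumr; apply: eq_bigr => X _; rewrite mulr_sumr; apply: eq_bigr => a _.
under eq_bigr do under eq_bigr do rewrite dft_synthesisE.
exact: dft_parseval2.
Qed.

Lemma dft_root_neq0 (R : realType) N k : dft_root R N k != 0.
Proof. exact: expi_neq0. Qed.

Lemma dft_root_modz (R : realType) (N k : nat) (i : int) : (0 < N)%N ->
  dft_root R N k ^ i = dft_root R N k ^ (i %% N)%Z.
Proof.
move=> N0; have rN : dft_root R N k ^ N%:Z = 1.
  by rewrite -[LHS]/(_ ^+ N) expiMn /dft_angle mulrC divfK ?expi_2pi // pnatr_eq0 -lt0n.
rewrite [in LHS](divz_eq i N) expfzDr ?dft_root_neq0 // [X in X * _](_ : _ = 1) ?mul1r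
  //.
by rewrite mulrC -exprz_exp rN exp1rz.
Qed.

Lemma dft_synthesis_modz (R : realType) (N : nat) h X i j : (0 < N)%N ->
  @dft_synthesis R N h X i j = dft_synthesis h X (i %% N)%Z (j %% N)%Z.
Proof.
move=> N0; apply: eq_bigr => k _; apply: eq_bigr => l _; rewrite /mode.
by rewrite (dft_root_modz _ _ i) // (dft_root_modz _ _ j).
Qed.

Definition dft_analysis (R : realType) (N : nat) (f : grid R[i]) (k l : 'I_N) :
  'cV[R[i]]_(4 * 3) :=
  pack (fun X => \col_a (N%:R^-1 * \sum_(i < N) (dft_root R N k ^+ i)^-1 *
    (N%:R^-1 * \sum_(j < N) (dft_root R N l ^+ j)^-1 * f X i j a 0))).

Lemma dft_analysisK (R : realType) (N : nat) (f : grid R[i]) X i j : (0 < N)%N ->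
  (forall X i j, f X i j = f X (i %% N)%Z (j %% N)%Z) ->
  dft_synthesis (@dft_analysis R N f) X i j = f X i j.
Proof.
move=> N0 fN; rewrite dft_synthesis_modz // fN.
have modN (x : int) : exists m : 'I_N, (x %% N)%Z = m%:Z.
  have N0' : N%:Z != 0 by rewrite eqz_nat -lt0n.
  have h := ltz_pmod x (_ : 0 < N%:Z); have h0 := modz_ge0 x N0'.
  case: (x %% N)%Z h0 h => // m _ h; suff mN : (m < N)%N by exists (Ordinal mN).
  by apply: h.
have [{}i ->] := modN i; have [{}j ->] := modN j.
apply/colP => a; rewrite dft_synthesisE.
pose g k := (N%:R^-1 * \sum_(j < N) (dft_root R N k ^+ j)^-1 * f X i j a 0).
transitivity (\sum_(k < N) dft_root R N k ^+ i * (N%:R^-1 * \sum_(i < N) (dft_root R N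
  k ^+ i)^-1 * f X i j a 0)).
  apply: eq_bigr => k _; congr (_ * _).
  under eq_bigr do rewrite packK mxE.
  under eq_bigr do rewrite mulrCA.
  rewrite -mulr_sumr; congr (_ * _).
  under eq_bigr do rewrite mulr_sumr.
  rewrite exchange_big; apply: eq_bigr => m _ /=.
  under eq_bigr do rewrite mulrCA.
  rewrite -mulr_sumr; congr (_ * _).
  exact: (dft_inversion (fun j : 'I_N => f X m j a 0)).
exact: (dft_inversion (fun i : 'I_N => f X i j a 0)).
Qed.

Lemma af_rhs_sum (K : numFieldType) (c dx dy : K) n (q : 'I_n -> grid K) X i j :
  af_rhs c dx dy (fun X i j => \sum_(k < n) q k X i j) X i j = \sum_(k < n) af_rhs c
    dx dy (q k) X i j.
Proof.
have rhs0 : af_rhs c dx dy (fun _ _ _ => 0) X i j = 0.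
  pose z : grid K := fun _ _ _ => 0.
  have e : (fun X i j => -1 *: z X i j + z X i j) = z.
    by apply/funext => Y; apply/funext => k; apply/funext => l;
      rewrite /z scaler0 addr0.
  by have := af_rhs_linear c dx dy (-1) z z X i j; rewrite e scaleN1r addNr.
elim: n q => [|n IH] q.
  rewrite big_ord0 -[RHS]rhs0; congr (af_rhs c dx dy _ X i j).
  by apply/funext => Y; apply/funext => k; apply/funext => l; rewrite big_ord0.
rewrite big_ord_recl -IH -[X in _ = X + _]scale1r -af_rhs_linear.
congr (af_rhs c dx dy _ X i j); apply/funext => Y; apply/funext => k; apply/funext => l.
by rewrite big_ord_recl scale1r.
Qed.

Lemma af_rhs_dft_synthesis (R : realType) (c dx dy : R[i]) N h X i j :
  af_rhs c dx dy (@dft_synthesis R N h) X i j =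
  dft_synthesis (fun k l => - (evolution_matrix c dx dy (dft_root R N k) (dft_root R N
    l) *m h k l)) X i j.
Proof.
rewrite /dft_synthesis af_rhs_sum; apply: eq_bigr => k _.
rewrite af_rhs_sum; apply: eq_bigr => l _.
by apply: evolution_matrixP; exact: dft_root_neq0.
Qed.

(** Every Fourier amplitude of [f] has zero mean pressure, so coercivity holds mode by mode;
    Parseval's identity on both sides transfers it to the grid. The constant [m] does not depend on
    the period. *)
Lemma periodic_coercive (R : realType) (c dx dy : R) : 0 < c -> 0 < dx -> 0 < dy ->
  exists2 m : R, 0 < m & forall (N : nat) (f : grid R[i]), (0 < N)%N ->
  (forall X i j, f X i j = f X (i %% N)%Z (j %% N)%Z) ->
  (forall i j, f dA i j ic 0 = 0) ->
  m * \sum_(i < N) \sum_(j < N) gsq f i j <=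
  \sum_(i < N) \sum_(j < N) gsq (af_rhs c%:C dx%:C dy%:C f) i j.
Proof.
move=> c0 dx0 dy0; have [m m0 mP] := @evolution_matrix_coercive R c dx dy (2 * pi) c0
  dx0 dy0.
exists m => // N f N0 fN fA.
have fE : f = dft_synthesis (@dft_analysis R N f).
  by apply/funext => X; apply/funext => i; apply/funext => j; rewrite dft_analysisK.
have aA k l : unpack (@dft_analysis R N f k l) dA ic 0 = 0.
  rewrite packK mxE big1 ?mulr0 // => i _; rewrite big1 ?mulr0 // => j _.
  by rewrite fA mulr0.
have -> : \sum_(i < N) \sum_(j < N) gsq f i j = \sum_(i < N) \sum_(j < N) gsq
  (dft_synthesis (@dft_analysis R N f)) i j.
  by rewrite -fE.
move: (@dft_analysis R N f) fE aA => h fE aA.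
have -> : \sum_(i < N) \sum_(j < N) gsq (af_rhs c%:C dx%:C dy%:C f) i j =
  \sum_(i < N) \sum_(j < N) gsq (dft_synthesis (fun k l => - (evolution_matrix c%:C
    dx%:C dy%:C (dft_root R N k) (dft_root R N l) *m h k l))) i j.
  apply: eq_bigr => i _; apply: eq_bigr => j _; apply: eq_bigr => X _.
  by rewrite fE af_rhs_dft_synthesis.
rewrite !gsq_dft_synthesis mulrCA ler_wpM2l ?exprn_ge0 // mulr_sumr ler_sum // => k _.
rewrite mulr_sumr ler_sum // => l _; rewrite vsqN.
have range (n : 'I_N) : 0 <= dft_angle R N n <= 2 * pi.
  have p0 : 0 <= 2 * pi :> R by rewrite mulr_ge0 // pi_ge0.
  rewrite /dft_angle; apply/andP; split; first by rewrite divr_ge0 // mulr_ge0.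
  by rewrite ler_pdivrMr ?ltr0n // ler_wpM2l // ler_nat ltnW.
by have := mP (dft_angle R N k) (dft_angle R N l) (h k l) (range k) (range l);
  rewrite aA nsq0 addr0.
Qed.

(** * Energy of stationary data in growing boxes *)

Lemma sum_shift1 (R : realType) (G : int -> R) (N : nat) : G N%:Z = G 0 ->
  \sum_(i < N) G (i%:Z + 1) = \sum_(i < N) G i%:Z.
Proof.
case: N => [|N] GN; first by rewrite !big_ord0.
rewrite big_ord_recr big_ord_recl /= addrC -GN; congr (G _ + _);
  first by rewrite -PoszD addn1.
by apply: eq_bigr => i _; rewrite -PoszD addn1.
Qed.

Lemma sum_shift (R : realType) (G : int -> R) (N : nat) (k : 'I_3) :
  (forall i, G (i + N%:Z) = G i) ->
  \sum_(i < N) G (i%:Z + k%:Z - 1) = \sum_(i < N) G i%:Z.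
Proof.
move=> GN; have down : \sum_(i < N) G (i%:Z - 1) = \sum_(i < N) G i%:Z.
  rewrite -(sum_shift1 (G := fun i => G (i - 1))); last by rewrite add0r -[RHS]GN addrC.
  by apply: eq_bigr => i _; rewrite addrK.
case: k => -[|[|[|k]]] h //=.
- by under eq_bigr do rewrite addr0.
- by under eq_bigr do rewrite addrK.
- rewrite -(sum_shift1 (G := G)); last by rewrite -[N%:Z]add0r GN.
  by apply: eq_bigr => i _; congr G; ring.
Qed.

(** The indices of $[0,N)$ left after removing two layers at each end. Two layers are removed
    because a boundary cell of the box has neighbours one layer further in. *)
Definition inner (N : nat) (i : int) : bool := (2 <= i) && (i < N%:Z - 2).

Lemma sum_inner (R : realType) (M : nat) (G : int -> R) :
  \sum_(i < M.+4) (inner M.+4 i%:Z)%:R * G i%:Z = \sum_(i < M) G (i%:Z + 2).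
Proof.
have inE (n : nat) : inner M.+4 n%:Z = (2 <= n < M.+2)%N.
  by rewrite /inner (_ : M.+4%:Z - 2 = M.+2%:Z) // -[2]/(2%:Z) lez_nat ltz_nat.
pose F n := (inner M.+4 n%:Z)%:R * G n%:Z.
have F0 n : ~~ (2 <= n < M.+2)%N -> F n = 0.
  by rewrite /F inE => /negPf ->; rewrite mul0r.
rewrite -/(\sum_(i < M.+4) F i) 2!big_ord_recr 2!big_ord_recl /=.
rewrite (F0 0%N) // (F0 (bump 0 0)) // (F0 M.+2) ?ltnn ?andbF // (F0 M.+3); last by lia.
rewrite !add0r !addr0.
apply: eq_bigr => i _; rewrite /F inE (_ : (_ <= _ < _)%N); last by have := ltn_ord i;
  rewrite /bump /=; lia.
by rewrite mul1r; congr G; rewrite -PoszD addn2.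
Qed.

(** Wrapping around the period moves an index by at most one step across the end of the box, so it
    never lands among the inner indices. *)
Lemma inner_nbr (N : nat) (i : int) (k : 'I_3) : (0 <= i < N%:Z)%R ->
  inner N ((i + k%:Z - 1) %% N)%Z -> (1 <= i < N%:Z - 1)%R.
Proof.
move=> /andP[i0 iN]; have := divz_eq (i + k%:Z - 1) N%:Z.
move: (_ %/ _)%Z (_ %% _)%Z => z x e /andP[x2 xN].
have z0 : 0 < z -> N%:Z <= z * N%:Z by move=> z0; rewrite ler_peMl //; lia.
have z1 : z < 0 -> z * N%:Z <= - N%:Z by move=> z1; rewrite -mulN1r ler_wpM2r //; lia.
have z2 : z = 0 -> z * N%:Z = 0 by move=> ->; rewrite mul0r.
have := ltn_ord k; move: (z * N%:Z) e z0 z1 z2 => w e z0 z1 z2 k3.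
by case: (ltrgtP z 0) => hz; [have := z1 hz|have := z0 hz|have := z2 hz]; lia.
Qed.

Definition box_energy (R : realType) (q : grid R[i]) (n : nat) : R :=
  \sum_(i < n.*2.+1) \sum_(j < n.*2.+1) gsq q (i%:Z - n%:Z) (j%:Z - n%:Z).

(** The periodization of [q] has a nonzero right-hand side only in the outermost layer of the box,
    where locality bounds it by the energy of the two outermost layers. Coercivity then bounds the
    whole energy by that of these layers. *)
Lemma box_energy_step (R : realType) (c dx dy : R) : 0 < c -> 0 < dx -> 0 < dy ->
  exists2 h : R, 0 < h & forall q, stationary c%:C dx%:C dy%:C q ->
  (forall i j, q dA i j ic 0 = 0) ->
  forall n, h * box_energy q n.+2 <= box_energy q n.+2 - box_energy q n.
Proof.
move=> c0 dx0 dy0; have [m m0 mP] := periodic_coercive c0 dx0 dy0.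
have [K K0 KP] := af_rhs_local c%:C dx%:C dy%:C.
(* Nine neighbours times the locality constant; [K + 1] keeps the denominator positive when [K] is
   zero. *)
exists (m / (9 * (K + 1))) => [|q st qA n].
  by rewrite divr_gt0 // mulr_gt0 // ltr_wpDl.
set N := n.+2.*2.+1.
have N4 : N = n.*2.+1.+4 by rewrite /N !doubleS.
pose q' : grid R[i] := fun X i j => q X (i - n.+2%:Z) (j - n.+2%:Z).
have st' : forall X i j, af_rhs c%:C dx%:C dy%:C q' X i j = 0.
  by move=> X i j; rewrite /q' af_rhs_shift st.
pose f : grid R[i] := fun X i j => q' X (i %% N)%Z (j %% N)%Z.
have fN X i j : f X i j = f X (i %% N)%Z (j %% N)%Z by rewrite /f !modz_mod.
have fA i j : f dA i j ic 0 = 0 by exact: qA.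
have fE (i j : 'I_N) : gsq f i j = gsq q' i j.
  by apply: eq_bigr => X _; rewrite /f !modz_small ?ltz_nat //= .
have BE : box_energy q n.+2 = \sum_(i < N) \sum_(j < N) gsq f i j.
  by apply: eq_bigr => i _; apply: eq_bigr => j _; rewrite fE.
(* Energy density of [f] restricted to the two outermost layers of the box, extended
   periodically. *)
pose G i j := gsq f i j - (inner N (i %% N)%Z)%:R * ((inner N (j %% N)%Z)%:R * gsq f i
  j).
have G0 i j : 0 <= G i j.
  rewrite /G mulrA -natrM mulnb subr_ge0 ler_piMl ?gsq_ge0 //; by case: (_ && _).
have Gsum : \sum_(i < N) \sum_(j < N) G i j = box_energy q n.+2 - box_energy q n.
  rewrite BE; under eq_bigr do rewrite sumrB.
  rewrite sumrB; congr (_ - _).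
  transitivity (\sum_(i < N) (inner N i%:Z)%:R * \sum_(j < N) (inner N j%:Z)%:R * gsq
    q' i%:Z j%:Z).
    apply: eq_bigr => i _; rewrite mulr_sumr; apply: eq_bigr => j _.
    by rewrite fE !modz_small ?ltz_nat //=.
  have si (H : int -> R) : \sum_(i < N) (inner N i%:Z)%:R * H i%:Z =
      \sum_(i < n.*2.+1) H (i%:Z + 2) by rewrite N4 sum_inner.
  rewrite (si (fun i => \sum_(j < N) (inner N j%:Z)%:R * gsq q' i j%:Z)).
  apply: eq_bigr => i _; rewrite (si (gsq q' (i%:Z + 2))); apply: eq_bigr => j _.
  by apply: eq_bigr => X _; rewrite /q'; congr (vsq (q X _ _)); lia.
have bound (i j : 'I_N) : gsq (af_rhs c%:C dx%:C dy%:C f) i j <=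
    K * \sum_(k < 3) \sum_(l < 3) G (i%:Z + k%:Z - 1) (j%:Z + l%:Z - 1).
  (* Away from the boundary [f] agrees with the stationary [q'] on the whole stencil, so the
     right-hand side of the difference vanishes. On the boundary no neighbour is inner, so [G] is
     the full energy density there. *)
  have [/andP[hi hj]|nint] := boolP ((1 <= i%:Z < N%:Z - 1) && (1 <= j%:Z < N%:Z - 1)).
    pose d : grid R[i] := fun X i j => -1 *: q' X i j + f X i j.
    have -> : gsq (af_rhs c%:C dx%:C dy%:C f) i j = gsq (af_rhs c%:C dx%:C dy%:C d) i j.
      by apply: eq_bigr => X _; rewrite af_rhs_linear st' scaler0 add0r.
    rewrite (le_trans (KP _ _ _)) // ler_wpM2l //.
    apply: ler_sum => k _; apply: ler_sum => l _;
      rewrite [X in X <= _](_ : _ = 0) ?G0 //.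
    rewrite /gsq big1 // => X _; rewrite /d /f !modz_small.
    - by rewrite scaleN1r addNr vsq0.
    - by have := ltn_ord l; move: hj; lia.
    - by have := ltn_ord k; move: hi; lia.
  rewrite (le_trans (KP _ _ _)) // ler_wpM2l //.
  apply: ler_sum => k _; apply: ler_sum => l _; rewrite /G.
  suff /negPf e : ~~ (inner N ((i%:Z + k%:Z - 1) %% N)%Z && inner N ((j%:Z + l%:Z - 1)
    %% N)%Z).
    by rewrite [_%:R * (_ * _)]mulrA -natrM mulnb e mul0r subr0.
  apply: contra nint => /andP[hi hj].
  by rewrite (inner_nbr _ hi) ?(inner_nbr _ hj) //= ltz_nat.
(* Over a full period each of the nine shifted sums of [G] equals the unshifted one. *)
have total : \sum_(i < N) \sum_(j < N) gsq (af_rhs c%:C dx%:C dy%:C f) i j <=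
    K * (9 * (box_energy q n.+2 - box_energy q n)).
  apply: (@le_trans _ _ (K * \sum_(i < N) \sum_(j < N) \sum_(k < 3) \sum_(l < 3)
      G (i%:Z + k%:Z - 1) (j%:Z + l%:Z - 1))).
    rewrite mulr_sumr ler_sum // => i _; rewrite mulr_sumr ler_sum // => j _;
      exact: bound.
  rewrite ler_wpM2l //.
  have GN1 i j : G (i + N%:Z) j = G i j by rewrite /G /gsq /f !modzDr.
  have GN2 i j : G i (j + N%:Z) = G i j by rewrite /G /gsq /f !modzDr.
  have -> : 9 * (box_energy q n.+2 - box_energy q n) =
      \sum_(k < 3) \sum_(l < 3) \sum_(i < N) \sum_(j < N) G i%:Z j%:Z.
    by rewrite Gsum; move: (_ - _) => x; rewrite !big_ord_recl !big_ord0; ring.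
  under eq_bigr do rewrite exchange_big /=.
  rewrite exchange_big /=; apply: ler_sum => k _.
  under eq_bigr do rewrite exchange_big /=.
  rewrite exchange_big /=; apply: ler_sum => l _.
  rewrite -(sum_shift (G := fun i => \sum_(j < N) G i j%:Z) k) => [|i]; last first.
    by apply: eq_bigr => j _; rewrite GN1.
  by apply: ler_sum => i _; rewrite (sum_shift (G := G (i%:Z + k%:Z - 1)) l).
have step : m * box_energy q n.+2 <= K * (9 * (box_energy q n.+2 - box_energy q n)).
  by rewrite {1}BE (le_trans (mP N f _ fN fA)).
have diff0 : 0 <= box_energy q n.+2 - box_energy q n.
  by rewrite -Gsum sumr_ge0 // => i _; rewrite sumr_ge0.
rewrite mulrAC ler_pdivrMr ?mulr_gt0 ?ltr_wpDl // (le_trans step) //.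
by move: (_ - _) diff0 => x x0; lra.
Qed.

(** * Bounded stationary data *)

Lemma bernoulli (R : realType) (h : R) n : 0 <= h -> 1 + n%:R * h <= (1 + h) ^+ n.
Proof.
move=> h0; elim: n => [|n IH]; first by rewrite mul0r addr0.
rewrite exprS (le_trans _ (ler_wpM2l _ IH)) ?addr_ge0 //.
rewrite -natr1; have : 0 <= n%:R * h * h by rewrite !mulr_ge0.
by lra.
Qed.

Lemma archimedean_le0 (R : realType) (x C : R) :
  (forall n : nat, n%:R * x <= C) -> x <= 0.
Proof.
move=> h; rewrite leNgt; apply/negP => x0.
have := h (Num.bound (`|C| / x)); rewrite leNgt => /negP; apply.
rewrite -ltr_pdivrMr //; apply: (@le_lt_trans _ _ (`|C| / x)).
  by rewrite ler_pM2r ?invr_gt0 // ler_norm.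
by apply: archi_boundP; rewrite divr_ge0 // ltW.
Qed.

(** The step inequality makes [B] grow geometrically, unless [B 0] vanishes, while the bound allows
    quadratic growth only. *)
Lemma box_energy_bounded0 (R : realType) (B : nat -> R) (h C : R) :
  0 < h -> (forall n, 0 <= B n) -> (forall n, h * B n.+2 <= B n.+2 - B n) ->
  (forall n, B n <= C * (n.*2.+1)%:R ^+ 2) -> B 0%N = 0.
Proof.
move=> h0 B0 step BC.
have grow n : (1 + h) * B n <= B n.+2.
  have := step n; have : 0 <= h * B n.+2 by rewrite mulr_ge0 // ltW.
  move=> s1 s2; have : h * B n <= h * B n.+2 by rewrite ler_pM2l //; lra.
  by lra.
have pow n : (1 + h) ^+ n * B 0%N <= B n.*2.
  elim: n => [|n IH]; first by rewrite mul1r.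
  by rewrite doubleS (le_trans _ (grow _)) // exprS -mulrA ler_pM2l // addr_gt0.
have C0 : 0 <= C by have := BC 0%N; rewrite expr1n mulr1; apply: le_trans.
apply/eqP; rewrite eq_le B0 andbT.
have h3 : 0 < h ^+ 3 by rewrite exprn_gt0.
(* Bernoulli's inequality cubed, $(nh)^3\le(1+h)^{3n}$, beats a quadratic. After $3n$ steps of size
   two the box has side $12n+1\le 13n$, whence $169=13^2$. *)
rewrite -(pmulr_rle0 _ h3); apply: (@archimedean_le0 _ _ (169 * C)) => n.
have [->|n0] := posnP n; first by rewrite mul0r mulr_ge0.
have n0' : 0 < n%:R :> R by rewrite ltr0n.
have n2 : 0 < n%:R ^+ 2 :> R by rewrite exprn_gt0.
rewrite -(ler_pM2l n2).
have -> : n%:R ^+ 2 * (n%:R * (h ^+ 3 * B 0%N)) = (n%:R * h) ^+ 3 * B 0%N by ring.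
apply: (@le_trans _ _ ((1 + h) ^+ (n * 3) * B 0%N)).
  have le1 : n%:R * h <= (1 + h) ^+ n.
    by apply: le_trans (bernoulli n (ltW h0)); rewrite lerDr.
  have nh0 : 0 <= n%:R * h by rewrite mulr_ge0 // ltW.
  by rewrite ler_wpM2r // exprM lerXn2r // nnegrE // (le_trans nh0).
apply: le_trans (pow _) _; apply: le_trans (BC _) _.
have -> : n%:R ^+ 2 * (169 * C) = C * (13 * n%:R) ^+ 2 by ring.
rewrite ler_wpM2l // lerXn2r ?nnegrE ?mulr_ge0 ?ler0n // -natrM ler_nat.
by rewrite -!mul2n; lia.
Qed.

Lemma nsq_le_norm (R : realType) (z : R[i]) (M : R) : `|z| <= M%:C -> nsq z <= M ^+ 2.
Proof.
move=> zM; have M0 : 0 <= M%:C := le_trans (normr_ge0 z) zM.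
by rewrite -lecR nsqE -normCK rmorphXn /= lerXn2r ?nnegrE.
Qed.

Definition nsq_bounded (R : realType) (w : int -> int -> R[i]) : Prop :=
  exists M : R, forall i j, nsq (w i j) <= M.

Lemma nsq_boundedD (R : realType) (v w : int -> int -> R[i]) :
  nsq_bounded v -> nsq_bounded w -> nsq_bounded (fun i j => v i j + w i j).
Proof.
move=> [M vM] [L wL]; exists (2 * M + 2 * L) => i j.
by rewrite (le_trans (nsqD _ _)) // lerD // ler_pM2l.
Qed.

Lemma nsq_boundedM (R : realType) k (w : int -> int -> R[i]) :
  nsq_bounded w -> nsq_bounded (fun i j => k * w i j).
Proof. by move=> [M wM]; exists (nsq k * M) => i j;
  rewrite nsqM ler_wpM2l ?nsq_ge0. Qed.

Lemma nsq_boundedMr (R : realType) k (w : int -> int -> R[i]) :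
  nsq_bounded w -> nsq_bounded (fun i j => w i j * k).
Proof. by move=> [M wM]; exists (M * nsq k) => i j;
  rewrite nsqM ler_wpM2r ?nsq_ge0. Qed.

Lemma nsq_boundedN (R : realType) (w : int -> int -> R[i]) :
  nsq_bounded w -> nsq_bounded (fun i j => - w i j).
Proof. by move=> [M wM]; exists M => i j; rewrite nsqN. Qed.

Lemma nsq_bounded_at (R : realType) (q : grid R[i]) X (f g : int -> int -> int) a :
  bounded_grid q -> nsq_bounded (fun i j => q X (f i j) (g i j) a 0).
Proof. by move=> [M qM]; exists (M ^+ 2) => i j; exact: nsq_le_norm. Qed.

Lemma bounded_gridP (R : realType) (q : grid R[i]) :
  (forall X a, nsq_bounded (fun i j => q X i j a 0)) -> exists M, forall i j, gsq q i
    j <= M.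
Proof.
move=> qb; have [M qM] := choice (fun p : 'I_4 * 'I_3 => qb p.1 p.2).
exists (\sum_X \sum_a M (X, a)) => i j; apply: ler_sum => X _; apply: ler_sum => a _.
exact: (qM (X, a)).
Qed.

(** The argument is applied to the data translated so that the given cell is the origin; the box of
    radius $0$ is then that single cell. *)
Lemma bounded_stationary_eq0 (R : realType) (c dx dy : R) (q : grid R[i]) :
  0 < c -> 0 < dx -> 0 < dy ->
  (forall X a, nsq_bounded (fun i j => q X i j a 0)) ->
  stationary c%:C dx%:C dy%:C q -> (forall i j, q dA i j ic 0 = 0) ->
  forall X i j, q X i j = 0.
Proof.
move=> c0 dx0 dy0 /bounded_gridP[M qM] st qA X x y.
have [h h0 hP] := box_energy_step c0 dx0 dy0.
pose q' : grid R[i] := fun X i j => q X (i + x) (j + y).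
have e0 : box_energy q' 0 = 0.
  apply: (@box_energy_bounded0 _ (box_energy q') h M h0) => n.
  - by rewrite sumr_ge0 // => i _; rewrite sumr_ge0 // => j _; exact: gsq_ge0.
  - by apply: hP => [Y i j|i j]; [rewrite /q' af_rhs_shift st|exact: qA].
  - have -> : M * n.*2.+1%:R ^+ 2 = \sum_(i < n.*2.+1) \sum_(j < n.*2.+1) M.
      by rewrite !sumr_const !card_ord -mulrnA -[in RHS]mulr_natr natrM expr2.
    by apply: ler_sum => i _; apply: ler_sum => j _; exact: qM.
apply: vsq_eq0; apply/eqP; rewrite eq_le vsq_ge0 andbT.
rewrite -[leRHS]e0 /box_energy !big_ord_recl !big_ord0 !addr0 /gsq (bigD1 X) //= /q'.
by rewrite !add0r lerDl sumr_ge0 // => Y _; exact: vsq_ge0.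
Qed.

(** Together with [thirdy], the two factors $t^{-1}+4+t$ of the symbol of the operator $T$. *)
Definition thirdx (K : numFieldType) (w : int -> int -> K) (i j : int) : K :=
  w (i - 1) j + 4 * w i j + w (i + 1) j.
Definition thirdy (K : numFieldType) (w : int -> int -> K) (i j : int) : K :=
  w i (j - 1) + 4 * w i j + w i (j + 1).

(** Solving for the middle term gives $16|w_i|^2\le 2|w_{i-1}|^2+2|w_{i+1}|^2$, so any uniform bound
    on $|w|^2$ improves by a factor $4$, and this can be iterated. *)
Lemma dominant_eq0 (R : realType) (w : int -> R[i]) (M : R) :
  (forall i, nsq (w i) <= M) -> (forall i, w (i - 1) + 4 * w i + w (i + 1) = 0) ->
  forall i, w i = 0.
Proof.
move=> wM w0.
have dec n : forall i, 4 ^+ n * nsq (w i) <= M.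
  elim: n => [|n IH] i; first by rewrite mul1r.
  have e : 4 * w i = - (w (i - 1) + w (i + 1)).
    by apply/eqP; rewrite -addr_eq0 addrCA addrA; apply/eqP; exact: w0.
  have n4 : nsq (4 : R[i]) = 16 by rewrite -[4]/(4%:R) -(rmorph_nat (@real_complex R))
    /nsq /=; ring.
  have le16 : 16 * nsq (w i) <= 2 * nsq (w (i - 1)) + 2 * nsq (w (i + 1)).
    by rewrite -n4 -nsqM e nsqN nsqD.
  have p4 : 0 < 4 ^+ n :> R by rewrite exprn_gt0.
  have le4 := ler_wpM2l (ltW p4) le16.
  have := IH (i - 1); have := IH (i + 1); rewrite exprS; move: le4.
  by move: (4 ^+ n) (nsq (w i)) (nsq (w (i - 1))) (nsq (w (i + 1))) => e4 a b d; lra.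
move=> i; apply: nsq_eq0; apply/eqP; rewrite eq_le nsq_ge0 andbT.
apply: (@archimedean_le0 _ _ M) => n; apply: le_trans (dec n i).
rewrite ler_wpM2r ?nsq_ge0 // (_ : 4 = 1 + 3 :> R); last by ring.
by rewrite (le_trans _ (bernoulli n _)) //; have := ler0n R n; lra.
Qed.

Lemma thirdx_eq0 (R : realType) (w : int -> int -> R[i]) :
  nsq_bounded w -> (forall i j, thirdx w i j = 0) -> forall i j, w i j = 0.
Proof. by move=> [M wM] w0 i j; apply: (@dominant_eq0 _ (w ^~ j) M) => k;
  [exact: wM|exact: w0]. Qed.

Lemma thirdy_eq0 (R : realType) (w : int -> int -> R[i]) :
  nsq_bounded w -> (forall i j, thirdy w i j = 0) -> forall i j, w i j = 0.
Proof. by move=> [M wM] w0 i j; apply: (@dominant_eq0 _ (w i) M) => k;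
  [exact: wM|exact: w0]. Qed.

Lemma af_rhsD (K : numFieldType) (c dx dy : K) (q q' : grid K) X i j :
  af_rhs c dx dy (fun X i j => q X i j + q' X i j) X i j =
  af_rhs c dx dy q X i j + af_rhs c dx dy q' X i j.
Proof.
rewrite -[X in _ = X + _]scale1r -af_rhs_linear; congr (af_rhs c dx dy _ X i j).
by apply/funext => Y; apply/funext => k; apply/funext => l; rewrite scale1r.
Qed.

Lemma af_rhs_shiftx (K : numFieldType) (c dx dy : K) (q : grid K) m X i j :
  af_rhs c dx dy (fun X i j => q X (i + m) j) X i j = af_rhs c dx dy q X (i + m) j.
Proof.
have := af_rhs_shift c dx dy q m 0 X i j; rewrite addr0 => <-.
congr (af_rhs c dx dy _ X i j).
by apply/funext => Y; apply/funext => k; apply/funext => l; rewrite addr0.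
Qed.

Lemma af_rhs_shifty (K : numFieldType) (c dx dy : K) (q : grid K) n X i j :
  af_rhs c dx dy (fun X i j => q X i (j + n)) X i j = af_rhs c dx dy q X i (j + n).
Proof.
have := af_rhs_shift c dx dy q 0 n X i j; rewrite addr0 => <-.
congr (af_rhs c dx dy _ X i j).
by apply/funext => Y; apply/funext => k; apply/funext => l; rewrite addr0.
Qed.

Definition grid_thirdx (K : numFieldType) (q : grid K) : grid K :=
  fun X i j => 4 *: q X i j + (q X (i - 1) j + q X (i + 1) j).
Definition grid_thirdy (K : numFieldType) (q : grid K) : grid K :=
  fun X i j => 4 *: q X i j + (q X i (j - 1) + q X i (j + 1)).
Definition grid_sumx (K : numFieldType) (q : grid K) : grid K :=
  fun X i j => q X i j + q X (i + 1) j.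
Definition grid_sumy (K : numFieldType) (q : grid K) : grid K :=
  fun X i j => q X i j + q X i (j + 1).

Lemma grid_thirdx_stationary (K : numFieldType) (c dx dy : K) (q : grid K) :
  stationary c dx dy q -> stationary c dx dy (grid_thirdx q).
Proof.
move=> st X i j; rewrite af_rhs_linear af_rhsD !af_rhs_shiftx !st.
by rewrite scaler0 !addr0.
Qed.

Lemma grid_thirdy_stationary (K : numFieldType) (c dx dy : K) (q : grid K) :
  stationary c dx dy q -> stationary c dx dy (grid_thirdy q).
Proof.
move=> st X i j; rewrite af_rhs_linear af_rhsD !af_rhs_shifty !st.
by rewrite scaler0 !addr0.
Qed.

Lemma nsq_bounded_comp (R : realType) (w : int -> int -> R[i]) (f g : int -> int ->
  int) :
  nsq_bounded w -> nsq_bounded (fun i j => w (f i j) (g i j)).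
Proof. by move=> [M wM]; exists M. Qed.

Ltac bounded := repeat match goal with
  | |- nsq_bounded (fun i j => @?v i j + @?w i j) => refine (@nsq_boundedD _ v w _ _)
  | |- nsq_bounded (fun i j => - @?w i j) => refine (@nsq_boundedN _ w _)
  | |- nsq_bounded (fun i j => ?k * @?w i j) => refine (@nsq_boundedM _ k w _)
  | |- nsq_bounded (fun i j => @?w i j * ?k) => refine (@nsq_boundedMr _ k w _)
  | H : nsq_bounded ?w |- nsq_bounded (fun i j => ?w (@?f i j) (@?g i j)) =>
      exact (@nsq_bounded_comp _ w f g H)
  | H : bounded_grid ?q |- nsq_bounded (fun i j => fun_of_matrix (?q ?X (@?f i j) (@?g
    i j)) ?a 0) =>
      exact (@nsq_bounded_at _ q X f g a H)
  end.

Lemma thirdxy_eq0 (R : realType) (w : int -> int -> R[i]) :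
  nsq_bounded w -> (forall i j, thirdx (thirdy w) i j = 0) -> forall i j, w i j = 0.
Proof.
move=> wb w0; apply: thirdy_eq0 => //; apply: thirdx_eq0 => //.
by rewrite /thirdy; bounded.
Qed.

Lemma equil_bounded (R : realType) (c dx dy : R[i]) (phi : int -> int -> R[i]) X a :
  nsq_bounded phi -> nsq_bounded (fun i j => equil c dx dy phi X i j a 0).
Proof.
move=> pb; rewrite /equil; case: (dofP X) => -> /=; move: a; apply: ord3_ind.
all: under boolp.eq_fun do (under boolp.eq_fun do rewrite ?(col3_0, col3_1, col3_2)).
all: by bounded.
Qed.

(** The difference of both sides is bounded and stationary, and its average pressure vanishes
    because that of [equil] is $T\varphi/36$; hence the difference is zero. *)
Lemma bounded_stationary_equil (R : realType) (c dx dy : R) (q : grid R[i]) :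
  0 < c -> 0 < dx -> 0 < dy -> bounded_grid q -> stationary c%:C dx%:C dy%:C q ->
  grid_thirdx (grid_thirdy q) = equil c%:C dx%:C dy%:C (fun i j => 36 * cp q dA i j).
Proof.
move=> c0 dx0 dy0 qb st.
have cC0 : c%:C != 0 :> R[i] by rewrite fmorph_eq0 gt_eqF.
have dxC0 : dx%:C != 0 :> R[i] by rewrite fmorph_eq0 gt_eqF.
have dyC0 : dy%:C != 0 :> R[i] by rewrite fmorph_eq0 gt_eqF.
set phi := fun i j => _.
pose d : grid R[i] := fun X i j => -1 *: equil c%:C dx%:C dy%:C phi X i j +
  grid_thirdx (grid_thirdy q) X i j.
suff d0 : forall X i j, d X i j = 0.
  apply/funext => X; apply/funext => i; apply/funext => j.
  by have := d0 X i j; rewrite /d scaleN1r addrC => /subr0_eq.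
apply: (bounded_stationary_eq0 c0 dx0 dy0) => [X a|X i j|i j].
- have eb : nsq_bounded (fun i j => equil c%:C dx%:C dy%:C phi X i j a 0).
    by apply: equil_bounded; rewrite /phi /cp; bounded.
  rewrite /d; under boolp.eq_fun do (under boolp.eq_fun do rewrite !mxE).
  by bounded.
- rewrite af_rhs_linear equil_stationary // scaler0 add0r.
  by apply: grid_thirdx_stationary; apply: grid_thirdy_stationary.
- by rewrite /d /equil /= !mxE /= /phi /cp; field.
Qed.

(** $T$ commutes with the translation-invariant relations. Applied to the left side of each, it
    gives the same relation for [equil] data, which holds, and $T$ is injective on bounded
    functions. *)
Lemma bounded_stationary_discrete (R : realType) (c dx dy : R) (q : grid R[i]) :
  0 < c -> 0 < dx -> 0 < dy -> bounded_grid q -> stationary c%:C dx%:C dy%:C q ->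
  discrete_equilibrium c%:C dx%:C dy%:C q.
Proof.
move=> c0 dx0 dy0 qb st.
have cC0 : c%:C != 0 :> R[i] by rewrite fmorph_eq0 gt_eqF.
have dxC0 : dx%:C != 0 :> R[i] by rewrite fmorph_eq0 gt_eqF.
have dyC0 : dy%:C != 0 :> R[i] by rewrite fmorph_eq0 gt_eqF.
have := equil_discrete (fun i j => 36 * cp q dA i j) cC0 dxC0 dyC0.
rewrite -bounded_stationary_equil // => -[h1 h2 h3 h4 h5 h6 h7 h8 h9 h10 h11].
have gE X i j a : grid_thirdx (grid_thirdy q) X i j a 0 =
    thirdx (thirdy (fun i j => q X i j a 0)) i j.
  by rewrite !mxE /thirdx /thirdy; ring.
split; apply: thirdxy_eq0; try (by rewrite /cu /cv /cp; bounded); move=> i j.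
- rewrite -[RHS](h1 i j) /cu /cp !gE /thirdx /thirdy !shiftz; ring.
- rewrite -[RHS](h2 i j) /cv /cp !gE /thirdx /thirdy !shiftz; ring.
- rewrite -[RHS](h3 i j) /cv /cp !gE /thirdx /thirdy ?shiftz; ring.
- rewrite -[RHS](h4 i j) /cu /cp !gE /thirdx /thirdy ?shiftz; ring.
- rewrite -[RHS](h5 i j) /cu /cp !gE /thirdx /thirdy ?shiftz; ring.
- rewrite -[RHS](h6 i j) /cv /cp !gE /thirdx /thirdy ?shiftz; ring.
- rewrite -[RHS](h7 i j) /cu /cp !gE /thirdx /thirdy ?shiftz; ring.
- rewrite -[RHS](h8 i j) /cv /cp !gE /thirdx /thirdy ?shiftz; ring.
- rewrite -[RHS](h9 i j) /cp !gE /thirdx /thirdy ?shiftz; ring.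
- rewrite -[RHS](h10 i j) /cp !gE /thirdx /thirdy ?shiftz; ring.
- rewrite -[RHS](h11 i j) /cp !gE /thirdx /thirdy ?shiftz; ring.
Qed.

(** * Discrete equilibria without grid-scale modes *)

Lemma eq0D (K : pzRingType) (a b : K) : a = 0 -> b = 0 -> a + b = 0.
Proof. by move=> -> ->; rewrite addr0. Qed.

Lemma eq0M (K : pzRingType) (r a : K) : a = 0 -> r * a = 0.
Proof. by move=> ->; rewrite mulr0. Qed.

Lemma eq_lincomb (K : pzRingType) (x y e : K) : e = 0 -> x - y = e -> x = y.
Proof. by move=> -> /subr0_eq. Qed.

(** The relations are solved for $(1+t_x)(1+t_y)q$ in terms of $p^N$, by the linear combinations
    recorded in each [eq_lincomb]. *)
Lemma discrete_equil (R : realType) (c dx dy : R[i]) (q : grid R[i]) :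
  c != 0 -> dx != 0 -> dy != 0 -> bounded_grid q -> discrete_equilibrium c dx dy q ->
  grid_sumx (grid_sumy q) = equil c dx dy (fun i j => 4 * cp q dN i j).
Proof.
move=> c0 dx0 dy0 qb [uA vA vEH uEV uN vN uEH vEV pEV pEH pA].
pose s4 (e : int -> int -> R[i]) i j := e i j + e i (j + 1) + (e (i + 1) j + e (i + 1)
  (j + 1)).
have gE X i j a : grid_sumx (grid_sumy q) X i j a 0 = s4 (fun i j => q X i j a 0) i j.
  by rewrite !mxE.
have s40 (e : int -> int -> R[i]) : (forall i j, e i j = 0) -> forall i j, s4 e i j = 0.
  by move=> e0 i j; rewrite /s4 !e0 !addr0.
(* The relations for $u^A$ and $v^A$ determine the velocities only up to the factor $t^{-1}+4+t$,
   which is cancelled using boundedness. *)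
have uAE : forall i j, s4 (cu q dA) i j -
   (- ((cp q dN (i - 1) (j + 1) + 4 * cp q dN i (j + 1) + cp q dN (i + 1) (j + 1))
    - (cp q dN (i - 1) (j - 1) + 4 * cp q dN i (j - 1) + cp q dN (i + 1) (j - 1))) /
      (3 * c * dy)) = 0.
  apply: thirdy_eq0 => [|i j]; first by rewrite /s4 /cu /cp; bounded.
  apply: (eq_lincomb (eq0D (eq0M (6 / c) (s40 _ uA i j))
    (eq0D (eq0M (- 1 / (3 * c * dy)) (pA i (j + 1))) (eq0M (1 / (3 * c * dy)) (pA i (j
      - 1)))))).
  by rewrite /thirdy /s4 !shiftz; field; rewrite ?c0 ?dx0 ?dy0.
have vAE : forall i j, s4 (cv q dA) i j -
   ((cp q dN (i + 1) (j - 1) + 4 * cp q dN (i + 1) j + cp q dN (i + 1) (j + 1))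
    - (cp q dN (i - 1) (j - 1) + 4 * cp q dN (i - 1) j + cp q dN (i - 1) (j + 1))) /
      (3 * c * dx) = 0.
  apply: thirdx_eq0 => [|i j]; first by rewrite /s4 /cv /cp; bounded.
  apply: (eq_lincomb (eq0D (eq0M (6 / c) (s40 _ vA i j))
    (eq0D (eq0M (1 / (3 * c * dx)) (pA (i + 1) j)) (eq0M (- 1 / (3 * c * dx)) (pA (i -
      1) j))))).
  by rewrite /thirdx /s4 !shiftz; field; rewrite ?c0 ?dx0 ?dy0.
apply/funext => X; apply/funext => i; apply/funext => j; apply/colP => a; rewrite gE.
case: (dofP X) => -> /=; move: a; apply: ord3_ind.
all: rewrite /equil /= ?(col3_0, col3_1, col3_2).
- apply: (eq_lincomb (uAE i j)).
  by rewrite /s4 /cu ?shiftz; field; rewrite ?c0 ?dx0 ?dy0.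
- apply: (eq_lincomb (vAE i j)).
  by rewrite /s4 /cv ?shiftz; field; rewrite ?c0 ?dx0 ?dy0.
- apply: (eq_lincomb (eq0M (1 / 9) (pA i j))).
  by rewrite /s4 /cp ?shiftz; field; rewrite ?c0 ?dx0 ?dy0.
- apply: (eq_lincomb (eq0D (eq0M (2 / c) (eq0D (uEH i j) (uEH (i + 1) j)))
    (eq0D (eq0M (- 1 / (2 * c * dy)) (pEH i (j + 1))) (eq0M (1 / (2 * c * dy)) (pEH i
      j))))).
  by rewrite /s4 /cu ?shiftz; field; rewrite ?c0 ?dx0 ?dy0.
- apply: (eq_lincomb (eq0M (1 / c) (s40 _ vEH i j))).
  by rewrite /s4 /cv ?shiftz; field; rewrite ?c0 ?dx0 ?dy0.
- apply: (eq_lincomb (eq0M (1 / 4) (eq0D (pEH i j) (pEH i (j + 1))))).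
  by rewrite /s4 /cp ?shiftz; field; rewrite ?c0 ?dx0 ?dy0.
- apply: (eq_lincomb (eq0M (1 / c) (s40 _ uEV i j))).
  by rewrite /s4 /cu ?shiftz; field; rewrite ?c0 ?dx0 ?dy0.
- apply: (eq_lincomb (eq0D (eq0M (2 / c) (eq0D (vEV i j) (vEV i (j + 1))))
    (eq0D (eq0M (1 / (2 * c * dx)) (pEV (i + 1) j)) (eq0M (- 1 / (2 * c * dx)) (pEV i
      j))))).
  by rewrite /s4 /cv ?shiftz; field; rewrite ?c0 ?dx0 ?dy0.
- apply: (eq_lincomb (eq0M (1 / 4) (eq0D (pEV i j) (pEV (i + 1) j)))).
  by rewrite /s4 /cp ?shiftz; field; rewrite ?c0 ?dx0 ?dy0.
- apply: (eq_lincomb (eq0M (2 / c) (eq0D (uN i j) (uN (i + 1) j)))).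
  by rewrite /s4 /cu ?shiftz; field; rewrite ?c0 ?dx0 ?dy0.
- apply: (eq_lincomb (eq0M (2 / c) (eq0D (vN i j) (vN i (j + 1))))).
  by rewrite /s4 /cv ?shiftz; field; rewrite ?c0 ?dx0 ?dy0.
- by rewrite /s4 /cp ?shiftz; field; rewrite ?c0 ?dx0 ?dy0.
Qed.

Definition alternating_mean0 (R : realType) (w : int -> R[i]) : Prop :=
  forall eps : R, 0 < eps -> exists n0 : nat, forall n : nat, (n0 <= n)%N ->
  `|\sum_(m < n) (-1) ^+ m * w m%:Z| <= (n%:R * eps)%:C.

Lemma alternating_mean0D (R : realType) (v w : int -> R[i]) :
  alternating_mean0 v -> alternating_mean0 w -> alternating_mean0 (fun m => v m + w m).
Proof.
move=> hv hw e e0; have e2 : 0 < e / 2 by rewrite divr_gt0.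
have [n1 h1] := hv _ e2; have [n2 h2] := hw _ e2.
exists (maxn n1 n2) => n; rewrite geq_max => /andP[l1 l2].
under eq_bigr do rewrite mulrDr.
rewrite big_split (le_trans (ler_normD _ _)) //.
rewrite (_ : n%:R * e = n%:R * (e / 2) + n%:R * (e / 2)); last by field.
by rewrite rmorphD lerD ?h1 ?h2.
Qed.

Lemma alternating_mean0M (R : realType) k (w : int -> R[i]) :
  alternating_mean0 w -> alternating_mean0 (fun m => k * w m).
Proof.
move=> hw e e0.
have [K K0 kK] : exists2 K : R, 0 < K & `|k| <= K%:C.
  exists (complex.Re `|k| + 1).
    have : 0 <= `|k| by exact: normr_ge0.
    by rewrite lecE /= => /andP[_ h]; rewrite ltr_wpDl.
  have : 0 <= `|k| by exact: normr_ge0.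
  by rewrite !lecE /= => /andP[/eqP h _]; rewrite h eqxx lerDl ler01.
have [n0 h0] := hw (e / K) (divr_gt0 e0 K0).
exists n0 => n /h0 h.
under eq_bigr do rewrite mulrCA.
rewrite -mulr_sumr normrM (_ : n%:R * e = K * (n%:R * (e / K))); last by field;
  rewrite gt_eqF.
by rewrite rmorphM ler_pM.
Qed.

(** The recurrence makes $(-1)^mw_m$ constant, so its mean is $w_0$. *)
Lemma alternating_mean0_eq0 (R : realType) (w : int -> R[i]) :
  alternating_mean0 w -> (forall m, w m + w (m + 1) = 0) -> w 0 = 0.
Proof.
move=> hw w0; have alt (m : nat) : (-1) ^+ m * w m%:Z = w 0.
  elim: m => [|m IH]; first by rewrite mul1r.
  rewrite -IH exprS -mulrA mulrCA; congr (_ * _).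
  by rewrite mulN1r -addn1 PoszD; apply/eqP; rewrite eq_sym -addr_eq0 w0.
apply: nsq_eq0; apply/eqP; rewrite eq_le nsq_ge0 andbT.
apply/ler_addgt0Pl => e e0; rewrite addr0.
have se0 : 0 < Num.sqrt e by rewrite sqrtr_gt0.
have [n0 h0] := hw _ se0; have := h0 n0.+1 (leqnSn _).
under eq_bigr do rewrite alt.
rewrite sumr_const card_ord -[w 0 *+ _]mulr_natl normrM normr_nat rmorphM rmorph_nat
  ler_pM2l ?ltr0Sn //.
by move=> /nsq_le_norm; rewrite sqr_sqrtr // ltW.
Qed.

Definition gridscale_free (R : realType) (w : int -> int -> R[i]) : Prop :=
  forall i j, alternating_mean0 (fun m => w (i + m) j) /\ alternating_mean0 (fun m =>
    w i (j + m)).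

Lemma gridscale_freeD (R : realType) (v w : int -> int -> R[i]) :
  gridscale_free v -> gridscale_free w -> gridscale_free (fun i j => v i j + w i j).
Proof.
move=> hv hw i j; have [v1 v2] := hv i j; have [w1 w2] := hw i j.
by split; exact: alternating_mean0D.
Qed.

Lemma gridscale_freeM (R : realType) k (w : int -> int -> R[i]) :
  gridscale_free w -> gridscale_free (fun i j => k * w i j).
Proof. by move=> hw i j; have [w1 w2] := hw i j; split; exact: alternating_mean0M. Qed.

Lemma gridscale_free_shift (R : realType) k l (w : int -> int -> R[i]) :
  gridscale_free w -> gridscale_free (fun i j => w (i + k) (j + l)).
Proof.
move=> hw i j; have [w1 w2] := hw (i + k) (j + l).
by split=> e e0; [have [n0 h0] := w1 e e0|have [n0 h0] := w2 e e0]; exists n0 => n /h0;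
  under eq_bigr do rewrite addrAC.
Qed.

Lemma gridscale_free_ext (R : realType) (v w : int -> int -> R[i]) :
  (forall i j, v i j = w i j) -> gridscale_free v -> gridscale_free w.
Proof.
by move=> e; rewrite (_ : v = w) //; apply/funext => i; apply/funext => j.
Qed.

(** The factors $1+t_x$ and $1+t_y$ are cancelled one after the other. *)
Lemma gridscale_free_eq0 (R : realType) (w : int -> int -> R[i]) : gridscale_free w ->
  (forall i j, w i j + w i (j + 1) + (w (i + 1) j + w (i + 1) (j + 1)) = 0) ->
  forall i j, w i j = 0.
Proof.
move=> hw w0.
have hs : gridscale_free (fun i j => w i j + w i (j + 1)).
  apply: gridscale_freeD => //.
  by apply: gridscale_free_ext (gridscale_free_shift 0 1 hw) => i j; rewrite addr0.
have s0 i j : w i j + w i (j + 1) = 0.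
  rewrite -(addr0 i); apply: (alternating_mean0_eq0 (w := fun m => w (i + m) j + w (i
    + m) (j + 1))).
    by have [h _] := hs i j.
  by move=> m; rewrite (addrA i) w0.
move=> i j; rewrite -(addr0 j); apply: (alternating_mean0_eq0 (w := fun m => w i (j +
  m))).
  by have [_ h] := hw i j.
by move=> m; rewrite (addrA j) s0.
Qed.

Lemma af_rhs_gridscale_free (R : realType) (c dx dy : R[i]) (q : grid R[i]) X a :
  no_gridscale_mode q -> gridscale_free (fun i j => af_rhs c dx dy q X i j a 0).
Proof.
move=> ng; pose free (F : int -> int -> 'cV[R[i]]_3) :=
  forall a, gridscale_free (fun i j => F i j a 0).
suff : free (fun i j => af_rhs c dx dy q X i j) by apply.
have fq Y : free (fun i j => q Y i j).
  move=> b i j; split=> e e0; have [n0 h] := ng Y i j b e e0;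
    exists n0 => n /h[h1 h2] //.
have fS Y m n : free (fun i j => q Y (i + m) (j + n)).
  by move=> b; exact: (gridscale_free_shift m n (fq Y b)).
have freex Y m : free (fun i j => q Y (i + m) j).
  by move=> b; apply: gridscale_free_ext (fS Y m 0 b) => i j; rewrite addr0.
have freey Y n : free (fun i j => q Y i (j + n)).
  by move=> b; apply: gridscale_free_ext (fS Y 0 n b) => i j; rewrite addr0.
have fD F G : free F -> free G -> free (fun i j => F i j + G i j).
  by move=> hF hG b; apply: gridscale_free_ext (gridscale_freeD (hF b) (hG b)) => i j;
    rewrite mxE.
have fZ k F : free F -> free (fun i j => k *: F i j).
  by move=> hF b; apply: gridscale_free_ext (gridscale_freeM k (hF b)) => i j;
    rewrite mxE.
have fN F : free F -> free (fun i j => - F i j).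
  by move=> hF b; apply: gridscale_free_ext (fZ (-1) F hF b) => i j; rewrite scaleN1r.
have fM (A : 'M[R[i]]_3) F : free F -> free (fun i j => A *m F i j).
  move=> hF b; have hA d := gridscale_freeM (A b d) (hF d).
  apply: gridscale_free_ext (gridscale_freeD (hA 0) (gridscale_freeD (hA 1) (hA 2)))
    => i j.
  by rewrite mxE !big_ord_recl big_ord0 addr0;
    congr (_ * F i j _ 0 + (_ * F i j _ 0 + _ * F i j _ 0));
    try congr (A b _); exact/val_inj.
rewrite /af_rhs /rhsA /rhsP /fx /fy /DxEH /DypEH /DymEH /DxpEV /DxmEV /DyEV.
rewrite /DxpN /DxmN /DypN /DymN.
case: (X == dA); [|case: (X == dEH); [|case: (X == dEV)]]; repeat match goal with
  | |- free (fun i j => @?F i j + @?G i j) => refine (fD F G _ _)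
  | |- free (fun i j => - @?F i j) => refine (fN F _)
  | |- free (fun i j => ?k *: @?F i j) => refine (fZ k F _)
  | |- free (fun i j => ?A *m @?F i j) => refine (fM A F _)
  | |- free (fun i j => q ?Y i j) => exact (fq Y)
  | |- free (fun i j => q ?Y (i + ?m) j) => exact (freex Y m)
  | |- free (fun i j => q ?Y i (j + ?n)) => exact (freey Y n)
  | |- free (fun i j => q ?Y (i + ?m) (j + ?n)) => exact (fS Y m n)
  end.
Qed.

(** The residual $r$ of [q] satisfies $(1+t_x)(1+t_y)r=0$, as this is the residual of [equil] data;
    it inherits the absence of grid-scale modes, so the factor cancels. *)
Lemma discrete_stationary (R : realType) (c dx dy : R[i]) (q : grid R[i]) :
  c != 0 -> dx != 0 -> dy != 0 -> bounded_grid q -> no_gridscale_mode q ->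
  discrete_equilibrium c dx dy q -> stationary c dx dy q.
Proof.
move=> c0 dx0 dy0 qb ng de X i j; apply/colP => a; rewrite [RHS]mxE; move: i j.
apply: gridscale_free_eq0; first exact: af_rhs_gridscale_free.
move=> i j; have := equil_stationary (fun i j => 4 * cp q dN i j) c0 dx0 dy0 X i j.
rewrite -discrete_equil // /grid_sumx af_rhsD af_rhs_shiftx /grid_sumy !af_rhsD
  !af_rhs_shifty.
by move: (af_rhs c dx dy q) => r /(congr1 (fun v : 'cV_3 => v a 0)); rewrite !mxE.
Qed.

(** * Kernel and consistency *)

Local Open Scope classical_set_scope.

Lemma equil_scale_shift (K : numFieldType) (c dx dy k : K) (phi : int -> int -> K) X i
  j :
  (forall i' j', phi (i' + i) (j' + j) = k * phi i' j') ->
  equil c dx dy phi X i j = k *: equil c dx dy phi X 0 0.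
Proof.
move=> hp.
have e0 m n : phi (i + m) (j + n) = k * phi m n by rewrite -hp [m + i]addrC [n +
  j]addrC.
have e1 n : phi i (j + n) = k * phi 0 n by rewrite -e0 addr0.
have e2 m : phi (i + m) j = k * phi m 0 by rewrite -e0 addr0.
have e3 : phi i j = k * phi 0 0 by rewrite -e0 !addr0.
case: (dofP X) => ->; rewrite /equil /= col3Z !add0r !e0 ?e1 ?e2 ?e3.
all: by apply: col3_inj; ring.
Qed.

Lemma expi_third_neq0 (R : realType) (x : R) : (expi x)^-1 + 4 + expi x != 0.
Proof.
have -> : (expi x)^-1 + 4 + expi x = (4 + 2 * cos x)%:C.
  by rewrite rmorphD rmorphM !rmorph_nat /= cos_expi; field; rewrite ?expi_neq0.
by rewrite fmorph_eq0 gt_eqF //; have := cos_geN1 x; lra.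
Qed.

(** The kernel vector is the amplitude of [equil] for the potential $t_x^it_y^j$, which is again a
    mode. It is nonzero since its mean pressure is $(t_x^{-1}+4+t_x)(t_y^{-1}+4+t_y)/36$. *)
Lemma evolution_kernel_nontrivial (R : realType) (c dx dy : R) :
  0 < c -> 0 < dx -> 0 < dy -> kernel_nontrivial c dx dy.
Proof.
move=> c0 dx0 dy0 kx ky.
have cC0 : c%:C != 0 :> R[i] by rewrite fmorph_eq0 gt_eqF.
have dxC0 : dx%:C != 0 :> R[i] by rewrite fmorph_eq0 gt_eqF.
have dyC0 : dy%:C != 0 :> R[i] by rewrite fmorph_eq0 gt_eqF.
have tx0 := expi_neq0 (kx * dx); have ty0 := expi_neq0 (ky * dy).
have nx := expi_third_neq0 (kx * dx); have ny := expi_third_neq0 (ky * dy).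
move: (expi (kx * dx)) (expi (ky * dy)) tx0 ty0 nx ny => tx ty tx0 ty0 nx ny.
pose phi i j : R[i] := tx ^ i * ty ^ j.
pose q := equil c%:C dx%:C dy%:C phi.
have qE : mode tx ty (pack (fun X => q X 0 0)) = q.
  apply/funext => X; apply/funext => i; apply/funext => j.
  rewrite /mode packK; apply/esym/equil_scale_shift => i' j'.
  by rewrite /phi !expfzDr //; ring.
exists (pack (fun X => q X 0 0)).
  apply/eqP => q0; have := packK (fun X => q X 0 0) dA; rewrite q0.
  move=> /(congr1 (fun w : 'cV_3 => w ic 0));
    rewrite /q /equil /= col3_2 !mxE => /esym/eqP.
  rewrite /phi !add0r !expr0z !expr1z !exprN1.
  apply/negP; rewrite (_ : _ / 36 = (tx^-1 + 4 + tx) * (ty^-1 + 4 + ty) / 36);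
    last by field; rewrite ?tx0 ?ty0.
  by rewrite !mulf_neq0 // invr_eq0 pnatr_eq0.
apply: unpack_eq0 => X a.
have := af_rhs_mode0 c%:C dx%:C dy%:C (pack (fun X => q X 0 0)) X tx0 ty0.
rewrite qE equil_stationary // => /esym/eqP; rewrite oppr_eq0 => /eqP ->.
by rewrite mxE.
Qed.

(** * Convergence of the explicit stationary data to the geostrophic equilibria *)

Lemma uniform_modulus (R : realType) (w : R -> R -> R) (r eps : R) :
  continuous (fun z : R * R => w z.1 z.2) -> 0 < eps ->
  exists2 d : R, 0 < d & forall x y x' y', `|x| <= r -> `|y| <= r ->
    `|x' - x| <= d -> `|y' - y| <= d -> `|w x' y' - w x y| <= eps.
Proof.
move=> cw e0.
(* Only the base point is confined to the compact square; the nearby point may leave it, as stencil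
   points do. *)
pose P (d : R) (z : R * R) := forall x' y', `|x' - z.1| <= d -> `|y' - z.2| <= d ->
  `|w x' y' - w z.1 z.2| <= eps.
have cK : compact (`[- r, r] `*` `[- r, r] : set (R * R)).
  by have cM : compact (`[- r, r] : set R) := @segment_compact R _ _;
    exact: (compact_setX cM cM).
have : \forall d \near 0^'+, (`[- r, r] `*` `[- r, r] : set (R * R)) `<=` P d.
  move/compact_near_coveringP: cK; apply => z0 _.
  have e2 : 0 < eps / 2 by rewrite divr_gt0.
  have /cvgrPdist_le/(_ _ e2) := cw z0.
  rewrite -nbhs_ballE => -[d /= d0 dP].
  have d2 : 0 < d / 2 by rewrite divr_gt0.
  exists (ball z0 (d / 2), [set m | m < d / 2]) => /=.
    by split; [exact: nbhsx_ballx|exact: nbhs_right_lt].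
  move=> [[x y] m] /= [[/= hx hy] hm] x' y' /= hx' hy'.
  rewrite /ball /= in hx hy.
  have near0 x1 y1 : `|z0.1 - x1| < d -> `|z0.2 - y1| < d -> `|w z0.1 z0.2 - w x1 y1|
    <= eps / 2.
    by move=> h1 h2; apply: (dP (x1, y1)); split.
  have h1 : `|w z0.1 z0.2 - w x y| <= eps / 2 by apply: near0; [move: hx|move: hy]; lra.
  have h2 : `|w z0.1 z0.2 - w x' y'| <= eps / 2.
    apply: near0; [move: hx hx'|move: hy hy']; rewrite !ltr_norml !ler_norml.
      by move=> /andP[a1 a2] /andP[b1 b2]; apply/andP; split; lra.
    by move=> /andP[a1 a2] /andP[b1 b2]; apply/andP; split; lra.
  move: h1 h2; rewrite !ler_norml => /andP[a1 a2] /andP[b1 b2].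
  by apply/andP; split; lra.
move=> near0; have [d [d0 dP]] : exists d : R, 0 < d /\ `[- r, r] `*` `[- r, r] `<=` P
  d.
  apply: (@filter_ex _ (0 : R)^'+); near=> m; split; first by near: m;
    exact: nbhs_right_gt.
  by near: m.
exists d => // x y x' y' hx hy; apply: (dP (x, y)).
by split; rewrite /= in_itv /= -ler_norml.
Unshelve. all: by end_near.
Qed.

Lemma bounded_on_square (R : realType) (w : R -> R -> R) (r : R) :
  continuous (fun z : R * R => w z.1 z.2) ->
  exists2 B : R, 0 < B & forall x y, `|x| <= r -> `|y| <= r -> `|w x y| <= B.
Proof.
move=> cw.
have cK : compact (`[- r, r] `*` `[- r, r] : set (R * R)).
  by have cM : compact (`[- r, r] : set R) := @segment_compact R _ _;
    exact: (compact_setX cM cM).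
have : \forall B \near +oo, (`[- r, r] `*` `[- r, r] : set (R * R)) `<=`
    [set z | `|w z.1 z.2| <= B].
  move/compact_near_coveringP: cK; apply => z0 _.
  have /cvgrPdist_le/(_ _ ltr01) near1 := cw z0.
  exists ([set z | `|w z0.1 z0.2 - w z.1 z.2| <= 1], [set B | `|w z0.1 z0.2| + 1 < B])
    => /=.
    by split => //; exact: nbhs_pinfty_gt.
  move=> [z B] /= [h1 h2]; rewrite -(subKr (w z0.1 z0.2) (w z.1 z.2)).
  by rewrite (le_trans (ler_normB _ _)) // (le_trans _ (ltW h2)) // lerD2l.
move=> nearB; have [B [B0 BP]] : exists B : R, 0 < B /\ `[- r, r] `*` `[- r, r] `<=`
  [set z | `|w z.1 z.2| <= B].
  apply: (@filter_ex _ (+oo : set_system R)); near=> B; split; first by near: B;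
    exact: nbhs_pinfty_gt.
  by near: B.
exists B => // x y hx hy; apply: (BP (x, y)).
by split; rewrite /= in_itv /= -ler_norml.
Unshelve. all: by end_near.
Qed.

Lemma mean_value (R : realType) (f df : R -> R) (a b : R) :
  (forall x : R, is_derive x 1 f (df x)) ->
  exists2 xi, `|xi - a| <= `|b - a| & f b - f a = df xi * (b - a).
Proof.
move=> fd; have cf : continuous f.
  by move=> x; apply: differentiable_continuous; apply/derivable1_diffP;
    have [] := fd x.
have [ab|ab|<-] := ltgtP a b; last by exists a; rewrite ?subrr ?normr0 // mulr0.
  have [xi + e] := MVT ab (fun x _ => fd x) (continuous_subspaceT cf).
  rewrite in_itv /= => /andP[h1 h2]; exists xi => //.
  by rewrite !ger0_norm ?subr_ge0 ?lerD2r ltW.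
have [xi + e] := MVT ab (fun x _ => fd x) (continuous_subspaceT cf).
rewrite in_itv /= => /andP[h1 h2]; exists xi.
  have nE s : s < a -> `|s - a| = a - s by move=> sa;
    rewrite distrC gtr0_norm ?subr_gt0.
  by rewrite !nE // lerD2l lerN2 ltW.
by rewrite -[LHS]opprB e -mulrN opprB.
Qed.

(** By the mean value theorem a difference quotient of $p$, divided by $c$, is a velocity at an
    intermediate point, so continuity of the velocities suffices. Bounded velocities control the
    variation of $p$ itself. *)
Lemma equilibrium_modulus (R : realType) (c r eps : R) (u v p : R -> R -> R) :
  0 < c -> 0 < eps -> geostrophic_equilibrium c u v p ->
  exists2 d : R, 0 < d & forall x y, `|x| <= r -> `|y| <= r ->
  [/\ (forall x' y', `|x' - x| <= d -> `|y' - y| <= d -> `|p x' y' - p x y| <= eps),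
      (forall x' y1 y2, `|x' - x| <= d -> `|y1 - y| <= d -> `|y2 - y| <= d -> y1 < y2 ->
        `|- (p x' y2 - p x' y1) / (c * (y2 - y1)) - u x y| <= eps) &
      (forall x1 x2 y', `|x1 - x| <= d -> `|x2 - x| <= d -> `|y' - y| <= d -> x1 < x2 ->
        `|(p x2 y' - p x1 y') / (c * (x2 - x1)) - v x y| <= eps)].
Proof.
move=> c0 e0 [cu cv dpx dpy].
have [du du0 duP] := uniform_modulus r cu e0.
have [dv dv0 dvP] := uniform_modulus r cv e0.
have [Bu Bu0 BuP] := bounded_on_square (r + 1) cu.
have [Bv Bv0 BvP] := bounded_on_square (r + 1) cv.
have cB : 0 < c * (Bu + Bv) by rewrite mulr_gt0 ?addr_gt0.
(* An intermediate point lies within $2d$ of an endpoint and so within $3d$ of the base point,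
   whence the thirds; the bound $1$ keeps points in the enlarged square; the last term makes the
   change of $p$ at most [eps]. *)
pose d := Num.min (Num.min (du / 3) (dv / 3)) (Num.min 1 (eps / (c * (Bu + Bv)))).
have d0 : 0 < d by rewrite !lt_min ltr01 !divr_gt0.
have : d <= d by []; rewrite {2}/d !le_min => /andP[/andP[ddu ddv] /andP[d1 de]].
exists d => // x y hx hy.
have close (a a' b : R) : `|a - b| <= d -> `|a' - b| <= d -> forall t, `|t - a| <=
  `|a' - a| ->
    `|t - b| <= du /\ `|t - b| <= dv.
  move=> ha ha' t ht.
  have h2 : `|a' - a| <= 2 * d.
    by move: ha ha'; rewrite !ler_norml => /andP[? ?] /andP[? ?]; apply/andP; split;
      lra.
  have h3 : `|t - b| <= 3 * d.
    by move: (le_trans ht h2) ha; rewrite !ler_norml => /andP[? ?] /andP[? ?];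
      apply/andP; split; lra.
  by split; apply: le_trans h3 _; lra.
split=> [x' y' hx' hy'|x' y1 y2 hx' h1 h2 y12|x1 x2 y' h1 h2 hy' x12].
(* The path from $(x,y)$ to $(x',y')$ goes through $(x,y')$, so partial derivatives are enough. *)
- have [xi hxi ex] := mean_value x x' (fun t => dpx t y').
  have [eta heta ey] := mean_value y y' (fun t => dpy x t).
  have r1 (a b t : R) : `|a| <= r -> `|b - a| <= d -> `|t - a| <= `|b - a| -> `|t| <=
    r + 1.
    move=> ha hb ht; move: ha (le_trans (le_trans ht hb) d1).
    by rewrite !ler_norml => /andP[? ?] /andP[? ?]; apply/andP; split; lra.
  have hv : `|v xi y'| <= Bv by apply: BvP; [exact: (r1 x x')|exact: (r1 y y')].
  have hu : `|u x eta| <= Bu.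
    by apply: BuP; [apply: (le_trans hx); lra|exact: (r1 y y')].
  have -> : p x' y' - p x y = c * v xi y' * (x' - x) + - (c * u x eta) * (y' - y).
    by rewrite -ex -ey; ring.
  rewrite (le_trans (ler_normD _ _)) // !normrM normrN normrM (gtr0_norm c0).
  apply: (@le_trans _ _ (c * Bv * d + c * Bu * d)).
    by apply: lerD; apply: ler_pM => //; first [by rewrite mulr_ge0 // ltW | by
      rewrite ler_pM2l].
  by move: de; rewrite ler_pdivlMr //; lra.
- have [eta heta ey] := mean_value y1 y2 (fun t => dpy x' t).
  have y21 : y2 - y1 != 0 by rewrite subr_eq0 gt_eqF.
  rewrite ey (_ : _ / _ = u x' eta); last by field; rewrite y21 gt_eqF.
  apply: duP => //; last by have [] := close _ _ _ h1 h2 _ heta.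
  by apply: le_trans hx' _; lra.
- have [xi hxi ex] := mean_value x1 x2 (fun t => dpx t y').
  have x21 : x2 - x1 != 0 by rewrite subr_eq0 gt_eqF.
  rewrite ex (_ : _ / _ = v xi y'); last by field; rewrite x21 gt_eqF.
  apply: dvP => //; first by have [] := close _ _ _ h1 h2 _ hxi.
  by apply: le_trans hy' _; lra.
Qed.

Lemma convex2 (R : realType) (a b t e : R) :
  `|a - t| <= e -> `|b - t| <= e -> `|(a + b) / 2 - t| <= e.
Proof. by rewrite !ler_norml => /andP[? ?] /andP[? ?]; apply/andP; split; lra. Qed.

Lemma convex3 (R : realType) (w a b d t e : R) : 0 <= w ->
  `|a - t| <= e -> `|b - t| <= e -> `|d - t| <= e -> `|(a + w * b + d) / (2 + w) - t|
    <= e.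
Proof.
move=> w0; have w2 : 0 < 2 + w by rewrite ltr_wpDr.
rewrite !ler_norml => /andP[a1 a2] /andP[b1 b2] /andP[d1 d2].
have := ler_wpM2l w0 b1; have := ler_wpM2l w0 b2.
by move=> ? ?; apply/andP; split; rewrite ?lerBrDr ?lerBlDr ?ler_pdivlMr ?ler_pdivrMr
  //; lra.
Qed.

Lemma equil_discretizes (R : realType) (c : R) : 0 < c -> discretizes_equilibria c.
Proof.
move=> c0 u v p eqp r eps e0.
have [d d0 dP] := equilibrium_modulus r c0 e0 eqp.
(* Stencil points are at most $3/2$ cells from the location of a degree of freedom in each
   direction, so steps below $d/2$ stay within $d$. *)
exists (d / 2) => [|dx dy /andP[dx0 dxd] /andP[dy0 dyd]]; first by rewrite divr_gt0.
have cN : c != 0 by rewrite gt_eqF.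
have dxN : dx != 0 by rewrite gt_eqF.
have dyN : dy != 0 by rewrite gt_eqF.
exists (equil c dx dy (fun i j => p (i%:~R * dx) (j%:~R * dy)));
  first exact: equil_stationary.
move=> X i j x y hx hy.
have [pP uP vP] := dP x y hx hy.
have near (h : R) (k : int) (b : bool) : 0 < h -> h < d / 2 ->
    [/\ `|(k - 1)%:~R * h - (k%:~R * h + (if b then h / 2 else 0))| <= d,
       `|k%:~R * h - (k%:~R * h + (if b then h / 2 else 0))| <= d &
       `|(k + 1)%:~R * h - (k%:~R * h + (if b then h / 2 else 0))| <= d].
  move=> h0 hd; rewrite intrB intrD !ler_norml.
  by case: b; split; apply/andP; split; lra.
have [xm x0 xp] := near dx i ((X == dEV) || (X == dN)) dx0 dxd.
have [ym y0 yp] := near dy j ((X == dEH) || (X == dN)) dy0 dyd.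
rewrite -/(grid_x dx X i) -/x in xm x0 xp; rewrite -/(grid_y dy X j) -/y in ym y0 yp.
clearbody x y.
have xpE : (i + 1)%:~R * dx = i%:~R * dx + dx by rewrite intrD mulrDl mul1r.
have xmE : (i - 1)%:~R * dx = i%:~R * dx - dx by rewrite intrB mulrBl mul1r.
have ypE : (j + 1)%:~R * dy = j%:~R * dy + dy by rewrite intrD mulrDl mul1r.
have ymE : (j - 1)%:~R * dy = j%:~R * dy - dy by rewrite intrB mulrBl mul1r.
rewrite xpE in xp; rewrite xmE in xm; rewrite ypE in yp; rewrite ymE in ym.
rewrite /equil; case: (dofP X) => -> /=; apply: ord3_ind;
  rewrite !(col3_0, col3_1, col3_2) ?xpE ?xmE ?ypE ?ymE.
all: move: (i%:~R * dx) (j%:~R * dy) x0 y0 xp xm yp ym => x1 y1 x0 y0 xp xm yp ym.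
all: have w4 : 0 <= 4 :> R by [].
all: have w6 : 0 <= 6 :> R by [].
all: have xlt1 : x1 < x1 + dx by rewrite ltrDl.
all: have ylt1 : y1 < y1 + dy by rewrite ltrDl.
all: have xlt2 : x1 - dx < x1 + dx by lra.
all: have ylt2 : y1 - dy < y1 + dy by lra.
all: have U2 k hk := uP k _ _ hk ym yp ylt2.
all: have U1 k hk := uP k _ _ hk y0 yp ylt1.
all: have V2 k hk := vP _ _ k xm xp hk xlt2.
all: have V1 k hk := vP _ _ k x0 xp hk xlt1.
all: rewrite (_ : y1 + dy - (y1 - dy) = 2 * dy) in U2; last by ring.
all: rewrite (_ : y1 + dy - y1 = dy) in U1; last by ring.
all: rewrite (_ : x1 + dx - (x1 - dx) = 2 * dx) in V2; last by ring.
all: rewrite (_ : x1 + dx - x1 = dx) in V1; last by ring.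
(* In all twelve components, averaging with weights $1,4,1$ or $1,6,1$ or $1,1$ preserves the error
   bound of the pressure values or difference quotients. *)
- have := convex3 w4 (U2 _ xm) (U2 _ x0) (U2 _ xp).
  by congr (`|_ - _| <= _); field; rewrite ?cN ?dyN.
- have := convex3 w4 (V2 _ ym) (V2 _ y0) (V2 _ yp).
  by congr (`|_ - _| <= _); field; rewrite ?cN ?dxN.
- have := convex3 w4 (convex3 w4 (pP _ _ xm ym) (pP _ _ xm y0) (pP _ _ xm yp))
    (convex3 w4 (pP _ _ x0 ym) (pP _ _ x0 y0) (pP _ _ x0 yp))
    (convex3 w4 (pP _ _ xp ym) (pP _ _ xp y0) (pP _ _ xp yp)).
  by congr (`|_ - _| <= _); field.
- have := convex3 w6 (U1 _ xm) (U1 _ x0) (U1 _ xp).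
  by congr (`|_ - _| <= _); field; rewrite ?cN ?dyN.
- have := convex2 (V2 _ y0) (V2 _ yp).
  by congr (`|_ - _| <= _); field; rewrite ?cN ?dxN.
- have := convex2 (convex3 w6 (pP _ _ xm y0) (pP _ _ x0 y0) (pP _ _ xp y0))
    (convex3 w6 (pP _ _ xm yp) (pP _ _ x0 yp) (pP _ _ xp yp)).
  by congr (`|_ - _| <= _); field.
- have := convex2 (U2 _ x0) (U2 _ xp).
  by congr (`|_ - _| <= _); field; rewrite ?cN ?dyN.
- have := convex3 w6 (V1 _ ym) (V1 _ y0) (V1 _ yp).
  by congr (`|_ - _| <= _); field; rewrite ?cN ?dxN.
- have := convex2 (convex3 w6 (pP _ _ x0 ym) (pP _ _ x0 y0) (pP _ _ x0 yp))
    (convex3 w6 (pP _ _ xp ym) (pP _ _ xp y0) (pP _ _ xp yp)).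
  by congr (`|_ - _| <= _); field.
- have := convex2 (U1 _ x0) (U1 _ xp).
  by congr (`|_ - _| <= _); field; rewrite ?cN ?dyN.
- have := convex2 (V1 _ y0) (V1 _ yp).
  by congr (`|_ - _| <= _); field; rewrite ?cN ?dxN.
- have := convex2 (convex2 (pP _ _ x0 y0) (pP _ _ x0 yp)) (convex2 (pP _ _ xp y0) (pP
  _ _ xp yp)).
  by congr (`|_ - _| <= _); field.
Qed.

Local Close Scope classical_set_scope.

Theorem corollary4p1 (R : realType) (c dx dy : R)
    (hc : 0 < c) (hdx : 0 < dx) (hdy : 0 < dy) :
  stationarity_preserving c /\
  (forall q : grid R[i], bounded_grid q ->
    stationary c%:C dx%:C dy%:C q -> discrete_equilibrium c%:C dx%:C dy%:C q) /\
  (forall q : grid R[i], bounded_grid q -> no_gridscale_mode q ->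
    (stationary c%:C dx%:C dy%:C q <->
     discrete_equilibrium c%:C dx%:C dy%:C q)).
Proof.
split; first by split; [exact: equil_discretizes|move=> *;
  exact: evolution_kernel_nontrivial].
split=> [q qb|q qb ng]; first exact: bounded_stationary_discrete.
split; first exact: bounded_stationary_discrete.
by apply: discrete_stationary => //; rewrite fmorph_eq0 gt_eqF.
Qed.
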